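(* Let $d\in\mathbb{N}$, $1 < p < \infty$, $\alpha_i > 0$, $0 < q_i \leq \infty$, and $b_i > 1/q_i$ for $i = 0,1$. Then $$\mathrm{Lip}^{(\alpha_0,-b_0)}_{p,q_0}(\mathbb{R}^d) \hookrightarrow \mathrm{Lip}^{(\alpha_1,-b_1)}_{p,q_1}(\mathbb{R}^d)$$ if and only if one of the following conditions holds: (a) $\alpha_0 > \alpha_1$; (b) $\alpha_0 = \alpha_1$ and $b_1 -\frac{1}{q_1} > b_0 -\frac{1}{q_0}$; (c) $\alpha_0 = \alpha_1$, $b_1 -\frac{1}{q_1} = b_0 -\frac{1}{q_0}$ and $q_0 \leq q_1$. The corresponding result with $\mathbb{R}^d$ replaced by $\mathbb{T}^d$ also holds true.
   Context: $A\hookrightarrow B$ means $A\subset B$ with continuous inclusion; $1/\infty=0$. Modulus of smoothness: for $\alpha>0$, $h\in\mathbb{R}^d$, $\Delta^\alpha_h f(x)=\sum_{j=0}^\infty(-1)^j\binom{\alpha}{j}f(x+(\alpha-j)h)$, where $\binom{\alpha}{j}=\frac{\alpha(\alpha-1)\cdots(\alpha-j+1)}{j!}$, $\binom{\alpha}{0}=1$, and for $f\in L_p(\mathbb{R}^d)$, $\omega_\alpha(f,t)_p=\sup_{|h|\le t}\|\Delta_h^\alpha f\|_{L_p(\mathbb{R}^d)}$, $t>0$. Logarithmic Lipschitz space: $\mathrm{Lip}^{(\alpha,-b)}_{p,q}(\mathbb{R}^d)$ is the set of $f\in L_p(\mathbb{R}^d)$ with $$\|f\|_{\mathrm{Lip}^{(\alpha,-b)}_{p,q}}=\|f\|_{L_p}+\Big(\int_0^1\big(t^{-\alpha}(1-\log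 t)^{-b}\omega_\alpha(f,t)_p\big)^q\frac{dt}{t}\Big)^{1/q}<\infty$$ (supremum over $0<t<1$ if $q=\infty$). The periodic space $\mathrm{Lip}^{(\alpha,-b)}_{p,q}(\mathbb{T}^d)$ is defined by the same formulas with $L_p(\mathbb{R}^d)$ replaced by $L_p(\mathbb{T}^d)$. *)

(* Defs.v *)
From HB Require Import structures.
From mathcomp Require Export all_boot all_order all_algebra.
From mathcomp.real_closed Require Export complex.
From mathcomp Require Export all_classical all_reals all_analysis.
Export Order.TTheory GRing.Theory Num.Theory.
Export numFieldNormedType.Exports.

Set Implicit Arguments.
Unset Strict Implicit.
Unset Printing Implicit Defensive.

Local Open Scope classical_set_scope.
Local Open Scope ring_scope.

(** The space R^d, with the product (Borel) sigma-algebra of the library. *)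

Notation space R d := (d.-tuple (measurableTypeR R)) (only parsing).

(** Lebesgue measure on R^d, as the iterated product of [lebesgue_measure]:
    [leb 0] is the unit mass on the one-point space and [leb d.+1] is the image
    of [lebesgue_measure \x leb d] under (x, v) |-> x :: v.  The product
    measure needs a sigma-finite second factor, hence the instances. *)

Section lebesgue_measure_space.
Context {R : realType}.

Definition consX d (z : measurableTypeR R * space R d) : space R d.+1 :=
  [tuple of z.1 :: z.2].

Definition unconsX d (v : space R d.+1) : measurableTypeR R * space R d :=
  (thead v, [tuple of behead v]).

Lemma consXK d : cancel (@consX d) (@unconsX d).
Proof. by case=> x v; congr pair; exact: val_inj. Qed.

Lemma measurable_consX d : measurable_fun [set: _] (@consX d).
Proof. exact: measurable_cons. Qed.

Lemma measurable_unconsX d : measurable_fun [set: _] (@unconsX d).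
Proof.
by apply/measurable_fun_pairP; split;
  [exact: measurable_tnth|exact: measurable_behead].
Qed.

Section step.
Variables (d : nat) (mu : {sigma_finite_measure set (space R d) -> \bar R}).

Definition lebS : set (space R d.+1) -> \bar R :=
  pushforward (lebesgue_measure \x mu)%E (@consX d).

HB.instance Definition _ := Measure.copy lebS
  (measure_function_pushforward__canonical__measure_function_Measure
     (lebesgue_measure \x mu)%E (@measurable_consX d)).

Lemma lebS_sigma_finite : sigma_finite [set: _] lebS.
Proof.
have /sigma_finiteP[F [FT ndF Foo]] := sigma_finiteT (@lebesgue_measure R).
have /sigma_finiteP[G [GT ndG Goo]] := sigma_finiteT mu.
exists (fun n => @unconsX d @^-1` (F n `*` G n)).
  rewrite -preimage_bigcup -(preimage_setT (@unconsX d)) -setXTT FT GT.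
  congr preimage; apply/seteqP; split=> -[x y] /=.
    move=> [[n _ Fnx] [k _ Gky]]; exists (maxn n k) => //; split.
    - by move: x Fnx; exact/subsetPset/ndF/leq_maxl.
    - by move: y Gky; exact/subsetPset/ndG/leq_maxr.
  by move=> [n _ [Fnx Gny]]; split; exists n.
move=> n; have [mF F_lty] := Foo n; have [mG G_lty] := Goo n; split.
  rewrite -[X in measurable X]setTI; apply: measurable_unconsX => //.
  exact: measurableX.
rewrite /lebS /pushforward -comp_preimage.
rewrite (_ : _ \o _ = id); last by apply/funext => z /=; rewrite consXK.
by rewrite preimage_id product_measure1E// lte_mul_pinfty// ge0_fin_numE.
Qed.

HB.instance Definition _ :=
  Measure_isSigmaFinite.Build _ _ _ lebS lebS_sigma_finite.

End step.

Fixpoint leb (d : nat) : {sigma_finite_measure set (space R d) -> \bar R} :=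
  if d is d'.+1 then lebS (leb d') else \d_([tuple] : space R 0).

Lemma leb_box d (A : 'I_d -> set (measurableTypeR R)) :
  (forall i, measurable (A i)) ->
  leb d [set x | forall i, A i (tnth x i)] =
  (\prod_(i < d) lebesgue_measure (A i))%E.
Proof.
elim: d => [|d IH] in A * => mA.
  by rewrite big_ord0 /= diracE mem_set// => -[].
rewrite big_ord_recl -IH//.
have mB : measurable [set x : space R d | forall i, A (lift ord0 i) (tnth x i)].
  rewrite (_ : [set _ | _] =
    \bigcap_(i in [set: 'I_d]) ((fun x : space R d => tnth x i) @^-1`
      A (lift ord0 i))); last first.
    by apply/seteqP; split => [x Ax i _|x Ax i]; exact: Ax.
  apply: fin_bigcap_measurable => // i _; rewrite -[X in measurable X]setTI.
  exact: measurable_tnth.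
rewrite -product_measure1E//=; congr (product_measure1 _ _ _).
apply/seteqP; split=> -[x v] /=.
  by move=> Ax; split=> [|i]; [exact: (Ax ord0)|have := Ax (lift ord0 i); rewrite tnthS].
move=> [A0 Av] i; have [->//|i0] := eqVneq i ord0.
have [j ->] : exists j, i = lift ord0 j.
  by case: (unliftP ord0 i) i0 => [j ->|-> /eqP//]; exists j.
by rewrite tnthS.
Qed.

End lebesgue_measure_space.

Section torus_measure.
Context {R : realType}.

(* A fundamental domain of T^d = (R / 2 pi Z)^d. *)
Definition cube d : set (space R d) :=
  [set x | forall i, (tnth x i : R) \in `[0, 2 * pi[].
Arguments cube : clear implicits.

Lemma measurable_cube d : measurable (cube d).
Proof.
rewrite (_ : cube d = \bigcap_(i in [set: 'I_d])
  ((fun x : space R d => tnth x i) @^-1` `[0, 2 * pi[)); last first.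
  by apply/seteqP; split => [x Ax i _|x Ax i]; exact: Ax.
apply: fin_bigcap_measurable => // i _; rewrite -[X in measurable X]setTI.
by apply: measurable_tnth => //; exact: measurable_itv.
Qed.
Arguments measurable_cube : clear implicits.

Definition leb_torus d : set (space R d) -> \bar R :=
  mrestr (leb d) (measurable_cube d).

HB.instance Definition _ d := Measure.on (@leb_torus d).

End torus_measure.

Section moduli.
Context {R : realType} {d : nat}.
Implicit Types (f : space R d -> R[i]) (h x : space R d) (a b t c : R).

Definition translate x c h : space R d :=
  [tuple (tnth x i : R) + c * (tnth h i : R) | i < d].

Definition enorm h : R := Num.sqrt (\sum_(i < d) (tnth h i : R) ^+ 2).

Definition unit_vector (i : 'I_d) : space R d := [tuple (i == j)%:R | j < d].

(** Functions on T^d are the functions on R^d that are 2 pi-periodic in each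
    variable. *)
Definition periodic : set (space R d -> R[i]) :=
  [set f | forall i x, f (translate x (2 * pi) (unit_vector i)) = f x].

Definition gbinom a (j : nat) : R := (\prod_(k < j) (a - k%:R)) / j`!%:R.

(** The series defining the difference converges absolutely almost everywhere
    when f is p-integrable with p >= 1.  A complex series is summed through
    its real and imaginary parts; at the exceptional points [limn] has an
    irrelevant value. *)
Definition real_difference a h (u : space R d -> R) x : R :=
  limn (fun n => \sum_(0 <= j < n)
    (-1) ^+ j * gbinom a j * u (translate x (a - j%:R) h)).

Definition difference a h f x : R[i] :=
  (real_difference a h (fun y => complex.Re (f y)) x +i*
   real_difference a h (fun y => complex.Im (f y)) x)%C.

Variable mu : {measure set (space R d) -> \bar R}.

Definition Lp_norm (p : R) f : \bar R :=
  Lnorm mu p%:E (fun x => (Normc.normc (f x))%:E).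

Definition Lp (p : R) : set (space R d -> R[i]) :=
  [set f | [/\ measurable_fun [set: space R d] (fun x => complex.Re (f x)),
               measurable_fun [set: space R d] (fun x => complex.Im (f x))
             & (Lp_norm p f < +oo)%E]].

Definition modulus a f t (p : R) : \bar R :=
  ereal_sup [set Lp_norm p (difference a h f) | h in [set h | enorm h <= t]].

(** [Lip_qnorm a b p q] is the quasi-norm of Lip^(a, -b)_(p, q). *)

Definition Lip_weighted a b p f t : \bar R :=
  ((t `^ (- a) * (1 - ln t) `^ (- b))%:E * modulus a f t p)%E.

Definition Lip_seminorm a b p (q : \bar R) f : \bar R :=
  (if q is r%:E then
    (\int[lebesgue_measure]_(t in `]0%R, 1%R[)
       (Lip_weighted a b p f t `^ r * (t^-1)%:E)) `^ r^-1
   else ereal_sup [set Lip_weighted a b p f t | t in `]0%R, 1%R[])%E.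

Definition Lip_qnorm a b p q f : \bar R :=
  (Lp_norm p f + Lip_seminorm a b p q f)%E.

Definition Lip a b p q : set (space R d -> R[i]) :=
  [set f | Lp p f /\ (Lip_qnorm a b p q f < +oo)%E].

End moduli.

Section spaces.
Context {R : realType} (d : nat).
Implicit Types (a b p : R) (q : \bar R).

Definition LipR_qnorm a b p q := Lip_qnorm (@leb R d) a b p q.
Definition LipR a b p q := Lip (@leb R d) a b p q.

Definition LipT_qnorm a b p q := Lip_qnorm (@leb_torus R d) a b p q.
Definition LipT a b p q := periodic `&` Lip (@leb_torus R d) a b p q.

End spaces.

Arguments LipR_qnorm {R} d a b p q f.
Arguments LipR {R} d a b p q f.
Arguments LipT_qnorm {R} d a b p q f.
Arguments LipT {R} d a b p q f.

(** [A] is contained in [B], and the inclusion is continuous from the topology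
    of the quasi-norm [nA] to the one of [nB]. *)
Definition continuous_inclusion (R : realType) (T : Type)
    (A : set (T -> R[i])) (nA : (T -> R[i]) -> \bar R)
    (B : set (T -> R[i])) (nB : (T -> R[i]) -> \bar R) : Prop :=
  A `<=` B /\
  forall f, A f -> forall e : R, 0 < e -> exists2 delta : R, 0 < delta &
    forall g, A g -> (nA (fun x => g x - f x)%R < delta%:E)%E ->
      (nB (fun x => g x - f x)%R < e%:E)%E.

(** The convention 1 / oo = 0 is the one of the library. *)
Definition inv_exponent (R : realType) (q : \bar R) : R := fine (q^-1)%E.

Arguments Lip_seminorm {R d} mu a b p q f.

(* Main.v *)
Require Import Defs.
From mathcomp Require Import ring lra zify measurable_realfun.

Set Implicit Arguments.
Unset Strict Implicit.
Unset Printing Implicit Defensive.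

Local Open Scope classical_set_scope.
Local Open Scope ring_scope.

(** Write w_a(t) for the modulus of smoothness of order a of f in L_p, and put
    s = 1 - log t. The weight in the quasi-norm of Lip^(a, -b)_(p, q) is a
    power of t times a power of s against dt/t, and dt/t is the measure ds.
    Since t^-a w_a(t) is almost decreasing, hence almost increasing in s, the
    quasi-norm behaves like a weighted Lebesgue norm of a monotone function on
    the half-line s > 1: it bounds t^-a w_a(t) by a multiple of s^(b - 1/q)
    [wsemi_pointwise], and for fixed a the spaces are ordered by b - 1/q first
    and by q next.

    If one of the conditions holds, then either the smaller order a1 < a0 is
    reached through Marchaud's inequality [marchaud], with a gain of a power of
    t over every power of s; or the pointwise bound is strictly better than
    what the target needs [wsemi_upper]; or the exponent q only increases along
    a line b - 1/q = constant, and one interpolates between the pointwise bound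
    and the given seminorm [wsemi_interpolation].

    If none holds, the embedding fails on lacunary sums f_J = sum_(j < J) c_j
    phi_(N_j), with N_j = M^(2^j) and c_j = (log N_j)^(b0 - 1/q0) N_j^-a0,
    where phi_N is exp(i N x_1) times a fixed positive function: the product of
    the 1 / (1 + x_i^2), or 1 on the torus. The frequencies are so sparse that,
    at the scale t = 1/N_j, the j-th term dominates: t^-a0 w(t) is of size
    s^(b0 - 1/q0) for 1/N_J < t < 1/N_0 and is not larger elsewhere. The
    quasi-norm in the first space is therefore O((1 + log log N_J)^(1/q0))
    [lac_fun_upper]. In the second space, a single term is already too large
    when a0 < a1, or when a0 = a1 and b1 - 1/q1 < b0 - 1/q0 [necessary_order];
    in the critical case the quasi-norm is at least (log log N_J)^(1/q1), which
    is too large when q1 < q0 [necessary_summability].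

    The facts on moduli of smoothness of fractional order all come from algebra
    with the power series of (1 - z)^a, whose coefficients are summable: if (1
    - z)^a A(z) = B(z) with A and B absolutely summable, then B(T) f, for T a
    translation, is bounded in norm by the l^1 norm of A times the norm of (1 -
    T)^a f. Convolutions thus give that orders add up, the factor (1 - z^n)^a /
    (1 - z)^a of l^1 norm O(n^a) [dilation_factor] gives the behaviour of w_a
    under dilations, and the factorisation of 2^a (1 - z)^a - (1 - z^2)^a by (1
    - z)^b, for b at most a + 1 [marchaud_factor], gives Marchaud's inequality.

    All this only needs a measure for which the integral of functions with
    prescribed periods is invariant under translations, and the functions
    phi_N. The whole space and the torus are two instances of this setting. *)

Local Notation normc := Normc.normc.
Local Notation Re := complex.Re.
Local Notation Im := complex.Im.

(** * Convolution of sequences *)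

Section convolution.
Context {R : realType}.
Implicit Types a b c : nat -> R.

Definition convol a b (m : nat) : R := \sum_(j < m.+1) a j * b (m - j)%N.

Definition delta0 (j : nat) : R := (j == 0%N)%:R.

Definition l1_le a (C : R) := forall n, \sum_(j < n) `|a j| <= C.

Lemma convE n a b m : (m < n)%N ->
  convol a b m = ((\poly_(i < n) a i) * (\poly_(i < n) b i))`_m.
Proof.
move=> mn; rewrite coefM /convol; apply: eq_bigr => j _; rewrite !coef_poly.
have jn : (j < n)%N by rewrite (leq_ltn_trans _ mn)// -ltnS.
by rewrite jn (leq_ltn_trans (leq_subr _ _) mn).
Qed.

Lemma convC a b : convol a b = convol b a.
Proof. by apply/funext => m; rewrite !(@convE m.+1)// mulrC. Qed.

Lemma convA a b c : convol a (convol b c) = convol (convol a b) c.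
Proof.
apply/funext => m.
rewrite (@convE m.+1)// [RHS](@convE m.+1)//.
suff poly_conv u v w : ((\poly_(i < m.+1) convol u v i) * w)`_m =
    (((\poly_(i < m.+1) u i) * (\poly_(i < m.+1) v i)) * w)`_m.
  by rewrite poly_conv mulrC poly_conv mulrC mulrA.
rewrite !coefM; apply: eq_bigr => j _; congr (_ * _).
by rewrite coef_poly ltn_ord -convE.
Qed.

Lemma conv0l b : convol delta0 b = b.
Proof.
apply/funext => m; rewrite /convol big_ord_recl/= /delta0/= mul1r subn0.
by rewrite big1 ?addr0// => i _; rewrite mul0r.
Qed.

Lemma triangle_sum (F : nat -> nat -> R) n :
  \sum_(m < n) \sum_(j < m.+1) F j (m - j)%N =
  \sum_(j < n) \sum_(k < n - j) F j k.
Proof.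
elim: n => [|n IH]; first by rewrite !big_ord0.
rewrite big_ord_recr/= IH.
transitivity (\sum_(j < n.+1) (\sum_(k < n - j) F j k + F j (n - j)%N)).
  rewrite big_split/= [in RHS]big_ord_recr/= subnn big_ord0 addr0.
  by congr (_ + _).
apply: eq_bigr => j _; rewrite subSn ?big_ord_recr//.
by rewrite -ltnS.
Qed.

Lemma le_sum_ord (u : nat -> R) m n : (forall j, 0 <= u j) -> (m <= n)%N ->
  \sum_(j < m) u j <= \sum_(j < n) u j.
Proof.
move=> u0 /subnKC <-; rewrite big_split_ord/= lerDl.
by apply: sumr_ge0.
Qed.

Lemma sum_ord_sub (u : nat -> R) m n : (m <= n)%N ->
  \sum_(k < n) u k - \sum_(k < m) u k = \sum_(k < n - m) u (m + k)%N.
Proof.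
move=> mn; have [q ->] : exists q, n = (m + q)%N.
  by exists (n - m)%N; rewrite subnKC.
by rewrite addKn big_split_ord/= addrAC subrr add0r.
Qed.

Lemma conv_l1 a b A B : l1_le a A -> l1_le b B -> l1_le (convol a b) (A * B).
Proof.
move=> aA bB n; have A0 : 0 <= A by have := aA 0%N; rewrite big_ord0.
apply: (@le_trans _ _ (\sum_(m < n) \sum_(j < m.+1) `|a j| * `|b (m - j)%N|)).
  apply: ler_sum => m _; apply: (le_trans (ler_norm_sum _ _ _)).
  by apply: ler_sum => j _; rewrite normrM.
rewrite (triangle_sum (fun j k => `|a j| * `|b k|)).
apply: (@le_trans _ _ (\sum_(j < n) `|a j| * B)).
  by apply: ler_sum => j _; rewrite -mulr_sumr ler_wpM2l.
rewrite -mulr_suml; apply: ler_wpM2r; last exact: aA.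
by have := bB 0%N; rewrite big_ord0.
Qed.

Lemma l1_leD a b A B : l1_le a A -> l1_le b B ->
  l1_le (fun j => a j + b j) (A + B).
Proof.
move=> aA bB n; apply: (le_trans _ (lerD (aA n) (bB n))).
by rewrite -big_split; apply: ler_sum => j _; exact: ler_normD.
Qed.

Lemma l1_leZ a A (k : R) : l1_le a A -> l1_le (fun j => k * a j) (`|k| * A).
Proof.
move=> aA n; rewrite (eq_bigr (fun j : 'I_n => `|k| * `|a j|)).
  by rewrite -mulr_sumr ler_wpM2l//; exact: aA.
by move=> j _; rewrite normrM.
Qed.

Lemma l1_delta0 : l1_le delta0 1.
Proof.
case=> [|n]; first by rewrite big_ord0.
rewrite big_ord_recl big1 ?addr0 /delta0/= ?normr1//.
by move=> i _; rewrite normr0.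
Qed.

(** The coefficients of f(z^n), when b are the ones of f(z). *)
Definition upsample n b (m : nat) : R := if (n %| m)%N then b (m %/ n)%N else 0.

Lemma sum_upsample n b (F : nat -> R) m : (0 < n)%N ->
  \sum_(j < m.+1) upsample n b j * F j =
  \sum_(i < (m %/ n).+1) b i * F (n * i)%N.
Proof.
move=> n0; elim: m => [|m IH].
  by rewrite div0n !big_ord_recl !big_ord0 /upsample dvdn0 div0n muln0.
rewrite big_ord_recr/= IH divnS// /upsample.
case: (boolP (n %| m.+1)%N) => [nm|_]; last by rewrite mul0r addr0 add0n.
rewrite /= add1n [in RHS]big_ord_recr/=; congr (_ + b _ * F _).
  by rewrite divnS// nm.
by have := divnK nm; rewrite divnS// nm/= add1n mulnC.
Qed.

Lemma upsample_conv n a b : (0 < n)%N ->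
  upsample n (convol a b) = convol (upsample n a) (upsample n b).
Proof.
move=> n0; apply/funext => m; rewrite /convol.
rewrite (sum_upsample a (fun j => upsample n b (m - j)%N))//.
rewrite {1}/upsample; case: ifPn => nm; last first.
  rewrite big1// => i _; rewrite /upsample dvdn_subl ?dvdn_mulr//.
    by rewrite (negbTE nm) mulr0.
  by rewrite mulnC (leq_trans _ (leq_divM m n))// leq_mul2r -ltnS ltn_ord orbT.
rewrite /convol; apply: eq_bigr => i _; congr (_ * _).
have -> : (m - n * i = n * (m %/ n - i))%N.
  by rewrite mulnBr (mulnC n (m %/ n)%N) divnK.
by rewrite /upsample dvdn_mulr// mulKn.
Qed.

End convolution.

Section double_series.
Context {R : realType}.

(** Cauchy's product of double series: summing by antidiagonals or by rows
    gives the same value, as both differ from the square partial sums by tails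
    of an absolutely convergent double series. *)
Lemma cauchy_double (F : nat -> nat -> R) (B : R) (r : nat -> R) :
  (forall n, \sum_(j < n) \sum_(k < n) `|F j k| <= B) ->
  (forall j, (fun n => \sum_(k < n) F j k) @ \oo --> r j) ->
  exists l : R,
    (fun n => \sum_(m < n) \sum_(j < m.+1) F j (m - j)%N) @ \oo --> l /\
    (fun n => \sum_(j < n) r j) @ \oo --> l.
Proof.
move=> FB Fr.
pose Sq n := \sum_(j < n) \sum_(k < n) `|F j k|.
have ndSq : nondecreasing_seq Sq.
  move=> m n mn; rewrite /Sq; apply: (@le_trans _ _ (\sum_(j < m) \sum_(k < n) `|F j k|)).
    by apply: ler_sum => j _; apply: (@le_sum_ord _ (fun k => `|F j k|)).
  apply: (@le_sum_ord _ (fun j => \sum_(k < n) `|F j k|)) => // j.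
  exact: sumr_ge0.
have cSq : cvgn Sq.
  by apply: nondecreasing_is_cvgn => //; exists B => _ [n _ <-]; exact: FB.
have SqL : Sq @ \oo --> limn Sq by [].
set L := limn Sq in SqL.
have SqleL n : Sq n <= L by apply: nondecreasing_cvgn_le.
pose S n := \sum_(j < n) \sum_(k < n) F j k.
pose T n := \sum_(m < n) \sum_(j < m.+1) F j (m - j)%N.
pose aT n := \sum_(m < n) \sum_(j < m.+1) `|F j (m - j)%N|.
have aTE n : aT n = \sum_(j < n) \sum_(k < n - j) `|F j k|.
  by rewrite /aT (triangle_sum (fun j k => `|F j k|)).
have TE n : T n = \sum_(j < n) \sum_(k < n - j) F j k.
  by rewrite /T triangle_sum.
have aTSq n : aT n <= Sq n.
  rewrite aTE; apply: ler_sum => j _.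
  by apply: (@le_sum_ord _ (fun k => `|F j k|)) => //; rewrite leq_subr.
have SqaT n : Sq n./2 <= aT n.
  rewrite aTE; apply: (@le_trans _ _ (\sum_(j < n./2) \sum_(k < n - j) `|F j k|)).
    apply: ler_sum => j _; apply: (@le_sum_ord _ (fun k => `|F j k|)) => //.
    have := ltn_ord j; have := odd_double_half n; rewrite -addnn; lia.
  apply: (@le_sum_ord _ (fun j => \sum_(k < n - j) `|F j k|)) => [j|].
    exact: sumr_ge0.
  have := odd_double_half n; rewrite -addnn; lia.
have aTL : aT @ \oo --> L.
  apply: (@squeeze_cvgr _ _ _ _ (fun n => Sq n./2) Sq); last exact: SqL.
  - by apply: nearW => n; rewrite SqaT aTSq.
  - apply: (cvg_comp half Sq) SqL => // .
    move=> A [N _ NA]; exists N.*2 => // n /= Nn; apply: NA => /=.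
    by rewrite -(doubleK N) half_leq.
have aTcvg : cvgn aT by apply/cvg_ex; exists L.
have Tcvg : cvgn T.
  have : cvgn (series (fun m => `|\sum_(j < m.+1) F j (m - j)%N|)).
    apply: (@nondecreasing_is_cvgn R).
      by apply: nondecreasing_series => // n _.
    exists L => _ [n _ <-]; rewrite seriesEord; apply: le_trans (SqleL n).
    apply: le_trans (aTSq n); apply: ler_sum => m _; exact: ler_norm_sum.
  move/normed_cvg; rewrite (_ : series _ = T)//.
  by apply/funext => n; rewrite seriesEord.
exists (limn T); split; first exact: Tcvg.
have ST : (fun n => S n - T n) @ \oo --> 0.
  have : (fun n => Sq n - aT n) @ \oo --> L - L by exact: cvgB.
  rewrite subrr => h; apply: (@norm_cvg0 _ R^o).
  apply: (squeeze_cvgr _ (cvg_cst 0) h); apply: nearW => n; rewrite normr_ge0/=.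
  rewrite /S TE aTE /Sq -!sumrB; apply: (le_trans (ler_norm_sum _ _ _)).
  apply: ler_sum => j _; have jn : (n - j <= n)%N by rewrite leq_subr.
  rewrite (sum_ord_sub _ jn) (sum_ord_sub (fun k => `|F j k|) jn).
  exact: ler_norm_sum.
have rS : (fun n => \sum_(j < n) r j - S n) @ \oo --> 0.
  have : (fun n => L - Sq n) @ \oo --> L - L by apply: cvgB => //; exact: cvg_cst.
  rewrite subrr => h; apply: (@norm_cvg0 _ R^o).
  apply: (squeeze_cvgr _ (cvg_cst 0) h); apply: nearW => n; rewrite normr_ge0/=.
  have cK : (fun K => `|\sum_(j < n) \sum_(k < K) F j k - S n|) @ \oo -->
      `|\sum_(j < n) r j - S n|.
    apply: cvg_norm; apply: cvgB; last exact: cvg_cst.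
    by apply: cvg_big => [|j _]; [exact: add_continuous|exact: Fr].
  apply: (cvgr_to_le cK).
  near=> K.
  have nK : (n <= K)%N by near: K; exact: nbhs_infty_ge.
  apply: (@le_trans _ _ (Sq K - Sq n)); last by rewrite lerB.
  have -> : \sum_(j < n) \sum_(k < K) F j k - S n =
      \sum_(j < n) \sum_(k < K - n) F j (n + k)%N.
    by rewrite -sumrB; apply: eq_bigr => j _; rewrite (sum_ord_sub _ nK).
  apply: (@le_trans _ _ (\sum_(j < n) \sum_(k < K) `|F j k| - Sq n)); last first.
    rewrite lerB// /Sq; apply: (@le_sum_ord _ (fun j => \sum_(k < K) `|F j k|)) => //.
    by move=> j; exact: sumr_ge0.
  rewrite -sumrB; apply: (le_trans (ler_norm_sum _ _ _)); apply: ler_sum => j _.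
  by rewrite (sum_ord_sub (fun k => `|F j k|) nK); exact: ler_norm_sum.
have -> : (fun n => \sum_(j < n) r j) =
    (fun n => (\sum_(j < n) r j - S n) + ((S n - T n) + T n)).
  by apply/funext => n; rewrite !addrA !subrK.
rewrite -[limn T]add0r -[X in _ --> 0 + X]add0r.
by apply: cvgD => //; apply: cvgD.
Unshelve. all: by end_near. Qed.

End double_series.

(** * Binomial coefficients with real upper entry *)

Section binomial_coefficients.
Context {R : realType}.
Implicit Types a b : R.

Lemma gbinom0 a : gbinom a 0 = 1.
Proof. by rewrite /gbinom big_ord0 fact0 invr1 mulr1. Qed.

Lemma gbinomS a j : j.+1%:R * gbinom a j.+1 = (a - j%:R) * gbinom a j.
Proof.
rewrite /gbinom big_ord_recr/= factS natrM.
have j0 : j.+1%:R != 0 :> R by rewrite pnatr_eq0.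
have f0 : j`!%:R != 0 :> R by rewrite pnatr_eq0 -lt0n fact_gt0.
by field; rewrite f0 addrC natr1 j0.
Qed.

(** The two-term recurrence determines the coefficients; it is the differential
    equation of the binomial series. *)
Lemma gbinom_rec (g : nat -> R) a : g 0%N = 1 ->
  (forall j, j.+1%:R * g j.+1 = (a - j%:R) * g j) -> g = gbinom a.
Proof.
move=> g0 gS; apply/funext; elim=> [|j IH]; first by rewrite g0 gbinom0.
have j0 : j.+1%:R != 0 :> R by rewrite pnatr_eq0.
by apply: (mulfI j0); rewrite gS gbinomS IH.
Qed.

Lemma gbinom_pascal a j : gbinom (a + 1) j.+1 = gbinom a j.+1 + gbinom a j.
Proof.
elim: j => [|j IH].
  have := gbinomS (a + 1) 0; have := gbinomS a 0.
  by rewrite !gbinom0 !mul1r !subr0 !mulr1 => -> ->.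
have j0 : j.+2%:R != 0 :> R by rewrite pnatr_eq0.
apply: (mulfI j0); rewrite [LHS]gbinomS IH [RHS]mulrDr gbinomS.
have := gbinomS a j.
by rewrite -!natr1 => h; lra.
Qed.

Lemma gbinom_nat n j : gbinom n%:R j = 'C(n, j)%:R :> R.
Proof.
suff -> : gbinom (n%:R : R) = fun j => 'C(n, j)%:R by [].
apply/esym/gbinom_rec => [|i]; first by rewrite bin0.
have [ni|ni] := leqP n i; last first.
  by rewrite -natrB ?(ltnW ni)// -!natrM mul_bin_left.
rewrite (@bin_small n i.+1) ?ltnS// mulr0.
move: ni; rewrite leq_eqVlt => /predU1P[->|ni]; first by rewrite subrr mul0r.
by rewrite bin_small// mulr0.
Qed.

(** Both sides satisfy the recurrence of the binomial coefficients: splitting m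
    + 1 = j + (m + 1 - j) inside the convolution turns its left-hand side into
    two shifted convolutions. *)
Lemma vandermonde a b : convol (gbinom a) (gbinom b) = gbinom (a + b).
Proof.
apply: gbinom_rec => [|m].
  by rewrite /convol big_ord_recl big_ord0 !gbinom0 mulr1 addr0.
rewrite /convol.
transitivity (\sum_(j < m.+2) j%:R * (gbinom a j * gbinom b (m.+1 - j)%N) +
    \sum_(j < m.+2) (m.+1 - j)%:R * (gbinom a j * gbinom b (m.+1 - j)%N)).
  rewrite -big_split mulr_sumr; apply: eq_bigr => j _ /=.
  by rewrite -mulrDl -natrD subnKC// -ltnS.
rewrite big_ord_recl mul0r add0r [X in _ + X]big_ord_recr/= subnn mul0r addr0.
rewrite -big_split mulr_sumr; apply: eq_bigr => j _ /=.
have jm : (j <= m)%N by rewrite -ltnS.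
rewrite /bump/= add1n subSS (subSn jm) mulrA gbinomS [X in _ + X]mulrCA gbinomS.
rewrite (natrB _ jm); ring.
Qed.

(** The coefficients of (1 - z)^a. *)
Definition diff_coef a (j : nat) : R := (-1) ^+ j * gbinom a j.

Lemma diff_coef0 a : diff_coef a 0 = 1.
Proof. by rewrite /diff_coef expr0 mul1r gbinom0. Qed.

Lemma diff_coefS a j :
  j.+1%:R * diff_coef a j.+1 = (j%:R - a) * diff_coef a j.
Proof.
rewrite /diff_coef mulrCA gbinomS exprS; ring.
Qed.

Lemma diff_coefD a b : convol (diff_coef a) (diff_coef b) = diff_coef (a + b).
Proof.
apply/funext => m; rewrite [in RHS]/diff_coef -vandermonde /convol mulr_sumr.
apply: eq_bigr => j _; rewrite /diff_coef mulrACA -exprD subnKC//.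
by rewrite -ltnS.
Qed.

Lemma diff_coef_0 : diff_coef 0 = delta0 :> (nat -> R).
Proof.
apply/funext; case=> [|j]; first by rewrite diff_coef0.
by rewrite /diff_coef (gbinom_nat 0) bin0n mulr0.
Qed.

Lemma diff_coef1 m : diff_coef 1 m = (m == 0%N)%:R - (m == 1%N)%:R :> R.
Proof.
rewrite /diff_coef (gbinom_nat 1).
case: m => [|[|m]]; first by rewrite expr0 bin0 mulr1 subr0.
  by rewrite expr1 binn mulr1 sub0r.
by rewrite bin_small// mulr0 subr0.
Qed.

Lemma conv_diff1 (c : nat -> R) m :
  convol (diff_coef 1) c m = c m - (if m is m'.+1 then c m' else 0).
Proof.
rewrite /convol; case: m => [|m].
  by rewrite big_ord_recl big_ord0 diff_coef0 mul1r subr0 addr0.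
rewrite big_ord_recl big_ord_recl/= !diff_coef1/= subr0 mul1r sub0r mulN1r.
rewrite subn0 subn1/= addrA big1 ?addr0// => i _.
by rewrite diff_coef1/= subr0 mul0r.
Qed.

Lemma diff_coef_partial a n :
  \sum_(j < n.+1) diff_coef a j = diff_coef (a - 1) n.
Proof.
elim: n => [|n IH].
  by rewrite big_ord_recl big_ord0 !diff_coef0 addr0.
rewrite big_ord_recr/= IH /diff_coef.
have := gbinom_pascal (a - 1) n; rewrite subrK => ->.
rewrite exprS; ring.
Qed.

Lemma diff_coef_partial_ge0 a n : a <= 1 -> 0 <= diff_coef (a - 1) n.
Proof.
move=> a1; elim: n => [|n IH]; first by rewrite diff_coef0.
have n0 : 0 < n.+1%:R :> R by rewrite ltr0n.
rewrite -(pmulr_rge0 _ n0) diff_coefS mulr_ge0//.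
have : 0 <= n%:R :> R by []. lra.
Qed.

Lemma diff_coef_le0 a j : 0 <= a <= 1 -> diff_coef a j.+1 <= 0.
Proof.
case/andP=> a0 a1; elim: j => [|j IH].
  by have := diff_coefS a 0; rewrite mul1r diff_coef0 mulr1 sub0r => ->; lra.
have n0 : 0 < j.+2%:R :> R by rewrite ltr0n.
rewrite -(pmulr_rle0 _ n0) diff_coefS; apply: mulr_ge0_le0 => //.
by rewrite subr_ge0 (le_trans a1)// ler1n.
Qed.

(** Statements on differences of order a are proved for fractional a, where the
    coefficients of (1 - z)^a beyond the first have constant sign, and then for
    a + 1. *)
Lemma fractional_induction (P : R -> Prop) :
  (forall a, 0 <= a < 1 -> P a) -> (forall a, 0 <= a -> P a -> P (a + 1)) ->
  forall a, 0 <= a -> P a.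
Proof.
move=> P01 PS a a0.
have /andP[ta at1] : (Num.truncn a)%:R <= a < (Num.truncn a).+1%:R.
  exact: Num.Theory.truncn_itv.
have -> : a = (a - (Num.truncn a)%:R) + (Num.truncn a)%:R by rewrite subrK.
set b := a - _; have b01 : 0 <= b < 1.
  by rewrite /b subr_ge0 ta ltrBlDl natr1.
elim: (Num.truncn a) => [|n IH]; first by rewrite addr0; exact: P01.
rewrite -natr1 addrA; apply: PS => //.
by case/andP: b01 => b0 _; rewrite addr_ge0.
Qed.

(** All coefficients but the first are nonpositive, and the partial sums of the
    series are the coefficients of (1 - z)^(a - 1), which are nonnegative. *)
Lemma diff_coef_l1_01 a : 0 <= a <= 1 -> l1_le (diff_coef a) 2.
Proof.
move=> /[dup] a01 /andP[a0 a1]; case=> [|n]; first by rewrite big_ord0.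
rewrite big_ord_recl diff_coef0 normr1.
rewrite (eq_bigr (fun j : 'I_n => - diff_coef a j.+1)); last first.
  by move=> j _; rewrite ler0_norm ?diff_coef_le0.
rewrite sumrN; have := diff_coef_partial a n; rewrite big_ord_recl diff_coef0 /=.
under eq_bigr do rewrite /bump/= add1n.
have := diff_coef_partial_ge0 n a1; lra.
Qed.

Lemma diff_coef_l1 a : 0 <= a -> exists C, l1_le (diff_coef a) C.
Proof.
move: a; apply: fractional_induction => [a a01|a a0 [C aC]].
  by exists 2; apply: diff_coef_l1_01; lra.
exists (C * 2); rewrite -diff_coefD; apply: conv_l1 => //.
by apply: diff_coef_l1_01; lra.
Qed.

Lemma gbinom_l1 a C : l1_le (diff_coef a) C -> l1_le (gbinom a) C.
Proof.
move=> aC n; rewrite (eq_bigr (fun j : 'I_n => `|diff_coef a j|)); first exact: aC.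
by move=> j _; rewrite /diff_coef normrMsign.
Qed.

End binomial_coefficients.

(** * The quotient of (1 - z^n)^a by (1 - z)^a *)

Section dilation.
Context {R : realType}.

(** Bernoulli's inequality for exponents at most 1, from Young's inequality for
    the conjugate exponents 1/s and 1/(1 - s). *)
Lemma bernoulli_powR (x s : R) : 0 <= x -> 0 < s <= 1 -> x `^ s <= 1 + s * (x - 1).
Proof.
move=> x0 /andP[s0]; rewrite le_eqVlt => /predU1P[->|s1].
  by rewrite powRr1// mul1r addrC subrK.
have s'0 : 0 < 1 - s by rewrite subr_gt0.
have := @conjugate_powR R (x `^ s) 1 s^-1 (1 - s)^-1 (powR_ge0 _ _) ler01.
rewrite !invr_gt0 !invrK => /(_ s0 s'0).
rewrite mulr1 powR1 mul1r -powRrM mulfV ?gt_eqF// powRr1// => h.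
by apply: (le_trans (h _)); [lra|lra].
Qed.

Variable be : R.
Hypothesis be01 : 0 < be < 1.
Let e := 1 - be.
Let c : nat -> R := diff_coef (- be).

Let e01 : 0 < e <= 1. Proof. by case/andP: be01 => ? ?; rewrite /e; apply/andP; split; lra. Qed.

Let cS m : m.+1%:R * c m.+1 = (m%:R + be) * c m.
Proof. by rewrite /c diff_coefS opprK. Qed.

Let c_gt0 m : 0 < c m.
Proof.
elim: m => [|m IH]; first by rewrite /c diff_coef0.
have m0 : 0 < m.+1%:R :> R by rewrite ltr0n.
rewrite -(pmulr_rgt0 _ m0) cS mulr_gt0//.
have := be01; have : 0 <= m%:R :> R by []. lra.
Qed.

Let sum_c n : be * \sum_(r < n) c r = n%:R * c n.
Proof.
elim: n => [|n IH]; first by rewrite big_ord0 mulr0 mul0r.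
by rewrite big_ord_recr/= mulrDr IH cS mulrDl.
Qed.

Let c_inc m : c m * m%:R `^ e <= c m.+1 * m.+1%:R `^ e.
Proof.
have m0 : 0 < m.+1%:R :> R by rewrite ltr0n.
have mE : m%:R `^ e = (m%:R / m.+1%:R) `^ e * m.+1%:R `^ e.
  by rewrite -powRM ?divr_ge0// divfK// gt_eqF.
rewrite mE mulrA ler_wpM2r ?powR_ge0//.
rewrite -(ler_pM2l m0) cS mulrCA [leRHS]mulrC (ler_wpM2l (ltW (c_gt0 m)))//.
apply: (@le_trans _ _ (m.+1%:R * (1 + e * (m%:R / m.+1%:R - 1)))).
  by rewrite (ler_wpM2l (ltW m0))// bernoulli_powR// divr_ge0.
have -> : m.+1%:R * (1 + e * (m%:R / m.+1%:R - 1)) = m%:R + be.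
  by rewrite /e -natr1; field; rewrite natr1 gt_eqF.
by [].
Qed.

Let c_dec m : c m.+1 * m.+2%:R `^ e <= c m * m.+1%:R `^ e.
Proof.
have m0 : 0 < m.+1%:R :> R by rewrite ltr0n.
have mE : m.+2%:R `^ e = (m.+2%:R / m.+1%:R) `^ e * m.+1%:R `^ e.
  by rewrite -powRM ?divr_ge0// divfK// gt_eqF.
rewrite mE mulrA ler_wpM2r ?powR_ge0//.
rewrite -(ler_pM2l m0) mulrA cS [leRHS]mulrC -mulrA mulrCA (ler_wpM2l (ltW (c_gt0 m)))//.
apply: (@le_trans _ _ ((m%:R + be) * (1 + e * (m.+2%:R / m.+1%:R - 1)))).
  apply: ler_wpM2l; last by rewrite bernoulli_powR// divr_ge0.
  have := be01; have : 0 <= m%:R :> R by []. lra.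
have -> : 1 + e * (m.+2%:R / m.+1%:R - 1) = (m.+2%:R - be) / m.+1%:R.
  by rewrite /e -!natr1; field; rewrite natr1 gt_eqF.
rewrite mulrA ler_pdivrMr// -!natr1; have := be01; nra.
Qed.

Let c_inc_le m n : (m <= n)%N -> c m * m%:R `^ e <= c n * n%:R `^ e.
Proof.
elim: n => [|n IH]; first by rewrite leqn0 => /eqP->.
by rewrite leq_eqVlt => /predU1P[->//|]; rewrite ltnS => /IH/le_trans; apply.
Qed.

Let c_dec_le m n : (m <= n)%N -> c n * n.+1%:R `^ e <= c m * m.+1%:R `^ e.
Proof.
elim: n => [|n IH]; first by rewrite leqn0 => /eqP->.
rewrite leq_eqVlt => /predU1P[->//|]; rewrite ltnS => /IH; apply: le_trans.
exact: c_dec.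
Qed.

Let c_cross m k : c m * m%:R `^ e <= c k * k.+1%:R `^ e.
Proof.
have lift i : c i * i%:R `^ e <= c i * i.+1%:R `^ e.
  rewrite (ler_wpM2l (ltW (c_gt0 i)))// ge0_ler_powR// ?nnegrE// ?ler_nat//.
  by case/andP: e01 => /ltW.
have [mk|km] := leqP m k; first exact: le_trans (c_inc_le mk) (lift k).
exact: le_trans (lift m) (c_dec_le (ltnW km)).
Qed.

(** The coefficients c m of (1 - z)^(- be) behave like g m^(- e), with g = 1 /
    Gamma(be). To avoid the Gamma function: c m * m^e increases, c m * (m +
    1)^e decreases, and g is the supremum of the former. *)
Lemma negative_binomial_bounds : exists2 g : R, 0 <= g & forall m,
  c m * m%:R `^ e <= g /\ g <= c m * m.+1%:R `^ e.
Proof.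
pose A := range (fun m => c m * m%:R `^ e).
have Aub : has_ubound A.
  by exists (c 0 * 1 `^ e) => _ [m _ <-]; exact: c_cross.
have A0 : A !=set0 by exists (c 0 * 0%:R `^ e), 0%N.
exists (sup A).
  apply: (@le_trans _ _ (c 0 * 0%:R `^ e)).
    by rewrite mulr_ge0 ?powR_ge0 ?ltW.
  by apply: ub_le_sup => //; exists 0%N.
move=> m; split; first by apply: ub_le_sup => //; exists m.
by apply: ge_sup => // _ [k _ <-]; exact: c_cross.
Qed.

Let al : nat -> R := diff_coef be.

Let conv_al_c : convol al c = delta0.
Proof. by rewrite diff_coefD subrr diff_coef_0. Qed.

(** The coefficients of (1 - z^n)^be / (1 - z)^be. *)
Definition dilation_quotient n : nat -> R := convol c (upsample n al).

Lemma dilation_quotientE n : convol (dilation_quotient n) (diff_coef be) =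
  upsample n (diff_coef be).
Proof.
by rewrite /dilation_quotient -convA (convC _ al) convA (convC c) conv_al_c conv0l.
Qed.

Let u n r k := c (n * k + r)%N - n%:R `^ (- e) * c k.

Let quotient_block n r q : (r < n)%N ->
  dilation_quotient n (n * q + r)%N =
  convol al (u n r) q + n%:R `^ (- e) * delta0 q.
Proof.
move=> rn; have n0 : (0 < n)%N by apply: leq_ltn_trans rn.
rewrite /dilation_quotient convC /convol.
rewrite (sum_upsample al (fun j => c (n * q + r - j)%N))//.
have -> : ((n * q + r) %/ n = q)%N by rewrite mulnC divnMDl// divn_small// addn0.
rewrite -conv_al_c /convol mulr_sumr -big_split/=; apply: eq_bigr => i _.
have iq : (i <= q)%N by rewrite -ltnS.
have -> : (n * q + r - n * i = n * (q - i) + r)%N.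
  by rewrite mulnBr -addnBAC// leq_mul2l iq orbT.
by rewrite /u; ring.
Qed.

Let u_l1 g n r : (0 < n)%N -> (r < n)%N -> 0 <= g ->
  (forall m, c m * m%:R `^ e <= g /\ g <= c m * m.+1%:R `^ e) ->
  l1_le (u n r) (c r + n%:R `^ (- e) * (1 + g)).
Proof.
move=> n0 rn g0 cg.
have ne0 : 0 <= n%:R `^ (- e) :> R by exact: powR_ge0.
have n0' : 0 < n%:R :> R by rewrite ltr0n.
have e0 : 0 <= e by case/andP: e01 => /ltW.
have cle m : (0 < m)%N -> c m <= g * m%:R `^ (- e).
  move=> m0; have [h _] := cg m.
  by rewrite powRN ler_pdivlMr// powR_gt0// ltr0n.
have cge m : g * m.+1%:R `^ (- e) <= c m.
  have [_ h] := cg m.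
  by rewrite powRN ler_pdivrMr// powR_gt0// ltr0n.
have decr x y : (0 < x)%N -> (x <= y)%N -> y%:R `^ (- e) <= x%:R `^ (- e) :> R.
  move=> x0 xy; rewrite !powRN lef_pV2 ?posrE ?powR_gt0 ?ltr0n//; last first.
    exact: leq_trans xy.
  by rewrite ge0_ler_powR ?nnegrE// ler_nat.
have uk k : `|u n r k.+1| <=
    n%:R `^ (- e) * g * (k.+1%:R `^ (- e) - k.+2%:R `^ (- e)).
  have nM x : (n * x)%:R `^ (- e) = n%:R `^ (- e) * x%:R `^ (- e) :> R.
    by rewrite natrM powRM.
  have h1 : c (n * k.+1 + r)%N <= g * (n%:R `^ (- e) * k.+1%:R `^ (- e)).
    apply: le_trans (cle _ _) _; first by rewrite addn_gt0 muln_gt0 n0.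
    by rewrite -nM ler_wpM2l// decr ?muln_gt0 ?n0// leq_addr.
  have h2 : g * (n%:R `^ (- e) * k.+2%:R `^ (- e)) <= c (n * k.+1 + r)%N.
    apply: le_trans (cge _); rewrite -nM ler_wpM2l// decr//.
    by rewrite mulnS (mulnS n k.+1); lia.
  have h3 := ler_wpM2l ne0 (cle k.+1 isT).
  have h4 := ler_wpM2l ne0 (cge k.+1).
  by rewrite ler_norml /u; apply/andP; split; lra.
have tele K : \sum_(k < K) (k.+1%:R `^ (- e) - k.+2%:R `^ (- e)) =
    1 - K.+1%:R `^ (- e) :> R.
  elim: K => [|K IH]; first by rewrite big_ord0 powR1 subrr.
  by rewrite big_ord_recr/= IH; ring.
case=> [|K].
  by rewrite big_ord0 addr_ge0 ?ltW// mulr_gt0 ?powR_gt0// ltr_wpDr.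
rewrite big_ord_recl mulrDr addrA lerD//.
  rewrite /u muln0 add0n /c diff_coef0 (le_trans (ler_normB _ _))//.
  by rewrite !mulr1 (ger0_norm ne0) gtr0_norm ?c_gt0.
apply: (@le_trans _ _ (\sum_(k < K) n%:R `^ (- e) * g *
    (k.+1%:R `^ (- e) - k.+2%:R `^ (- e)))).
  by apply: ler_sum => k _; exact: uk.
rewrite -mulr_sumr tele ler_piMr ?mulr_ge0//.
Qed.

(** Along each residue class r modulo n, the coefficients are the convolution
    of those of (1 - z)^be with k |-> c (n k + r). As c is close to a
    homogeneous function, subtracting n^(- e) c k only creates a unit mass at
    0, and what is left is summable with a norm O(c r + n^(- e)). Summing over
    r gives n^be. *)
Lemma dilation_quotient_l1 : exists C, forall n, (0 < n)%N ->
  l1_le (dilation_quotient n) (C * n%:R `^ be).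
Proof.
have [g g0 cg] := negative_binomial_bounds.
exists (3 + 2 * g + 2 * g / be) => n n0.
have al2 : l1_le al 2 by apply: diff_coef_l1_01; have := be01; lra.
set A := dilation_quotient n.
have ne0 : 0 <= n%:R `^ (- e) :> R by exact: powR_ge0.
have block r Q : (r < n)%N -> \sum_(q < Q) `|A (n * q + r)%N| <=
    2 * (c r + n%:R `^ (- e) * (1 + g)) + n%:R `^ (- e) * 1.
  move=> rn; have h1 := conv_l1 al2 (u_l1 n0 rn g0 cg).
  have := l1_leD h1 (l1_leZ (n%:R `^ (- e)) l1_delta0) Q.
  rewrite ger0_norm//; under eq_bigr do rewrite -quotient_block//.
  by [].
have split_blocks Q : \sum_(m < n * Q) `|A m| =
    \sum_(r < n) \sum_(q < Q) `|A (n * q + r)%N|.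
  elim: Q => [|Q IH].
    by rewrite muln0 big_ord0 big1// => i _; rewrite big_ord0.
  rewrite mulnS addnC big_split_ord/= IH -big_split/=.
  by apply: eq_bigr => r _; rewrite big_ord_recr.
have nbe : n%:R * n%:R `^ (- e) = n%:R `^ be :> R.
  rewrite -[X in X * _](@powRr1 _ n%:R)// -powRD.
    by congr (_ `^ _); rewrite /e; lra.
  by apply/implyP => _; rewrite pnatr_eq0 -lt0n.
have cn : n%:R * c n <= g * n%:R `^ be.
  have [h _] := cg n.
  rewrite -nbe [leRHS]mulrCA ler_wpM2l// powRN ler_pdivlMr// powR_gt0// ltr0n//.
move=> N; apply: (@le_trans _ _ (\sum_(m < n * N) `|A m|)).
  apply: (@le_sum_ord _ (fun m => `|A m|)) => //.
  by rewrite leq_pmull.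
rewrite split_blocks.
apply: (@le_trans _ _ (\sum_(r < n) (2 * (c r + n%:R `^ (- e) * (1 + g)) +
    n%:R `^ (- e) * 1))).
  by apply: ler_sum => r _; exact: block.
rewrite big_split/= -mulr_sumr big_split/= !sumr_const !card_ord.
rewrite -[n%:R `^ (- e) * (1 + g) *+ n]mulr_natl -[n%:R `^ (- e) * 1 *+ n]mulr_natl.
rewrite !mulrA nbe.
have be0 : 0 < be by case/andP: be01.
have : \sum_(r < n) c r <= g / be * n%:R `^ be.
  rewrite -(ler_pM2l be0) sum_c (le_trans cn)//.
  by rewrite mulrA mulrCA divff ?gt_eqF// mulr1.
move: (\sum_(r < n) c r) (n%:R `^ be) => x y.
have -> : 2 * g / be = 2 * (g / be) by rewrite mulrA.
move: (g / be) => z h; lra.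
Qed.

End dilation.

Section dilation_general.
Context {R : realType}.

(** For a fractional order this is [dilation_quotient]; increasing the order by
    1 multiplies by the geometric sum (1 - z^n) / (1 - z), of norm n. *)
Lemma dilation_factor (a : R) : 0 <= a -> exists C : R, forall n, (0 < n)%N ->
  exists2 A : nat -> R, l1_le A (C * n%:R `^ a) &
    convol A (diff_coef a) = upsample n (diff_coef a).
Proof.
move: a; apply: fractional_induction => [a|a a0 [C hC]].
  case/andP; rewrite le_eqVlt => /predU1P[<- _|a0 a1].
    exists 1 => n n0; exists delta0.
      by rewrite powRr0 mulr1; exact: l1_delta0.
    rewrite conv0l diff_coef_0; apply/funext => m; rewrite /upsample /delta0.
    case: ifPn => nm; last first.
      by case: eqP nm => // ->; rewrite dvdn0.
    by have [q ->] := dvdnP nm; rewrite mulnK// muln_eq0 (gtn_eqF n0) orbF.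
  have a01 : 0 < a < 1 by rewrite a0.
  have [C hC] := dilation_quotient_l1 a01.
  by exists C => n n0; exists (dilation_quotient a n); [exact: hC|exact: dilation_quotientE].
exists C => n n0; have [A Al1 AE] := hC n n0.
(* the coefficients of (1 - z^n) / (1 - z) *)
pose geom j : R := (j < n)%:R.
have geoml1 : l1_le geom n%:R.
  move=> N; have -> : n%:R = \sum_(j < n) `|geom j| :> R.
    rewrite (eq_bigr (fun=> 1)) ?sumr_const ?card_ord// => j _.
    by rewrite /geom ltn_ord normr1.
  have [Nn|nN] := leqP N n; first exact: (@le_sum_ord _ (fun j => `|geom j|)).
  rewrite -subr_le0 (sum_ord_sub (fun j => `|geom j|) (ltnW nN)) big1// => k _.
  by rewrite /geom ltnNge leq_addr normr0.
exists (convol A geom).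
  rewrite powRD; last by rewrite pnatr_eq0 -lt0n n0 implybT.
  by rewrite powRr1// mulrA; exact: conv_l1.
rewrite -diff_coefD upsample_conv// -AE.
have <- : convol geom (diff_coef 1) = upsample n (diff_coef 1).
  apply/funext => m; rewrite convC conv_diff1 /upsample /geom.
  case: m => [|m]; first by rewrite n0 dvdn0 div0n diff_coef0 subr0.
  have -> : (if (n %| m.+1)%N then diff_coef 1 (m.+1 %/ n)%N else 0) =
      - (n == m.+1)%:R :> R.
    case: ifPn => [nm|nm]; last by case: eqP nm => [->|_]; rewrite ?dvdnn// oppr0.
    rewrite diff_coef1 ![(_ %/ _)%N == _]eq_sym !eqn_div// mul0n mul1n.
    by rewrite [0%N == _]eq_sym/= sub0r.
  by have [nm|mn|nm] := ltngtP n m.+1; rewrite /= ?subrr ?sub0r ?oppr0.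
by rewrite !convA -(convA A (diff_coef a)) (convC (diff_coef a)) !convA.
Qed.

End dilation_general.

(** * Marchaud's factorisation *)

Section plus_minus.
Context {R : realType}.

Lemma gbinom1 m : gbinom 1 m = 'C(1, m)%:R :> R.
Proof. exact: (gbinom_nat 1). Qed.

Let plus_minus1 : convol (gbinom 1) (diff_coef 1) = upsample 2 (diff_coef 1) :> (nat -> R).
Proof.
apply/funext => m; rewrite convC conv_diff1 /upsample.
case: m => [|[|[|[|m]]]]; rewrite ?gbinom1//=.
- by rewrite bin0 subr0 diff_coef0.
- by rewrite bin0 binn subrr.
- by rewrite divnn/= diff_coef1/= binn bin_small.
- by rewrite !bin_small// subrr.
- rewrite !bin_small// subrr; case: ifP => // _.
  rewrite diff_coef1 (_ : m.+4 %/ 2 = (m %/ 2).+2)%N ?subrr//.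
  by rewrite -[m.+4]/(2 * 2 + m)%N divnMDl.
Qed.

Let plus_minus_nat (n : nat) :
  convol (gbinom n%:R) (diff_coef n%:R) = upsample 2 (diff_coef n%:R) :> (nat -> R).
Proof.
elim: n => [|n IH].
  have -> : gbinom 0%:R = delta0 :> (nat -> R).
    by apply/funext => j; rewrite gbinom_nat bin0n.
  rewrite conv0l diff_coef_0; apply/funext => -[|m]; first by rewrite /upsample.
  by rewrite /upsample /delta0; case: ifP => // /dvdnP[[|q]// ->]; rewrite mulnK.
rewrite -natr1 -vandermonde -diff_coefD upsample_conv// -IH -plus_minus1.
by rewrite !convA -(convA (gbinom n%:R)) (convC (gbinom 1)) !convA.
Qed.

Let gpoly (j : nat) : {poly R} := (j`!%:R)^-1 *: \prod_(k < j) ('X - k%:R%:P).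

Let gpolyE a j : (gpoly j).[a] = gbinom a j.
Proof.
rewrite /gpoly hornerZ horner_prod /gbinom mulrC; congr (_ * _).
by apply: eq_bigr => k _; rewrite hornerXsubC.
Qed.

(** The identity (1 + z)^a (1 - z)^a = (1 - z^2)^a. Each coefficient is a
    polynomial in a on either side, so natural numbers a suffice, and these
    reduce to a = 1. *)
Lemma gbinom_diff_coef a : convol (gbinom a) (diff_coef a) =
  upsample 2 (diff_coef a) :> (nat -> R).
Proof.
apply/funext => m.
pose L : {poly R} := \sum_(j < m.+1) gpoly j * ((-1) ^+ (m - j) *: gpoly (m - j)).
pose U : {poly R} := if (2 %| m)%N then (-1) ^+ (m %/ 2) *: gpoly (m %/ 2) else 0.
have LE x : L.[x] = convol (gbinom x) (diff_coef x) m.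
  rewrite /L horner_sum /convol; apply: eq_bigr => j _.
  by rewrite hornerM gpolyE hornerZ gpolyE.
have UE x : U.[x] = upsample 2 (diff_coef x) m.
  rewrite /U /upsample; case: ifP => _; last by rewrite horner0.
  by rewrite hornerZ gpolyE.
rewrite -LE -UE; suff -> : L = U by [].
apply/eqP; rewrite -subr_eq0; apply/eqP.
(* more roots than the degree allows *)
pose rs : seq R := [seq k%:R | k <- iota 0 (size (L - U))].
apply: (@roots_geq_poly_eq0 _ _ rs).
- apply/allP => _ /mapP[k _ ->]; rewrite rootE hornerD hornerN LE UE.
  by rewrite plus_minus_nat subrr.
- by rewrite map_inj_uniq ?iota_uniq//; exact: mulrIn.
- by rewrite size_map size_iota.
Qed.

End plus_minus.

Section binomial_sum.
Context {R : realType}.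
Implicit Types a b : R.

(** Leibniz's criterion, with the bound by the first term. *)
Lemma alternating_sum (dd : nat -> R) n : (forall j, 0 <= dd j) ->
  (forall j, dd j.+1 <= dd j) -> 0 <= \sum_(j < n) (-1) ^+ j * dd j <= dd 0%N.
Proof.
elim: n dd => [|n IH] dd d0 dn; first by rewrite big_ord0 lexx d0.
rewrite big_ord_recl expr0 mul1r.
rewrite (eq_bigr (fun j : 'I_n => - ((-1) ^+ j * dd j.+1))); last first.
  by move=> j _; rewrite exprS mulN1r mulNr.
rewrite sumrN; have /andP[h1 h2] := IH (fun j => dd j.+1) (fun j => d0 _) (fun j => dn _).
have := dn 0%N; rewrite /=; lra.
Qed.

Lemma gbinom_tail a m n : 0 <= a < 1 ->
  0 <= (-1) ^+ m * \sum_(i < n) gbinom a (m.+1 + i)%N <= `|gbinom a m.+1|.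
Proof.
move=> /andP[a0 a1]; have a01 : 0 <= a <= 1 by rewrite a0 ltW.
pose dd i := `|diff_coef a (m.+1 + i)%N|.
have gE i : (-1) ^+ m * gbinom a (m.+1 + i)%N = (-1) ^+ i * dd i.
  rewrite /dd addSn ler0_norm ?diff_coef_le0// /diff_coef exprS mulN1r mulNr opprK.
  by rewrite [RHS]mulrA -exprD addnCA addnn exprD -mul2n exprM sqrrN !expr1n mulr1.
have -> : `|gbinom a m.+1| = dd 0%N.
  by rewrite /dd addn0 /diff_coef normrMsign.
rewrite mulr_sumr (eq_bigr (fun i : 'I_n => (-1) ^+ i * dd i)) => [|i _].
  apply: alternating_sum => j; first exact: normr_ge0.
  rewrite /dd addnS; set k := (m.+1 + j)%N.
  have k0 : 0 < k.+1%:R :> R by rewrite ltr0n.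
  rewrite -(ler_pM2l k0) -{1}(gtr0_norm k0) -normrM diff_coefS normrM.
  rewrite ler_wpM2r// -natr1 ger0_norm; first lra.
  by rewrite subr_ge0 (le_trans (ltW a1))// ler1n /k addSn.
exact: gE.
Qed.

(** The value at z = 1 of (1 + z)^a, that is, 2^a. *)
Definition binomial_sum a : R := limn (fun n => \sum_(j < n) gbinom a j).

Lemma binomial_sum_cvg a : 0 <= a ->
  (fun n => \sum_(j < n) gbinom a j) @ \oo --> binomial_sum a.
Proof.
move=> /diff_coef_l1[C /gbinom_l1 aC].
suff : cvgn (fun n => \sum_(j < n) gbinom a j) by [].
have : cvgn (series (fun j => `|gbinom a j|)).
  apply: nondecreasing_is_cvgn; first by apply: nondecreasing_series => // n _.
  by exists C => _ [n _ <-]; rewrite seriesEord; exact: aC.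
move/normed_cvg; rewrite (_ : series _ = fun n => \sum_(j < n) gbinom a j)//.
by apply/funext => n; rewrite seriesEord.
Qed.

Lemma binomial_sumD a b : 0 <= a -> 0 <= b ->
  binomial_sum (a + b) = binomial_sum a * binomial_sum b.
Proof.
move=> a0 b0; have [A /gbinom_l1 aA] := diff_coef_l1 a0.
have [B /gbinom_l1 bB] := diff_coef_l1 b0.
have A0 : 0 <= A by have := aA 0%N; rewrite big_ord0.
have [|j|l [h1 h2]] := @cauchy_double _ (fun j k => gbinom a j * gbinom b k) (A * B)
    (fun j => gbinom a j * binomial_sum b).
- move=> n; apply: (@le_trans _ _ (\sum_(j < n) `|gbinom a j| * B)).
    apply: ler_sum => j _; under eq_bigr do rewrite normrM.
    by rewrite -mulr_sumr ler_wpM2l//; exact: bB.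
  rewrite -mulr_suml; apply: ler_wpM2r; last exact: aA.
  by have := bB 0%N; rewrite big_ord0.
- under eq_cvg do rewrite -mulr_sumr.
  by apply: cvgMl_tmp; exact: binomial_sum_cvg.
have e1 : l = binomial_sum (a + b).
  rewrite /binomial_sum -vandermonde; apply/esym/cvg_lim => //.
have e2 : l = binomial_sum a * binomial_sum b.
  apply: (cvg_unique _ h2) => //=; under eq_cvg do rewrite -mulr_suml.
  by apply: cvgMr_tmp; exact: binomial_sum_cvg.
by rewrite -e1 e2.
Qed.

Lemma binomial_sum1 : binomial_sum 1 = 2.
Proof.
apply/cvg_lim => //; apply: cvg_near_cst; exists 2%N => // n /= n2.
rewrite -(subnKC n2) big_split_ord/= !big_ord_recl big_ord0 !gbinom1/= addr0.
by rewrite bin0 binn [X in _ + X]big1 ?addr0// => i _; rewrite gbinom1 bin_small.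
Qed.

(** A lower bound up to a factor 2, which the power trick of
    [binomial_sum_ge_pow] removes. *)
Lemma binomial_sum_ge a : 0 <= a -> 2 `^ (a - 1) <= binomial_sum a.
Proof.
move: a; apply: fractional_induction => [a a01|a a0 IH]; last first.
  rewrite binomial_sumD// binomial_sum1 addrK.
  rewrite -[a](subrK 1) powRD; last by rewrite pnatr_eq0 implybT.
  by rewrite powRr1// subrK ler_wpM2r.
apply: (@le_trans _ _ 1).
  rewrite -[leRHS](powRr0 2) ler_powR ?ler1n// ; case/andP: a01; lra.
have a0 : 0 <= a by case/andP: a01.
apply: (cvgr_to_ge (binomial_sum_cvg a0)); exists 1%N => // -[//|n] _ /=.
rewrite big_ord_recl gbinom0 lerDl.
have /andP[+ _] := gbinom_tail 0 n a01.
by rewrite expr0 mul1r; under eq_bigr do rewrite add1n.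
Qed.

(** Since [binomial_sum] is multiplicative, applying [binomial_sum_ge] to a
    multiple n a and taking the n-th root makes the constant disappear. *)
Lemma binomial_sum_ge_pow a : 0 <= a -> 2 `^ a <= binomial_sum a.
Proof.
move=> a0; have p0 : 0 < 2 `^ a :> R by rewrite powR_gt0.
have s0 : 0 < binomial_sum a by apply: lt_le_trans (binomial_sum_ge a0); rewrite powR_gt0.
rewrite leNgt; apply/negP => lt.
pose x := binomial_sum a / 2 `^ a.
have x0 : 0 <= x by rewrite divr_ge0 ?ltW.
have x1 : x < 1 by rewrite ltr_pdivrMr// mul1r.
have powE n : binomial_sum (a * n.+1%:R) = binomial_sum a ^+ n.+1.
  elim: n => [|n IH]; first by rewrite mulr1 expr1.
  rewrite -natr1 mulrDr mulr1 binomial_sumD ?mulr_ge0// IH.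
  by rewrite [RHS]exprSr.
have xn n : 2^-1 <= x ^+ n.+1.
  rewrite /x expr_div_n -powE ler_pdivlMr ?exprn_gt0//.
  apply: le_trans (binomial_sum_ge _); last by rewrite mulr_ge0.
  rewrite powRD; last by rewrite pnatr_eq0 implybT.
  rewrite powRN powRr1// mulrC ler_wpM2r ?invr_ge0//.
  by rewrite powRrM powR_mulrn ?powR_ge0.
have : 2^-1 <= 0 :> R.
  apply: (@cvgr_to_ge _ \oo _ _ (fun n => x ^+ n)).
    by apply: cvg_expr; rewrite ger0_norm.
  by exists 1%N => // -[//|n] _; exact: xn.
lra.
Qed.

Let marchaud_core a : 0 <= a -> exists C, exists2 Q : nat -> R, l1_le Q C &
  convol (diff_coef 1) Q = fun m => binomial_sum a * delta0 m - gbinom a m.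
Proof.
move: a; apply: fractional_induction => [a a01|a a0 [C [Q QC QE]]].
  have a0 : 0 <= a by case/andP: a01.
  pose Q m := binomial_sum a - \sum_(j < m.+1) gbinom a j.
  exists 2, Q.
    have a01' : 0 <= a <= 1 by case/andP: a01 => -> /ltW.
    move=> n; apply: le_trans (gbinom_l1 (diff_coef_l1_01 a01') n.+1).
    rewrite big_ord_recl; apply: ler_wpDl => //; apply: ler_sum => m _.
    have cQ : (fun N => `|\sum_(j < N) gbinom a j - \sum_(j < m.+1) gbinom a j|)
        @ \oo --> `|Q m|.
      by apply: cvg_norm; apply: cvgB; [exact: binomial_sum_cvg|exact: cvg_cst].
    apply: (cvgr_to_le cQ); exists m.+1 => // N /= mN.
    rewrite (sum_ord_sub _ mN) -(normrMsign m).
    by have /andP[h1 h2] := gbinom_tail m (N - m.+1) a01; rewrite ger0_norm.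
  apply/funext => m; rewrite conv_diff1 /Q /delta0; case: m => [|m]/=.
    by rewrite big_ord_recl big_ord0 addr0 subr0 mulr1.
  by rewrite mulr0 [X in _ - X - _]big_ord_recr/=; lra.
have [A aA] := diff_coef_l1 a0.
exists (2 * C + A), (fun m => 2 * Q m + gbinom a m).
  apply: l1_leD; last exact: gbinom_l1.
  by rewrite -[X in X * C]ger0_norm//; exact: l1_leZ.
apply/funext => m; rewrite conv_diff1.
have := congr1 (fun f => f m) QE; rewrite conv_diff1 binomial_sumD// binomial_sum1.
case: m => [|m]; rewrite /delta0/= ?gbinom0 => h; first lra.
by rewrite gbinom_pascal; lra.
Qed.

(** By [gbinom_diff_coef], the left-hand side is (1 - z)^a (2^a - (1 + z)^a).
    The last factor vanishes at z = 1, and dividing it by 1 - z leaves a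
    summable series: for fractional a, its coefficients are the tails of an
    alternating series. *)
Lemma marchaud_factor a b : 0 <= a -> a <= b <= a + 1 ->
  exists C, exists2 Q : nat -> R, l1_le Q C &
  forall m, binomial_sum a * diff_coef a m - upsample 2 (diff_coef a) m =
    convol Q (diff_coef b) m.
Proof.
move=> a0 /andP[ab ba]; have [C [Q QC QE]] := marchaud_core a0.
have b1 : 0 <= a + 1 - b by rewrite subr_ge0.
have [B bB] := diff_coef_l1 b1.
exists (C * B), (convol Q (diff_coef (a + 1 - b))); first exact: conv_l1.
move=> m; rewrite -convA diff_coefD subrK (addrC a) -diff_coefD convA (convC Q).
rewrite QE -gbinom_diff_coef {1}/convol.
rewrite /convol -{1}[diff_coef a]conv0l mulr_sumr -sumrB.
by apply: eq_bigr => j _; rewrite mulrBl mulrA.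
Qed.

End binomial_sum.

(** * Integral norms *)

Section measurable_limits.
Context {R : realType} {dd : measure_display} {T : measurableType dd}.

(** Limits of sequences of functions are total here: they have a fixed value at
    the points of divergence, so the set of convergence, which is measurable by
    Cauchy's criterion, has to be separated. *)
Lemma measurable_limn (h : (T -> R)^nat) :
  (forall n, measurable_fun [set: T] (h n)) ->
  measurable_fun [set: T] (fun x => limn (h ^~ x)).
Proof.
move=> mh.
pose C := \bigcap_k \bigcup_N \bigcap_m \bigcap_n
    [set x | `|h (N + m)%N x - h (N + n)%N x| <= k.+1%:R^-1].
have mC : measurable C.
  apply: bigcap_measurable => // k _; apply: bigcup_measurable => N _.
  apply: bigcap_measurable => // m _; apply: bigcap_measurable => // n _.
  have mhh : measurable_fun [set: T] (fun x => `|h (N + m)%N x - h (N + n)%N x|).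
    by apply: measurableT_comp => //; exact: measurable_funB.
  rewrite -[X in measurable X]setTI; apply: measurable_fun_le => //.
have CP x : C x <-> cvgn (h ^~ x).
  split.
    move=> Cx; apply/cauchy_cvgP/cauchy_ballP => e e0.
    have [k ke] : exists k : nat, k.+1%:R^-1 < e.
      by have [k] := ltr_add_invr e0; rewrite add0r => ?; exists k.
    have [N _ hN] := Cx k I.
    near_simpl; exists ([set n | (N <= n)%N], [set n | (N <= n)%N]).
      by split; exists N.
    move=> [m n] /= [Nm Nn]; rewrite /ball/=.
    have := hN (m - N)%N I (n - N)%N I; rewrite /= !subnKC// => /le_lt_trans; exact.
  move=> cx k _; have k0 : 0 < k.+1%:R^-1 / 2 :> R by rewrite divr_gt0.
  have /cvgrPdist_lt/(_ _ k0)[N _ hN] := cx.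
  exists N => // m _ n _ /=.
  have h1 := hN (N + m)%N (leq_addr _ _); have h2 := hN (N + n)%N (leq_addr _ _).
  rewrite -(subrKA (limn (h ^~ x))) (le_trans (ler_normD _ _))//.
  by rewrite (splitr k.+1%:R^-1) lerD// ltW// distrC.
pose g n x := if x \in C then h n x else point : R.
apply: (@measurable_fun_cvg _ _ _ _ g) => [n|x _].
  apply: measurable_fun_ifT => //.
  apply: (measurable_fun_bool true); rewrite setTI.
  rewrite [X in measurable X](_ : _ = C)//; apply/seteqP; split => x /=; first by move/set_mem.
  exact: mem_set.
rewrite /g; case: (boolP (x \in C)) => [xC|/negP xC].
  exact: (iffLR (CP x) (set_mem xC)).
rewrite (_ : limn _ = point); first exact: cvg_cst.
apply: getPN => l cl; apply: xC; apply/mem_set/CP; apply/cvg_ex; by exists l.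
Qed.

End measurable_limits.

Section Lp_lemmas.
Context {R : realType} {dd : measure_display} {T : measurableType dd}.
Variables (mu : {measure set T -> \bar R}) (p : R).
Hypothesis p1 : 1 <= p.
Implicit Types (u v : T -> R).

Let p0 : 0 < p. Proof. exact: lt_le_trans ltr01 p1. Qed.
Let pn0 : p != 0. Proof. by rewrite gt_eqF. Qed.

Lemma integral_LnormE u :
  (\int[mu]_x (`|u x| `^ p)%:E = Lnorm mu p%:E (EFin \o u) `^ p)%E.
Proof.
rewrite poweR_Lnorm//; apply: eq_integral => x _.
Qed.

Lemma Lnorm_leP u K : 0 <= K ->
  (Lnorm mu p%:E (EFin \o u) <= K%:E)%E <->
  (\int[mu]_x (`|u x| `^ p)%:E <= (K `^ p)%:E)%E.
Proof.
move=> K0; rewrite integral_LnormE; have N0 := Lnorm_ge0 mu p%:E (EFin \o u).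
have mono (r : R) (x y : \bar R) : 0 <= r -> (0 <= x -> x <= y -> x `^ r <= y `^ r)%E.
  move=> r0 x0 xy; rewrite gt0_ler_poweR// in_itv/= leey andbT//.
  exact: le_trans xy.
rewrite -poweR_EFin; split => h; first by rewrite mono// ltW.
have inv (x : \bar R) : (0 <= x -> (x `^ p) `^ p^-1 = x)%E.
  by move=> x0; rewrite -poweRrM mulfV// poweRe1.
rewrite -(inv _ N0) -(inv K%:E); last by rewrite lee_fin.
by rewrite mono// ?invr_ge0 ?poweR_ge0// ltW.
Qed.

Lemma Lnorm_le u v : measurable_fun setT u -> measurable_fun setT v ->
  (forall x, `|u x| <= `|v x|) ->
  (Lnorm mu p%:E (EFin \o u) <= Lnorm mu p%:E (EFin \o v))%E.
Proof.
move=> mu' mv uv.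
have [->|] := eqVneq (Lnorm mu p%:E (EFin \o v)) +oo%E; first exact: leey.
rewrite -ltey => voo; have N0 := Lnorm_ge0 mu p%:E (EFin \o v).
have fv : (Lnorm mu p%:E (EFin \o v) \is a fin_num)%E by rewrite ge0_fin_numE.
rewrite -(fineK fv); apply/Lnorm_leP; first exact: fine_ge0.
rewrite -poweR_EFin fineK// -integral_LnormE.
apply: ge0_le_integral => //.
- apply/measurable_EFinP/(measurableT_comp (measurable_powR p)).
  exact: measurableT_comp.
- apply/measurable_EFinP/(measurableT_comp (measurable_powR p)).
  exact: measurableT_comp.
- by move=> x _; rewrite lee_fin ge0_ler_powR// ?nnegrE// ltW.
Qed.

Lemma Lnorm_scale u (k : R) : measurable_fun setT u ->
  Lnorm mu p%:E (EFin \o (fun x => k * u x)) =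
  (`|k|%:E * Lnorm mu p%:E (EFin \o u))%E.
Proof.
move=> mu'; rewrite unlock /Lnorm/=.
rewrite (_ : `|k|%:E = (`|k|%:E `^ p) `^ p^-1)%E; last first.
  by rewrite -poweRrM mulfV// poweRe1 ?lee_fin.
have I0 : (0 <= \int[mu]_x `|(u x)%:E| `^ p)%E.
  by apply: integral_ge0 => x _; exact: poweR_ge0.
rewrite -poweRM ?poweR_ge0//.
congr (_ `^ _)%E; rewrite poweR_EFin -ge0_integralZl_EFin//.
- by apply: eq_integral => x _ /=; rewrite normrM powRM// EFinM.
apply/measurable_EFinP/(measurableT_comp (measurable_powR p)).
exact: measurableT_comp.
Qed.

Lemma Lnorm_sum_le n (u : nat -> T -> R) (k : nat -> R) (N : \bar R) :
  (forall j, measurable_fun setT (u j)) ->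
  (0 <= N)%E -> (forall j, (Lnorm mu p%:E (EFin \o u j) <= N)%E) ->
  (Lnorm mu p%:E (EFin \o (fun x => \sum_(j < n) k j * u j x)%R) <=
   (\sum_(j < n) `|k j|)%:E * N)%E.
Proof.
move=> mu' N0 uN; elim: n => [|n IH].
  rewrite big_ord0 mul0e (_ : _ \o _ = cst 0%E) ?Lnorm0//.
  by apply/funext => x /=; rewrite big_ord0.
rewrite (_ : _ \o _ = EFin \o ((fun x => \sum_(j < n) k j * u j x)
    \+ (fun x => k n * u n x))); last first.
  by apply/funext => x /=; rewrite big_ord_recr.
apply: (le_trans (minkowski_EFin _ _ _ p1)).
- by apply: measurable_sum => j; apply: measurable_funM.
- exact: measurable_funM.
rewrite big_ord_recr/= EFinD ge0_muleDl ?lee_fin ?sumr_ge0//.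
by apply: leeD => //; rewrite Lnorm_scale// lee_wpmul2l ?lee_fin.
Qed.

(** Monotone convergence for a pointwise nondecreasing sequence that is bounded
    in norm, in a form that never mentions the possibly infinite limit. *)
Lemma Lnorm_sup (v : nat -> T -> R) K : 0 <= K ->
  (forall n, measurable_fun setT (v n)) -> (forall n x, 0 <= v n x) ->
  (forall x, nondecreasing_seq (v ^~ x)) ->
  (forall n, (Lnorm mu p%:E (EFin \o v n) <= K%:E)%E) ->
  {ae mu, forall x, exists M, forall n, v n x <= M} /\
  forall g : T -> R, measurable_fun setT g ->
    (forall x M, (forall n, v n x <= M) -> `|g x| <= M) ->
    (Lnorm mu p%:E (EFin \o g) <= K%:E)%E.
Proof.
move=> K0 mv v0 ndv vK.
pose V x := limn (fun n => (v n x `^ p)%:E).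
have mvp n : measurable_fun setT (fun x => (v n x `^ p)%:E).
  by apply/measurable_EFinP/(measurableT_comp (measurable_powR p)).
have vp0 n x : setT x -> (0 <= (v n x `^ p)%:E)%E by rewrite lee_fin powR_ge0.
have ndvp x : setT x -> {homo (fun n => (v n x `^ p)%:E) : n m / (n <= m)%N >-> (n <= m)%E}.
  move=> _ m n mn; rewrite lee_fin ge0_ler_powR// ?nnegrE ?(ltW p0)//.
  exact: ndv.
have cV x : (fun n => (v n x `^ p)%:E) @ \oo --> V x.
  exact: (ereal_nondecreasing_is_cvgn (ndvp x I)).
have vV n x : ((v n x `^ p)%:E <= V x)%E.
  apply: lime_ge; first exact: (ereal_nondecreasing_is_cvgn (ndvp x I)).
  by exists n => // m /= nm; exact: ndvp.
have mV : measurable_fun setT V.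
  by apply: emeasurable_fun_cvg mvp _ => x _; exact: cV.
have V0 x : (0 <= V x)%E by apply: le_trans (vV 0%N x); exact: vp0.
have IV : (\int[mu]_x V x <= (K `^ p)%:E)%E.
  rewrite (monotone_convergence mu measurableT mvp vp0 ndvp).
  apply: lime_le.
    apply: ereal_nondecreasing_is_cvgn => m n mn; apply: ge0_le_integral => //.
      by move=> x _; exact: (vp0 m x I).
    by move=> x _; exact: (ndvp x I).
  apply: nearW => n; have /Lnorm_leP := vK n; move=> /(_ K0); apply: le_trans.
  have -> : (\int[mu]_x (`|v n x| `^ p)%:E = \int[mu]_x (v n x `^ p)%:E)%E.
    by apply: eq_integral => x _; rewrite ger0_norm.
  exact: lexx.
have bound x : V x \is a fin_num -> forall n, v n x <= fine (V x) `^ p^-1.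
  move=> fV n; have := vV n x; rewrite -(fineK fV) lee_fin => h.
  rewrite -[leLHS](@powRr1 _ (v n x))// -(mulfV pn0) powRrM.
  by rewrite ge0_ler_powR ?invr_ge0 ?(ltW p0)// ?nnegrE ?powR_ge0//= fine_ge0.
split.
  have : mu.-integrable setT V.
    apply/integrableP; split => //; apply: le_lt_trans (ltry (K `^ p)).
    apply: le_trans IV; rewrite (@eq_integral _ _ _ mu setT V (fun x => `|V x|%E))//.
    by move=> x _; rewrite gee0_abs.
  move/(integrable_ae measurableT); apply: filterS => x /(_ I) fV.
  by exists (fine (V x) `^ p^-1); exact: bound.
move=> g mg gM; apply/Lnorm_leP => //; apply: le_trans IV.
apply: ge0_le_integral => //.
- apply/measurable_EFinP/(measurableT_comp (measurable_powR p)).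
  exact: measurableT_comp.
- move=> x _; have [->|] := eqVneq (V x) +oo%E; first exact: leey.
  rewrite -ltey => Voo; have fV : V x \is a fin_num by rewrite ge0_fin_numE.
  have := gM _ _ (bound x fV) => h; rewrite -(fineK fV) lee_fin.
  apply: (@le_trans _ _ ((fine (V x) `^ p^-1) `^ p)).
    by rewrite ge0_ler_powR// ?nnegrE ?powR_ge0// ltW.
  by rewrite -powRrM mulVf// powRr1// fine_ge0.
Qed.

Lemma Lnorm_ae_eq u v : measurable_fun setT u -> measurable_fun setT v ->
  {ae mu, forall x, u x = v x} ->
  Lnorm mu p%:E (EFin \o u) = Lnorm mu p%:E (EFin \o v).
Proof.
move=> mu' mv uv; rewrite unlock /Lnorm/=; congr (_ `^ _)%E.
have mp (w : T -> R) : measurable_fun setT w -> measurable_fun setT (fun x => (`|w x|%:E `^ p)%E).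
  move=> mw; apply/measurable_EFinP/(measurableT_comp (measurable_powR p)).
  exact: measurableT_comp.
apply: ae_eq_integral => //; [exact: mp|exact: mp|].
by apply: filterS uv => x /= -> _.
Qed.

End Lp_lemmas.

(** * Power series in a translation *)

Section translations.
Context {R : realType} {d : nat}.
Implicit Types (x h : space R d) (c k : R).

Lemma translate_translate x c c' h :
  translate (translate x c h) c' h = translate x (c + c') h.
Proof. by apply: eq_from_tnth => i; rewrite !tnth_mktuple mulrDl addrA. Qed.

Lemma translateC x c h c' h' :
  translate (translate x c h) c' h' = translate (translate x c' h') c h.
Proof. by apply: eq_from_tnth => i; rewrite !tnth_mktuple addrAC. Qed.

Lemma translate0 x h : translate x 0 h = x.
Proof. by apply: eq_from_tnth => i; rewrite !tnth_mktuple mul0r addr0. Qed.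

Definition scale_vector k h : space R d := [tuple k * (tnth h i : R) | i < d].

Lemma translate_scale x c k h :
  translate x c (scale_vector k h) = translate x (c * k) h.
Proof. by apply: eq_from_tnth => i; rewrite !tnth_mktuple mulrA. Qed.

Lemma enorm_scale k h : enorm (scale_vector k h) = `|k| * enorm h.
Proof.
rewrite /enorm -sqrtr_sqr -sqrtrM ?sqr_ge0//; congr Num.sqrt.
by rewrite mulr_sumr; apply: eq_bigr => i _; rewrite tnth_mktuple exprMn.
Qed.

Lemma measurable_translate c h :
  measurable_fun [set: space R d] (fun x => translate x c h).
Proof.
apply/measurable_fun_tnthP => i.
rewrite (_ : _ \o _ = fun x : space R d => (tnth x i : R) + c * (tnth h i : R)).
  apply: measurable_funD => //; exact: measurable_tnth.
by apply/funext => x; rewrite /= tnth_mktuple.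
Qed.

End translations.

Section complex_modulus.
Context {R : realType}.
Implicit Types (z w : R[i]) (x y : R).

Lemma normcE x y : normc (x +i* y)%C = Num.sqrt (x ^+ 2 + y ^+ 2).
Proof. by []. Qed.

Lemma normc_ge0 z : 0 <= normc z.
Proof. by case: z => x y; exact: sqrtr_ge0. Qed.

Lemma normc_scale (k : R) x y :
  normc ((k * x) +i* (k * y))%C = `|k| * normc (x +i* y)%C.
Proof.
by rewrite !normcE -sqrtr_sqr -sqrtrM ?sqr_ge0// !exprMn mulrDr.
Qed.

Lemma normc_add x y x' y' :
  normc ((x + x') +i* (y + y'))%C <= normc (x +i* y)%C + normc (x' +i* y')%C.
Proof. exact: (le_normcD (x +i* y)%C (x' +i* y')%C). Qed.

Lemma Re_le_normc z : `|Re z| <= normc z.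
Proof.
by case: z => x y; rewrite normcE/= -sqrtr_sqr ler_wsqrtr// lerDl sqr_ge0.
Qed.

Lemma Im_le_normc z : `|Im z| <= normc z.
Proof.
by case: z => x y; rewrite normcE/= -sqrtr_sqr ler_wsqrtr// lerDr sqr_ge0.
Qed.

Lemma normc_sum n (a : nat -> R) (z : nat -> R[i]) :
  normc ((\sum_(j < n) a j * Re (z j)) +i* (\sum_(j < n) a j * Im (z j)))%C <=
  \sum_(j < n) `|a j| * normc (z j).
Proof.
elim: n => [|n IH].
  by rewrite !big_ord0 normcE expr0n/= addr0 sqrtr0.
rewrite !big_ord_recr/=; apply: le_trans (normc_add _ _ _ _) _.
by rewrite lerD// normc_scale; case: (z n).
Qed.

Lemma cvg_normc (u v : nat -> R) (x y : R) : u @ \oo --> x -> v @ \oo --> y ->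
  (fun n => normc (u n +i* v n)%C) @ \oo --> normc (x +i* y)%C.
Proof.
move=> ux vy; rewrite normcE.
apply: (@cvg_comp _ _ _ (fun n => u n ^+ 2 + v n ^+ 2) Num.sqrt _ _ _ _
  (@sqrt_continuous R _)).
by apply: cvgD; rewrite ?expr2; apply: cvgM.
Qed.

Lemma measurable_normc dd (T : measurableType dd) (f : T -> R[i]) :
  measurable_fun setT (fun t => Re (f t)) -> measurable_fun setT (fun t => Im (f t)) ->
  measurable_fun setT (fun t => normc (f t)).
Proof.
move=> mr mi.
rewrite (_ : (fun t => _) = (@powR R ^~ 2^-1) \o (fun t => Re (f t) ^+ 2 + Im (f t) ^+ 2)).
  apply: measurableT_comp; first exact: measurable_powR.
  by apply: measurable_funD; rewrite /=; apply: measurable_funX.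
apply/funext => t /=; rewrite powR12_sqrt ?addr_ge0 ?sqr_ge0//.
by case: (f t).
Qed.

End complex_modulus.

Section operators.
Context {R : realType} {d : nat}.
Implicit Types (f g : space R d -> R[i]) (u : space R d -> R)
  (h x : space R d) (a b : nat -> R) (s t : R).

Definition op_real a s h u x : R :=
  limn (fun n => \sum_(0 <= j < n) a j * u (translate x (s - j%:R) h)).

(** The operator sum_j a_j T^j, for T the translation by - h, followed by the
    translation by s h. *)
Definition op a s h f x : R[i] :=
  (op_real a s h (fun y => Re (f y)) x +i*
   op_real a s h (fun y => Im (f y)) x)%C.

Lemma difference_op (al : R) h f : difference al h f = op (diff_coef al) al h f.
Proof. by []. Qed.

Definition majorant a s h f n x : R :=
  \sum_(j < n) `|a j| * normc (f (translate x (s - j%:R) h)).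

Definition summable_at a s h f x := exists M, forall n, majorant a s h f n x <= M.

Lemma op_realE a s h u x : op_real a s h u x =
  limn (fun n => \sum_(j < n) a j * u (translate x (s - j%:R) h)).
Proof.
by rewrite /op_real; under eq_fun do rewrite big_mkord.
Qed.

Lemma majorant_ge0 a s h f n x : 0 <= majorant a s h f n x.
Proof. by apply: sumr_ge0 => j _; rewrite mulr_ge0// normc_ge0. Qed.

Lemma majorant_nd a s h f x : nondecreasing_seq (fun n => majorant a s h f n x).
Proof.
move=> m n mn; apply: (@le_sum_ord _ (fun j => `|a j| * normc (f (translate x (s - j%:R) h)))) => // j.
by rewrite mulr_ge0// normc_ge0.
Qed.

Lemma op_real_cvg a s h f u x : (forall y, `|u y| <= normc (f y)) ->
  summable_at a s h f x ->
  (fun n => \sum_(j < n) a j * u (translate x (s - j%:R) h)) @ \oo -->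
    op_real a s h u x.
Proof.
move=> uf [M fM]; rewrite op_realE.
suff : cvgn (fun n => \sum_(j < n) a j * u (translate x (s - j%:R) h)) by [].
have : cvgn (series (fun j => `|a j * u (translate x (s - j%:R) h)|)).
  apply: nondecreasing_is_cvgn; first by apply: nondecreasing_series => // n _.
  exists M => _ [n _ <-]; rewrite seriesEord; apply: le_trans (fM n).
  by apply: ler_sum => j _; rewrite normrM ler_wpM2l.
move/normed_cvg; set v := (X in _ -> cvg (X @ _)).
by rewrite (_ : series _ = v)//; apply/funext => n; rewrite seriesEord.
Qed.

Lemma op_Re_cvg a s h f x : summable_at a s h f x ->
  (fun n => \sum_(j < n) a j * Re (f (translate x (s - j%:R) h))) @ \oo -->
    Re (op a s h f x).
Proof. by apply: (@op_real_cvg _ _ _ f (fun y => Re (f y))) => y; exact: Re_le_normc. Qed.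

Lemma op_Im_cvg a s h f x : summable_at a s h f x ->
  (fun n => \sum_(j < n) a j * Im (f (translate x (s - j%:R) h))) @ \oo -->
    Im (op a s h f x).
Proof. by apply: (@op_real_cvg _ _ _ f (fun y => Im (f y))) => y; exact: Im_le_normc. Qed.

Lemma complex_ext (z w : R[i]) : Re z = Re w -> Im z = Im w -> z = w.
Proof. by case: z w => x y [x' y'] /= -> ->. Qed.

Lemma op_limit a s h f x (v w : R) : summable_at a s h f x ->
  (fun n => \sum_(j < n) a j * Re (f (translate x (s - j%:R) h))) @ \oo --> v ->
  (fun n => \sum_(j < n) a j * Im (f (translate x (s - j%:R) h))) @ \oo --> w ->
  op a s h f x = (v +i* w)%C.
Proof.
move=> sf hr hi; apply: complex_ext.
  exact: (cvg_unique _ (op_Re_cvg sf) hr).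
exact: (cvg_unique _ (op_Im_cvg sf) hi).
Qed.

Lemma normc_op_le a s h f x M : (forall n, majorant a s h f n x <= M) ->
  normc (op a s h f x) <= M.
Proof.
move=> fM; have sf : summable_at a s h f x by exists M.
have := cvg_normc (op_Re_cvg sf) (op_Im_cvg sf).
move=> /cvgr_to_le; apply; apply: nearW => n; apply: le_trans (fM n).
exact: (normc_sum n a (fun j => f (translate x (s - j%:R) h))).
Qed.

Lemma op_shift a s s' h f x :
  op a s h f x = op a s' h f (translate x (s - s') h).
Proof.
have E u : op_real a s h u x = op_real a s' h u (translate x (s - s') h).
  rewrite !op_realE; under [in RHS]eq_fun do
    under eq_bigr do rewrite translate_translate addrA subrK.
  by [].
by rewrite /op !E.
Qed.

Lemma op_scale a s h f (k : R) x : summable_at a s h f x ->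
  op (fun j => k * a j) s h f x = ((k * Re (op a s h f x)) +i* (k * Im (op a s h f x)))%C.
Proof.
move=> [M fM]; apply: op_limit.
- exists (`|k| * M) => n; rewrite /majorant.
  under eq_bigr do rewrite normrM -mulrA.
  by rewrite -mulr_sumr ler_wpM2l//; exact: fM.
- rewrite (_ : (fun n => _) = (fun n => k *
      \sum_(j < n) a j * Re (f (translate x (s - j%:R) h)))).
    by apply: cvgMl_tmp; apply: op_Re_cvg; exists M.
  by apply/funext => n; rewrite mulr_sumr; apply: eq_bigr => j _; rewrite mulrA.
- rewrite (_ : (fun n => _) = (fun n => k *
      \sum_(j < n) a j * Im (f (translate x (s - j%:R) h)))).
    by apply: cvgMl_tmp; apply: op_Im_cvg; exists M.
  by apply/funext => n; rewrite mulr_sumr; apply: eq_bigr => j _; rewrite mulrA.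
Qed.

Lemma op_add a b s h f x : summable_at a s h f x -> summable_at b s h f x ->
  op (fun j => a j + b j) s h f x = op a s h f x + op b s h f x.
Proof.
move=> sa sb; have [A fA] := sa; have [B fB] := sb.
have -> (z w : R[i]) : z + w = ((Re z + Re w) +i* (Im z + Im w))%C by case: z w => ? ? [].
apply: op_limit.
- exists (A + B) => n; apply: (le_trans _ (lerD (fA n) (fB n))).
  rewrite -big_split/=; apply: ler_sum => j _.
  by rewrite -mulrDl ler_wpM2r ?normc_ge0 ?ler_normD.
- rewrite (_ : (fun n => _) = (fun n =>
      \sum_(j < n) a j * Re (f (translate x (s - j%:R) h)) +
      \sum_(j < n) b j * Re (f (translate x (s - j%:R) h)))).
    by apply: cvgD; exact: op_Re_cvg.
  by apply/funext => n; rewrite -big_split; apply: eq_bigr => j _; rewrite mulrDl.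
- rewrite (_ : (fun n => _) = (fun n =>
      \sum_(j < n) a j * Im (f (translate x (s - j%:R) h)) +
      \sum_(j < n) b j * Im (f (translate x (s - j%:R) h)))).
    by apply: cvgD; exact: op_Im_cvg.
  by apply/funext => n; rewrite -big_split; apply: eq_bigr => j _; rewrite mulrDl.
Qed.

(** The n-fold shift is the shift by the n-fold vector. *)
Lemma op_upsample a s h f n x : (0 < n)%N ->
  summable_at (upsample n a) s h f x ->
  op (upsample n a) s h f x = op a (s / n%:R) (scale_vector n%:R h) f x.
Proof.
move=> n0 sf; have nR : n%:R != 0 :> R by rewrite pnatr_eq0 -lt0n.
have tE i : translate x (s / n%:R - i%:R) (scale_vector n%:R h) =
    translate x (s - (n * i)%:R) h.
  by rewrite translate_scale mulrBl divfK// mulrC natrM [n%:R * _]mulrC.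
have sub_cvg : (fun q => (n * q)%N.+1) @ \oo --> \oo.
  move=> A [N _ NA]; exists N => // q /= Nq; apply: NA => /=.
  by rewrite (leq_trans Nq)// leqW// leq_pmull.
have partial (F : R[i] -> R) q :
    \sum_(j < (n * q)%N.+1) upsample n a j * F (f (translate x (s - j%:R) h)) =
    \sum_(i < q.+1) a i * F (f (translate x (s / n%:R - i%:R) (scale_vector n%:R h))).
  rewrite (sum_upsample a (fun j => F (f (translate x (s - j%:R) h))))//.
  by rewrite mulKn//; apply: eq_bigr => i _; rewrite tE.
have [M fM] := sf.
have sf' : summable_at a (s / n%:R) (scale_vector n%:R h) f x.
  exists M => q; apply: le_trans (fM (n * q)%N.+1).
  apply: (le_trans (majorant_nd _ _ _ _ _ (leqnSn q))).
  rewrite /majorant (eq_bigr (fun j : 'I_(n * q).+1 => upsample n (fun i => `|a i|) j *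
      normc (f (translate x (s - j%:R) h)))).
    rewrite (sum_upsample _ (fun j => normc (f (translate x (s - j%:R) h))))//.
    by rewrite mulKn// ler_sum// => i _; rewrite tE.
  by move=> j _; rewrite /upsample; case: ifP => _//; rewrite normr0.
have limE (F : R[i] -> R) (l l' : R) :
    (fun m => \sum_(j < m) upsample n a j * F (f (translate x (s - j%:R) h))) @ \oo --> l ->
    (fun m => \sum_(j < m) a j *
      F (f (translate x (s / n%:R - j%:R) (scale_vector n%:R h)))) @ \oo --> l' -> l = l'.
  move=> /(cvg_comp _ _ sub_cvg) h1; rewrite -cvg_shiftS => h2.
  apply: (cvg_unique _ _ h2) => //; move: h1; rewrite /comp.
  by under eq_fun do rewrite partial.
apply: complex_ext.
  exact: (limE _ _ _ (op_Re_cvg sf) (op_Re_cvg sf')).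
exact: (limE _ _ _ (op_Im_cvg sf) (op_Im_cvg sf')).
Qed.

(** Pointwise composition of two power series in a translation; absolute
    summability at the point allows the rearrangement. *)
Lemma op_conv_at a b s t h f x M :
  (forall n, \sum_(j < n) \sum_(k < n) `|a j| * (`|b k| *
     normc (f (translate x (s - j%:R + (t - k%:R)) h))) <= M) ->
  op a s h (op b t h f) x = op (convol a b) (s + t) h f x.
Proof.
move=> fM.
have sb j : a j != 0 -> summable_at b t h f (translate x (s - j%:R) h).
  move=> aj; exists (M / `|a j|) => n; rewrite ler_pdivlMr ?normr_gt0// mulrC.
  apply: le_trans (fM (maxn n j.+1)); rewrite /majorant mulr_sumr.
  have jn : (j < maxn n j.+1)%N by rewrite leq_max leqnn orbT.
  rewrite (bigD1 (Ordinal jn))//= -[leLHS]addr0 lerD//; last first.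
    by do 2 (apply: sumr_ge0 => ? _); rewrite !mulr_ge0// normc_ge0.
  under eq_bigr do rewrite translate_translate.
  apply: (@le_sum_ord _ (fun k => `|a j| * (`|b k| *
     normc (f (translate x (s - j%:R + (t - k%:R)) h))))) => [k|].
    by rewrite !mulr_ge0// normc_ge0.
  by rewrite leq_max leqnn.
have main (F : R[i] -> R) : (forall z, `|F z| <= normc z) ->
    op_real a s h (fun y => op_real b t h (fun y' => F (f y')) y) x =
    op_real (convol a b) (s + t) h (fun y => F (f y)) x.
  move=> FN.
  pose K j k := a j * (b k * F (f (translate x (s - j%:R + (t - k%:R)) h))).
  pose r j := a j * op_real b t h (fun y => F (f y)) (translate x (s - j%:R) h).
  have [|j|l [h1 h2]] := @cauchy_double _ K M r.
  - move=> n; apply: le_trans (fM n); apply: ler_sum => j _; apply: ler_sum => k _.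
    by rewrite !normrM !ler_wpM2l.
  - rewrite /K /r; under eq_fun do rewrite -mulr_sumr.
    have [->|aj] := eqVneq (a j) 0.
      by rewrite mul0r; under eq_fun do rewrite mul0r; exact: cvg_cst.
    apply: cvgMl_tmp.
    have := @op_real_cvg b t h f (fun y => F (f y)) _ (fun y => FN (f y)) (sb j aj).
    by under eq_fun do under eq_bigr do rewrite translate_translate.
  transitivity l.
    rewrite op_realE; apply/cvg_lim => //.
  rewrite op_realE; apply/esym/cvg_lim => //.
  rewrite (_ : (fun n => _) = (fun n => \sum_(m < n) \sum_(j < m.+1) K j (m - j)%N))//.
  apply/funext => n; apply: eq_bigr => m _; rewrite /convol mulr_suml.
  apply: eq_bigr => j _; rewrite /K mulrA; congr (_ * F (f (translate _ _ _))).
  have jm : (j <= m)%N by rewrite -ltnS.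
  by rewrite (natrB _ jm); lra.
apply: complex_ext; first exact: (main (fun z => Re z) (@Re_le_normc R)).
exact: (main (fun z => Im z) (@Im_le_normc R)).
Qed.

End operators.

(** * Translation-invariant L_p spaces *)

Section invariance.
Context {R : realType} {d : nat}.

(** The functions with the periods 2 pi v, for v in L: L is empty for R^d, and
    consists of the unit vectors for the torus. *)
Definition invariant (L : set (space R d)) (Y : Type) (F : space R d -> Y) :=
  forall v, L v -> forall x, F (translate x (2 * pi) v) = F x.

Definition translation_invariant (mu : {measure set (space R d) -> \bar R})
    (L : set (space R d)) :=
  forall F : space R d -> \bar R, (forall x, 0 <= F x)%E ->
    measurable_fun setT F -> invariant L F -> forall c h,
    (\int[mu]_x F (translate x c h) = \int[mu]_x F x)%E.

Lemma invariant_comp L (Y Z : Type) (F : space R d -> Y) (G : Y -> Z) :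
  invariant L F -> invariant L (fun x => G (F x)).
Proof. by move=> iF v Lv x; rewrite iF. Qed.

End invariance.

Section setting.
Context {R : realType} {d : nat}.
Variables (mu : {measure set (space R d) -> \bar R}) (L : set (space R d)) (p : R).
Hypothesis TI : translation_invariant mu L.
Hypothesis p1 : 1 <= p.
Implicit Types (f g : space R d -> R[i]) (u : space R d -> R)
  (h x : space R d) (a b : nat -> R) (s t : R).

Definition Lpi f := Lp mu p f /\ invariant L f.

Definition nrm f : R := fine (Lp_norm mu p f).

Lemma Lp_normE f : Lpi f -> Lp_norm mu p f = (nrm f)%:E.
Proof.
case=> -[_ _ foo] _; rewrite fineK// ge0_fin_numE//; exact: Lnorm_ge0.
Qed.

Lemma nrm_ge0 f : 0 <= nrm f.
Proof. by apply: fine_ge0; exact: Lnorm_ge0. Qed.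

Lemma Lpi_measurable_normc f : Lpi f -> measurable_fun setT (fun x => normc (f x)).
Proof. by case=> -[mr mi _] _; exact: measurable_normc. Qed.

Lemma Lp_norm_EFin f : Lp_norm mu p f = Lnorm mu p%:E (EFin \o (fun x => normc (f x))).
Proof. by []. Qed.

Lemma Lpi_intro f K : measurable_fun setT (fun x => Re (f x)) ->
  measurable_fun setT (fun x => Im (f x)) -> invariant L f ->
  (Lp_norm mu p f <= K%:E)%E -> Lpi f /\ nrm f <= K.
Proof.
move=> mr mi fi fK; have fX : Lpi f.
  by split => //; split => //; apply: le_lt_trans fK _; exact: ltry.
by split => //; rewrite -lee_fin -Lp_normE.
Qed.

Lemma Lnorm_translate u c h : measurable_fun setT u -> invariant L u ->
  Lnorm mu p%:E (EFin \o (fun x => u (translate x c h))) = Lnorm mu p%:E (EFin \o u).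
Proof.
move=> mf iu; rewrite unlock /Lnorm/=; congr (_ `^ _)%E.
rewrite -(TI (F := fun x => (`|u x|%:E `^ p)%E) _ _ _ c h)//.
- by move=> x; exact: poweR_ge0.
- apply/measurable_EFinP/(measurableT_comp (measurable_powR p)).
  exact: measurableT_comp.
- exact: (invariant_comp (fun y => (`|y|%:E `^ p)%E)).
Qed.

Lemma Lnorm_normc_translate f c h : Lpi f ->
  Lnorm mu p%:E (EFin \o (fun x => normc (f (translate x c h)))) = Lp_norm mu p f.
Proof.
move=> fX; apply: (@Lnorm_translate (fun x => normc (f x))).
  exact: Lpi_measurable_normc.
by apply: invariant_comp; case: fX.
Qed.

Lemma measurable_normc_translate f c h : Lpi f ->
  measurable_fun setT (fun x => normc (f (translate x c h))).
Proof.
move=> fX; apply: (@measurableT_comp _ _ _ _ _ _ (fun x => normc (f x))).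
  exact: Lpi_measurable_normc.
exact: measurable_translate.
Qed.

Lemma measurable_majorant a s h f n : Lpi f ->
  measurable_fun setT (majorant a s h f n).
Proof.
move=> fX; apply: measurable_sum => j; apply: measurable_funM => //.
exact: measurable_normc_translate.
Qed.

Lemma Lnorm_majorant a s h f n A : Lpi f -> l1_le a A ->
  (Lnorm mu p%:E (EFin \o majorant a s h f n) <= (A * nrm f)%:E)%E.
Proof.
move=> fX aA; apply: le_trans (Lnorm_sum_le p1 n (N := Lp_norm mu p f)
    (u := fun j x => normc (f (translate x (s - j%:R) h))) (fun j => `|a j|) _ _ _) _.
- by move=> j; exact: measurable_normc_translate.
- exact: Lnorm_ge0.
- by move=> j; rewrite Lnorm_normc_translate.
- rewrite Lp_normE// -EFinM lee_fin ler_wpM2r ?nrm_ge0//.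
  by under eq_bigr do rewrite normr_id; exact: aA.
Qed.

Lemma measurable_op_real a s h u : measurable_fun setT u ->
  measurable_fun setT (op_real a s h u).
Proof.
move=> mf; apply: (@measurable_limn _ _ _
  (fun n x => \sum_(0 <= j < n) a j * u (translate x (s - j%:R) h))) => n.
apply: measurable_sum => j; apply: measurable_funM => //.
by apply: measurableT_comp => //; exact: measurable_translate.
Qed.

Lemma invariant_op a s h f : invariant L f -> invariant L (op a s h f).
Proof.
move=> fi v Lv x.
have E (F : R[i] -> R) : op_real a s h (fun y => F (f y)) (translate x (2 * pi) v) =
    op_real a s h (fun y => F (f y)) x.
  rewrite !op_realE; under eq_fun do under eq_bigr do rewrite translateC fi//.
  by [].
by apply: complex_ext; [exact: (E (fun z => Re z))|exact: (E (fun z => Im z))].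
Qed.

(** Minkowski's inequality for the partial sums, and monotone convergence: the
    majorants converge almost everywhere because they are bounded in norm. *)
Lemma op_bound a A s h f : Lpi f -> l1_le a A ->
  [/\ {ae mu, forall x, summable_at a s h f x}, Lpi (op a s h f) &
      nrm (op a s h f) <= A * nrm f].
Proof.
move=> fX aA.
have A0 : 0 <= A by have := aA 0%N; rewrite big_ord0.
have K0 : 0 <= A * nrm f by rewrite mulr_ge0// nrm_ge0.
have [good dominated] := Lnorm_sup p1 K0
  (fun n => measurable_majorant a s h n fX)
  (fun n x => majorant_ge0 a s h f n x) (fun x => @majorant_nd _ _ a s h f x)
  (fun n => Lnorm_majorant s h n fX aA).
have [mr mi] : measurable_fun setT (fun x => Re (op a s h f x)) /\
    measurable_fun setT (fun x => Im (op a s h f x)).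
  by case: fX => -[mr mi _] _; split; exact: measurable_op_real.
have [] := @Lpi_intro (op a s h f) (A * nrm f) mr mi.
- by apply: invariant_op; case: fX.
- apply: dominated; first exact: measurable_normc.
  by move=> x M fM; rewrite ger0_norm ?normc_ge0//; exact: normc_op_le.
- by [].
Qed.

Lemma nrm_ae f g : Lpi f -> Lpi g -> {ae mu, forall x, f x = g x} -> nrm f = nrm g.
Proof.
move=> fX gX fg; rewrite /nrm !Lp_norm_EFin; congr fine; apply: Lnorm_ae_eq.
- exact: Lpi_measurable_normc.
- exact: Lpi_measurable_normc.
- by apply: filterS fg => x ->.
Qed.

Lemma op_conv_ae a b A B s t h f : Lpi f -> l1_le a A -> l1_le b B ->
  {ae mu, forall x, op a s h (op b t h f) x = op (convol a b) (s + t) h f x}.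
Proof.
move=> fX aA bB.
have A0 : 0 <= A by have := aA 0%N; rewrite big_ord0.
have B0 : 0 <= B by have := bB 0%N; rewrite big_ord0.
pose v n x := \sum_(j < n) \sum_(k < n) `|a j| * (`|b k| *
     normc (f (translate x (s - j%:R + (t - k%:R)) h))).
have vE n x : v n x = \sum_(j < n) `|a j| * majorant b (s - j%:R + t) h f n x.
  apply: eq_bigr => j _; rewrite /majorant mulr_sumr; apply: eq_bigr => k _.
  by rewrite addrA.
have v0 n x : 0 <= v n x.
  by do 2 (apply: sumr_ge0 => ? _); rewrite !mulr_ge0// normc_ge0.
have mv n : measurable_fun setT (v n).
  rewrite (_ : v n = fun x => \sum_(j < n) `|a j| * majorant b (s - j%:R + t) h f n x).
    apply: measurable_sum => j; apply: measurable_funM => //.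
    exact: measurable_majorant.
  by apply/funext => x; exact: vE.
have ndv x : nondecreasing_seq (v ^~ x).
  move=> m n mn; rewrite /v.
  apply: (@le_trans _ _ (\sum_(j < m) \sum_(k < n) `|a j| * (`|b k| *
     normc (f (translate x (s - j%:R + (t - k%:R)) h))))).
    apply: ler_sum => j _; apply: (@le_sum_ord _ (fun k => `|a j| * (`|b k| *
      normc (f (translate x (s - j%:R + (t - k%:R)) h))))) => // k.
    by rewrite !mulr_ge0// normc_ge0.
  apply: (@le_sum_ord _ (fun j => \sum_(k < n) `|a j| * (`|b k| *
      normc (f (translate x (s - j%:R + (t - k%:R)) h))))) => // j.
  by apply: sumr_ge0 => k _; rewrite !mulr_ge0// normc_ge0.
have vK n : (Lnorm mu p%:E (EFin \o v n) <= (A * (B * nrm f))%:E)%E.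
  rewrite (_ : v n = fun x => \sum_(j < n) `|a j| * majorant b (s - j%:R + t) h f n x);
    last by apply/funext => x; exact: vE.
  apply: le_trans (Lnorm_sum_le p1 n (N := (B * nrm f)%:E)
    (u := fun j => majorant b (s - j%:R + t) h f n) (fun j => `|a j|) _ _ _) _.
  - by move=> j; exact: measurable_majorant.
  - by rewrite lee_fin mulr_ge0// nrm_ge0.
  - by move=> j; exact: Lnorm_majorant.
  - rewrite -EFinM lee_fin; apply: ler_wpM2r; first by rewrite mulr_ge0// nrm_ge0.
    by under eq_bigr do rewrite normr_id; exact: aA.
have K0 : 0 <= A * (B * nrm f) by rewrite !mulr_ge0// nrm_ge0.
have [+ _] := Lnorm_sup p1 K0 mv v0 ndv vK.
by apply: filterS => x [M vM]; exact: (op_conv_at vM).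
Qed.

Lemma nrm_op_shift a A s s' h f : Lpi f -> l1_le a A ->
  nrm (op a s h f) = nrm (op a s' h f).
Proof.
move=> fX aA; have [_ oX _] := op_bound s' h fX aA.
rewrite /nrm; congr fine; rewrite -[RHS](Lnorm_normc_translate (s - s') h oX).
rewrite Lp_norm_EFin; congr (Lnorm _ _ (_ \o _)); apply/funext => x.
by rewrite (op_shift a s s').
Qed.

Lemma nrm_op_conv a b A B s t h f : Lpi f -> l1_le a A -> l1_le b B ->
  nrm (op (convol a b) s h f) <= A * nrm (op b t h f).
Proof.
move=> fX aA bB; have [_ bX _] := op_bound t h fX bB.
have [_ abX _] := op_bound s h fX (conv_l1 aA bB).
have [_ aX h1] := op_bound (s - t) h bX aA.
apply: le_trans h1; rewrite (nrm_ae abX aX)//.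
by apply: filterS (op_conv_ae (s - t) t h fX aA bB) => x ->; rewrite subrK.
Qed.

Lemma nrm_le f g : Lpi f -> Lpi g -> (forall x, normc (f x) <= normc (g x)) ->
  nrm f <= nrm g.
Proof.
move=> fX gX fg; rewrite -lee_fin -!Lp_normE//; apply: Lnorm_le => //.
- exact: Lpi_measurable_normc.
- exact: Lpi_measurable_normc.
- by move=> x; rewrite !ger0_norm ?normc_ge0.
Qed.

Lemma Lpi_add f g : Lpi f -> Lpi g ->
  Lpi (fun x => f x + g x) /\ nrm (fun x => f x + g x) <= nrm f + nrm g.
Proof.
move=> fX gX; have [[mrf mif foo] fi] := fX; have [[mrg mig goo] gi] := gX.
apply: Lpi_intro.
- rewrite (_ : (fun x => _) = (fun x => Re (f x) + Re (g x))).
    exact: measurable_funD.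
  by apply/funext => x; case: (f x) (g x) => ? ? [].
- rewrite (_ : (fun x => _) = (fun x => Im (f x) + Im (g x))).
    exact: measurable_funD.
  by apply/funext => x; case: (f x) (g x) => ? ? [].
- by move=> v Lv x; rewrite fi// gi.
- rewrite EFinD -!Lp_normE//; apply: le_trans (minkowski_EFin _ _ _ p1); last 2 first.
  + exact: Lpi_measurable_normc.
  + exact: Lpi_measurable_normc.
  apply: Lnorm_le => //.
  + apply: measurable_normc.
      rewrite (_ : (fun x => _) = (fun x => Re (f x) + Re (g x))).
        exact: measurable_funD.
      by apply/funext => x; case: (f x) (g x) => ? ? [].
    rewrite (_ : (fun x => _) = (fun x => Im (f x) + Im (g x))).
      exact: measurable_funD.
    by apply/funext => x; case: (f x) (g x) => ? ? [].
  + by apply: measurable_funD; exact: Lpi_measurable_normc.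
  + move=> x; rewrite !ger0_norm ?addr_ge0 ?normc_ge0//; exact: le_normcD.
Qed.

Definition cscale (k : R) f x : R[i] := ((k * Re (f x)) +i* (k * Im (f x)))%C.

Lemma normc_cscale k f x : normc (cscale k f x) = `|k| * normc (f x).
Proof. by rewrite /cscale normc_scale; case: (f x). Qed.

Lemma Lpi_cscale k f : Lpi f -> Lpi (cscale k f) /\ nrm (cscale k f) = `|k| * nrm f.
Proof.
move=> fX; have [[mr mi foo] fi] := fX.
have E : Lp_norm mu p (cscale k f) = (`|k| * nrm f)%:E.
  rewrite EFinM -Lp_normE// Lp_norm_EFin -[in RHS](normr_id k) Lp_norm_EFin -Lnorm_scale//.
    by congr (Lnorm _ _ (_ \o _)); apply/funext => x; rewrite normc_cscale.
  exact: Lpi_measurable_normc.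
have [] := @Lpi_intro (cscale k f) (`|k| * nrm f).
- exact: measurable_funM.
- exact: measurable_funM.
- by move=> v Lv x; rewrite /cscale fi.
- by rewrite E.
- by move=> kX _; split => //; rewrite /nrm E.
Qed.

Lemma difference_bound (al : R) : 0 <= al -> exists C : R, 0 <= C /\
  forall h f, Lpi f -> Lpi (difference al h f) /\ nrm (difference al h f) <= C * nrm f.
Proof.
move=> /diff_coef_l1[C aC]; exists C; split.
  by have := aC 0%N; rewrite big_ord0.
by move=> h f fX; have [] := op_bound al h fX aC.
Qed.

(** Upsampling turns the difference with step n h into (1 - z^n)^al evaluated
    at the translation by h, and [dilation_factor] divides this by (1 - z)^al.
    *)
Lemma nrm_difference_dilate (al : R) : 0 <= al -> exists C : R, forall n h f,
  (0 < n)%N -> Lpi f ->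
  nrm (difference al (scale_vector n%:R h) f) <= C * n%:R `^ al * nrm (difference al h f).
Proof.
move=> al0; have [C hC] := dilation_factor al0; exists C => n h f n0 fX.
have [D aD] := diff_coef_l1 al0; have [A AC AE] := hC n n0.
have upl1 : l1_le (upsample n (diff_coef al)) (C * n%:R `^ al * D).
  by rewrite -AE; exact: conv_l1.
have nR : n%:R != 0 :> R by rewrite pnatr_eq0 -lt0n.
have [good upX _] := op_bound (al * n%:R) h fX upl1.
have [_ dX _] := op_bound al (scale_vector n%:R h) fX aD.
rewrite difference_op (nrm_ae dX upX).
  by rewrite -AE; exact: (nrm_op_conv _ _ h fX AC aD).
by apply: filterS good => x /(op_upsample n0) ->; rewrite mulfK.
Qed.

Lemma nrm_difference_mono (al be : R) : 0 <= al <= be -> exists C : R, 0 <= C /\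
  forall h f, Lpi f -> nrm (difference be h f) <= C * nrm (difference al h f).
Proof.
case/andP=> al0 albe; have [A aA] := diff_coef_l1 al0.
have be0 : 0 <= be - al by rewrite subr_ge0.
have [B bB] := diff_coef_l1 be0; exists B; split.
  by have := bB 0%N; rewrite big_ord0.
move=> h f fX; rewrite !difference_op -[in diff_coef be](subrK al be) -diff_coefD.
exact: nrm_op_conv fX bB aA.
Qed.

(** The inequality is [marchaud_factor] evaluated at the translation by h, with
    2^al at most [binomial_sum]. *)
Lemma nrm_difference_marchaud (al be : R) : 0 <= al -> al <= be <= al + 1 ->
  exists C : R, 0 <= C /\ forall h f, Lpi f ->
    2 `^ al * nrm (difference al h f) <=
      nrm (difference al (scale_vector 2 h) f) + C * nrm (difference be h f).
Proof.
move=> al0 albe; have [C [Q QC QE]] := marchaud_factor al0 albe.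
have be0 : 0 <= be by case/andP: albe => /(le_trans al0).
have [A aA] := diff_coef_l1 al0; have [B bB] := diff_coef_l1 be0.
exists C; split; first by have := QC 0%N; rewrite big_ord0.
move=> h f fX.
have [E Al1] : exists E, l1_le (upsample 2 (diff_coef al)) E.
  have [D hD] := dilation_factor al0; have [A' A'l A'E] := hD 2%N isT.
  by exists (D * 2%:R `^ al * A); rewrite -A'E; exact: conv_l1.
have [gA dX _] := op_bound al h fX aA.
have [gU uX _] := op_bound al h fX Al1.
have [gQ qX _] := op_bound al h fX (conv_l1 QC bB).
have [sX sE] := Lpi_cscale (binomial_sum al) dX.
have [uqX uqle] := Lpi_add uX qX.
have E1 : nrm (cscale (binomial_sum al) (op (diff_coef al) al h f)) =
    nrm (fun x => op (upsample 2 (diff_coef al)) al h f x +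
                  op (convol Q (diff_coef be)) al h f x).
  apply: nrm_ae => //; near=> x.
  rewrite -op_add; [|by near: x|by near: x].
  rewrite /cscale -op_scale; last by near: x.
  by congr (op _ _ _ _ _); apply/funext => m; rewrite -QE addrC subrK.
have E2 : nrm (difference al (scale_vector 2 h) f) =
    nrm (op (upsample 2 (diff_coef al)) al h f).
  have [gU' uX' _] := op_bound (al * 2) h fX Al1.
  have [_ dX' _] := op_bound al (scale_vector 2 h) fX aA.
  rewrite -(nrm_op_shift (al * 2) al h fX Al1) difference_op; apply: nrm_ae => //.
  by apply: filterS gU' => x /(op_upsample (n := 2) isT) ->; rewrite mulfK.
rewrite E2 [X in X <= _](_ : _ = 2 `^ al * nrm (op (diff_coef al) al h f))//.
apply: (@le_trans _ _ (`|binomial_sum al| * nrm (op (diff_coef al) al h f))).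
  apply: ler_wpM2r; first exact: nrm_ge0.
  by apply: le_trans (binomial_sum_ge_pow al0) _; exact: ler_norm.
rewrite -sE E1; apply: le_trans uqle _; rewrite lerD2l.
exact: nrm_op_conv fX QC bB.
Unshelve. all: by end_near. Qed.

End setting.

(** * Moduli of smoothness *)

Section modulus_properties.
Context {R : realType} {d : nat}.
Variables (mu : {measure set (space R d) -> \bar R}) (L : set (space R d)) (p : R).
Hypothesis TI : translation_invariant mu L.
Hypothesis p1 : 1 <= p.
Implicit Types (f g : space R d -> R[i]) (h : space R d) (a b t u : R).

Local Notation Lpi := (Lpi mu L p).
Local Notation nrm := (nrm mu p).

Definition rmod a f t : R := fine (modulus mu a f t p).

Let zero_vector : space R d := scale_vector 0 [tuple 0 | i < d].

Let enorm_zero : enorm zero_vector = 0.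
Proof. by rewrite enorm_scale normr0 mul0r. Qed.

Lemma modulusE a f t : 0 <= a -> Lpi f -> 0 <= t ->
  modulus mu a f t p = (rmod a f t)%:E.
Proof.
move=> a0 fX t0; have [C [C0 hC]] := difference_bound TI p1 a0.
rewrite /rmod fineK// ge0_fin_numE.
  apply: (@le_lt_trans _ _ (C * nrm f)%:E); last exact: ltry.
  apply: ge_ereal_sup => _ [h _ <-].
  by have [dX dle] := hC h f fX; rewrite (Lp_normE dX) lee_fin.
apply: le_trans (Lnorm_ge0 mu p%:E (fun x => (normc (difference a zero_vector f x))%:E)) _.
by apply: ereal_sup_ubound; exists zero_vector => //=; rewrite enorm_zero.
Qed.

Lemma rmod_ub a f t h : 0 <= a -> Lpi f -> enorm h <= t ->
  nrm (difference a h f) <= rmod a f t.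
Proof.
move=> a0 fX ht; have [C [C0 hC]] := difference_bound TI p1 a0.
have t0 : 0 <= t by apply: le_trans ht; exact: sqrtr_ge0.
have [dX _] := hC h f fX.
rewrite -lee_fin -(Lp_normE dX) -modulusE//.
by apply: ereal_sup_ubound; exists h.
Qed.

Lemma rmod_le a f t K : 0 <= a -> Lpi f -> 0 <= t ->
  (forall h, enorm h <= t -> nrm (difference a h f) <= K) -> rmod a f t <= K.
Proof.
move=> a0 fX t0 hK; have [C [C0 hC]] := difference_bound TI p1 a0.
rewrite -lee_fin -modulusE//; apply: ge_ereal_sup => _ [h /= ht <-].
by have [dX _] := hC h f fX; rewrite (Lp_normE dX) lee_fin hK.
Qed.

Lemma rmod_ge0 a f t : 0 <= a -> Lpi f -> 0 <= t -> 0 <= rmod a f t.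
Proof.
move=> a0 fX t0; apply: le_trans (nrm_ge0 _ _ (difference a zero_vector f)) _.
by apply: rmod_ub => //; rewrite enorm_zero.
Qed.

Lemma rmod_mono a f s t : 0 <= a -> Lpi f -> 0 <= s -> s <= t ->
  rmod a f s <= rmod a f t.
Proof.
move=> a0 fX s0 st; apply: rmod_le => // h hs.
by apply: rmod_ub => //; exact: le_trans st.
Qed.

Lemma rmod_bound a : 0 <= a -> exists C : R, 0 <= C /\
  forall f t, Lpi f -> 0 <= t -> rmod a f t <= C * nrm f.
Proof.
move=> a0; have [C [C0 hC]] := difference_bound TI p1 a0; exists C; split => //.
move=> f t fX t0; apply: rmod_le => // h _.
by have [_] := hC h f fX.
Qed.

Lemma rmod_dilate a : 0 <= a -> exists C : R, forall f t n,
  Lpi f -> 0 <= t -> (0 < n)%N -> rmod a f (n%:R * t) <= C * n%:R `^ a * rmod a f t.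
Proof.
move=> a0; have [C hC] := nrm_difference_dilate TI p1 a0.
exists `|C| => f t n fX t0 n0; apply: rmod_le => //; first by rewrite mulr_ge0.
move=> h hnt; have nR : 0 < n%:R :> R by rewrite ltr0n.
have -> : h = scale_vector n%:R (scale_vector n%:R^-1 h).
  apply: eq_from_tnth => i; rewrite !tnth_mktuple mulrA divff ?gt_eqF//.
  by rewrite mul1r.
apply: le_trans (hC n _ f n0 fX) _.
apply: (@le_trans _ _ (`|C| * n%:R `^ a * nrm (difference a (scale_vector n%:R^-1 h) f))).
  by rewrite ler_wpM2r ?nrm_ge0// ler_wpM2r ?powR_ge0// ler_norm.
apply: ler_wpM2l; first by rewrite mulr_ge0// powR_ge0.
by apply: rmod_ub => //; rewrite enorm_scale ger0_norm ?invr_ge0// ler_pdivrMl.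
Qed.

(** Dilation by an integer n costs n^a, and monotonicity fills in the ratios
    between two integers. *)
Lemma rmod_almost_decreasing a : 0 <= a -> exists C : R, 0 <= C /\ forall f u t,
  Lpi f -> 0 < u -> u <= t -> rmod a f t <= C * (t / u) `^ a * rmod a f u.
Proof.
move=> a0; have [C hC] := rmod_dilate a0.
exists (`|C| * 2 `^ a); split; first by rewrite mulr_ge0// powR_ge0.
move=> f u t fX u0 ut.
have tu1 : 1 <= t / u by rewrite ler_pdivlMr// mul1r.
have tu0 : 0 <= t / u by apply: le_trans tu1.
have /andP[nle nlt] := Num.Theory.truncn_itv tu0.
set n := Num.truncn (t / u) in nle nlt.
have tn : t <= n.+1%:R * u by rewrite -ler_pdivrMr// ltW.
apply: (le_trans (rmod_mono a0 fX _ tn)); first by rewrite (le_trans (ltW u0)).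
apply: le_trans (hC f u n.+1 fX (ltW u0) isT) _.
apply: ler_wpM2r; first by apply: rmod_ge0 => //; exact: ltW.
rewrite -mulrA -powRM//.
apply: (@le_trans _ _ (`|C| * n.+1%:R `^ a)).
  by rewrite ler_wpM2r ?powR_ge0// ler_norm.
have tu20 : 0 <= 2 * (t / u) by rewrite mulr_ge0.
rewrite ler_wpM2l// ge0_ler_powR// ?nnegrE//.
rewrite -natr1 mulr_natl mulr2n lerD//.
Qed.

Lemma rmod_mono_order a b : 0 <= a <= b -> exists C : R, 0 <= C /\ forall f t,
  Lpi f -> 0 <= t -> rmod b f t <= C * rmod a f t.
Proof.
move=> ab; have [C [C0 hC]] := nrm_difference_mono TI p1 ab; exists C; split => //.
have [a0 ab'] := andP ab.
move=> f t fX t0; apply: rmod_le => //; first exact: le_trans ab'.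
move=> h ht; apply: le_trans (hC h f fX) _; rewrite ler_wpM2l//.
exact: rmod_ub.
Qed.

Lemma rmod_halving a b : 0 <= a -> a <= b <= a + 1 -> exists C : R, 0 <= C /\
  forall f t, Lpi f -> 0 <= t ->
    2 `^ a * rmod a f t <= rmod a f (2 * t) + C * rmod b f t.
Proof.
move=> a0 ab; have [C [C0 hC]] := nrm_difference_marchaud TI p1 a0 ab.
exists C; split => // f t fX t0.
have b0 : 0 <= b by case/andP: ab => /(le_trans a0).
have p20 : 0 < 2 `^ a :> R by rewrite powR_gt0.
rewrite mulrC -ler_pdivlMr//; apply: rmod_le => // h ht.
rewrite ler_pdivlMr// mulrC; apply: le_trans (hC h f fX) _; rewrite lerD//.
  by apply: rmod_ub => //; rewrite enorm_scale ger0_norm// ler_wpM2l.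
by rewrite ler_wpM2l//; exact: rmod_ub.
Qed.

(** Iterating [rmod_halving] doubles t and divides by 2^a, until t is
    comparable to t0. The errors form a geometric series, which is summed in
    closed form: K (C' x^a - D x^e), with x = u / t0, is preserved by the
    recursion. This needs e different from a. *)
Lemma marchaud_step a b e : 0 <= a -> a <= b <= a + 1 -> 0 < e -> e != a ->
  exists C : R, 0 <= C /\ forall f K t0, Lpi f -> 0 < t0 -> nrm f <= K ->
    (forall u, 0 < u <= t0 -> rmod b f u <= K * (u / t0) `^ e) ->
    forall u, 0 < u <= t0 -> rmod a f u <= C * K * (u / t0) `^ (Num.min a e).
Proof.
move=> a0 ab e0 ea; have [C [C0 hC]] := rmod_halving a0 ab.
have [C1 [C10 hC1]] := rmod_bound a0.
have p20 : 0 < 2 `^ a :> R by rewrite powR_gt0.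
have one c : 1 `^ c = 1 :> R by rewrite powR1.
pose q : R := 2 `^ (e - a).
have qE : 2 `^ e = q * 2 `^ a by rewrite /q -powRD ?subrK// pnatr_eq0 implybT.
have q1 : q - 1 != 0.
  rewrite subr_eq0 /q powR_eq1 !negb_or subr_eq0 ea andbT.
  by rewrite ltNge ler0n/= andbT; apply/eqP; lra.
(* - D x^e is a particular solution of the recursion, and multiples of x^a
   solve the homogeneous one *)
pose D := C / (2 `^ a * (q - 1)).
have DE : D * (q - 1) * 2 `^ a = C.
  by rewrite /D; field; rewrite q1 gt_eqF.
pose C' := 2 `^ a * (C1 + `|D|).
have C'0 : 0 <= C' by rewrite /C' mulr_ge0 ?addr_ge0// ltW.
exists (C' + `|D|); split; first by rewrite addr_ge0.
move=> f K t0 fX t00 fK hb.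
have K0 : 0 <= K by apply: le_trans fK; exact: nrm_ge0.
pose B u := C' * (u / t0) `^ a - D * (u / t0) `^ e.
have key N : forall u, 0 < u <= t0 -> t0 < 2 ^+ N.+1 * u -> rmod a f u <= K * B u.
  have base u : 0 < u <= t0 -> t0 < 2 * u -> rmod a f u <= K * B u.
    case/andP=> u0 ut tu; apply: (le_trans (hC1 f u fX (ltW u0))).
    apply: (@le_trans _ _ (C1 * K)); first by rewrite ler_wpM2l.
    rewrite mulrC ler_wpM2l//.
    have x1 : u / t0 <= 1 by rewrite ler_pdivrMr// mul1r.
    have x0 : 0 <= u / t0 by rewrite divr_ge0 ?ltW.
    have xe : (u / t0) `^ e <= 1.
      by rewrite -[leRHS](one e) ge0_ler_powR ?(ltW e0) ?nnegrE.
    have xa : 1 <= 2 `^ a * (u / t0) `^ a.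
      have x20 : 0 <= 2 * (u / t0) by rewrite mulr_ge0.
      rewrite -powRM// -[leLHS](one a) ge0_ler_powR// ?nnegrE//.
      by rewrite mulrA ler_pdivlMr// mul1r ltW.
    apply: (@le_trans _ _ (C1 + `|D| - `|D|)); first by rewrite addrK.
    rewrite /B lerB//.
      by rewrite /C' mulrAC ler_peMl// addr_ge0.
    apply: (@le_trans _ _ (`|D| * (u / t0) `^ e)).
      by rewrite ler_wpM2r ?powR_ge0// ler_norm.
    by rewrite ler_piMr.
  elim: N => [|N IH] u ut; first by rewrite expr1; exact: base.
  move=> tu; have [t2|t2] := ltP t0 (2 * u); first exact: base.
  have [u0 ut0] := andP ut.
  have := IH (2 * u); rewrite mulr_gt0//= t2 mulrA -exprSr => /(_ isT tu) h2.
  rewrite -(ler_pM2l p20); apply: le_trans (hC f u fX (ltW u0)) _.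
  have h3 : C * rmod b f u <= C * (K * (u / t0) `^ e) by rewrite ler_wpM2l// hb.
  apply: (le_trans (lerD h2 h3)).
  have pw c : (2 * u / t0) `^ c = 2 `^ c * (u / t0) `^ c.
    by rewrite -mulrA powRM// divr_ge0 ?ltW.
  rewrite /B !pw.
  move: ((u / t0) `^ a) ((u / t0) `^ e) => x y.
  rewrite qE -DE le_eqVlt; apply/orP; left; apply/eqP; ring.
move=> u ut; have [u0 ut0] := andP ut.
have [N hN] : exists N, t0 < 2 ^+ N.+1 * u.
  exists (Num.truncn (t0 / u)); rewrite -ltr_pdivrMr//.
  have tu0 : 0 <= t0 / u by rewrite divr_ge0 ?ltW.
  have /andP[_ lt1] := Num.Theory.truncn_itv tu0.
  apply: (lt_trans lt1); rewrite -natrX ltr_nat ltn_expl//.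
apply: le_trans (key N u ut hN) _.
rewrite mulrAC mulrC; apply: ler_wpM2r => //.
have x1 : 0 < u / t0 <= 1 by rewrite divr_gt0//= ler_pdivrMr// mul1r.
have hm (c : R) : Num.min a e <= c -> (u / t0) `^ c <= (u / t0) `^ Num.min a e.
  by move=> hc; exact: ger_powR.
rewrite mulrDl /B lerD//.
  by rewrite ler_wpM2l// hm// ge_min lexx.
rewrite -mulNr; apply: (@le_trans _ _ (`|D| * (u / t0) `^ e)).
  by rewrite ler_wpM2r ?powR_ge0// -normrN ler_norm.
by rewrite ler_wpM2l// hm// ge_min lexx orbT.
Qed.

(** A bound of smoothness order beyond a in any higher modulus saturates the
    modulus of order a. The order is lowered from b to a by steps of at most 1;
    the intermediate exponents e stay strictly between a and the current order,
    so that [marchaud_step] applies. *)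
Lemma marchaud a b e : 0 < a -> a < b -> a < e ->
  exists C : R, 0 <= C /\ forall f K t0, Lpi f -> 0 < t0 -> nrm f <= K ->
    (forall u, 0 < u <= t0 -> rmod b f u <= K * (u / t0) `^ e) ->
    forall u, 0 < u <= t0 -> rmod a f u <= C * K * (u / t0) `^ a.
Proof.
move=> a0 ab ae.
have [n bn] : exists n : nat, b <= a + n.+1%:R.
  exists (Num.truncn (b - a)); rewrite -lerBlDl ltW//.
  have ba : 0 <= b - a by rewrite subr_ge0 ltW.
  by have /andP[] := Num.Theory.truncn_itv ba.
elim: n b ab bn e ae => [|n IH] b ab bn e ae.
  have [||||C [C0 hC]] := @marchaud_step a b e; [exact: ltW| |exact: lt_trans ae| |].
  - by rewrite ltW.
  - by rewrite gt_eqF.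
  by exists C; split => // f K t0 fX t00 fK hb u ut; have := hC f K t0 fX t00 fK hb u ut;
    rewrite min_l// ltW.
have [ba1|ba1] := leP b (a + 1).
  have [||||C [C0 hC]] := @marchaud_step a b e; [exact: ltW| |exact: lt_trans ae| |].
  - by rewrite ltW.
  - by rewrite gt_eqF.
  by exists C; split => // f K t0 fX t00 fK hb u ut; have := hC f K t0 fX t00 fK hb u ut;
    rewrite min_l// ltW.
pose b' := b - 1; have ab' : a < b' by rewrite /b'; lra.
pose e' := (a + Num.min e b') / 2.
have [m1 m2] : a < Num.min e b' /\ Num.min e b' <= b'.
  by rewrite lt_min ae ab' ge_min lexx orbT.
have m3 : Num.min e b' <= e by rewrite ge_min lexx.
have ae' : a < e' by rewrite /e'; lra.
have e'b : e' < b' by rewrite /e'; lra.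
have e'e : e' <= e by rewrite /e'; lra.
have bn' : b' <= a + n.+1%:R by move: bn; rewrite /b' -natr1; lra.
have [C [C0 hC]] := IH b' ab' bn' e' ae'.
have [||||C1 [C10 hC1]] := @marchaud_step b' b e'.
- lra.
- by apply/andP; rewrite /b'; split; lra.
- lra.
- by rewrite lt_eqF.
exists (C * (C1 + 1)); split; first by rewrite mulr_ge0// addr_ge0.
move=> f K t0 fX t00 fK hb u ut.
have K0 : 0 <= K by apply: le_trans fK; exact: nrm_ge0.
rewrite -(mulrA C).
apply: hC => //.
  by rewrite mulrDl mul1r ler_wpDl// mulr_ge0.
move=> v vt; have [v0 vt0] := andP vt.
have x1 : 0 < v / t0 <= 1 by rewrite divr_gt0//= ler_pdivrMr// mul1r.
apply: le_trans (hC1 f K t0 fX t00 fK _ v vt) _.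
  move=> w wt; apply: le_trans (hb w wt) _; rewrite ler_wpM2l//.
  have [w0 wt0] := andP wt.
  by apply: ger_powR => //; rewrite divr_gt0//= ler_pdivrMr// mul1r.
by rewrite (min_r (ltW e'b)) ler_wpM2r ?powR_ge0// ler_wpM2r// lerDl.
Qed.

End modulus_properties.

(** * Powers of the logarithm against dt/t *)

Section logarithmic_integrals.
Context {R : realType}.
Implicit Types (x y t s : R).

Local Notation leb1 := (@lebesgue_measure R).

(** The substitution s = 1 - log t. *)
Lemma log_integral (G g : R -> R) x y : 0 < x -> x < y -> y < 1 ->
  (forall s, 0 < s -> is_derive s 1 G (g s)) ->
  (forall s, 0 < s -> {for s, continuous g}) ->
  (\int[leb1]_(t in `[x, y]) (g (1 - ln t) * t^-1)%:E =
   (G (1 - ln x) - G (1 - ln y))%:E)%E.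
Proof.
move=> x0 xy y1 dG cg.
pose F t := - G (1 - ln t).
have s0 t : t <= y -> 0 < 1 - ln t.
  by move=> ty; rewrite subr_gt0 (le_lt_trans (ln_le0 _))// ltW// (le_lt_trans ty).
have dF t : 0 < t -> t <= y -> is_derive t 1 F (g (1 - ln t) * t^-1).
  move=> t0 ty; have dl := is_derive1_ln t0.
  have d1 : is_derive t 1 (fun u => 1 - ln u) (0 - t^-1) by apply: is_deriveB.
  have d2 : is_derive (1 - ln t) 1 G (g (1 - ln t)) := dG _ (s0 _ ty).
  have d3 := @is_derive1_comp _ G (fun u : R => 1 - ln u) t _ _ d2 d1.
  have d4 := is_deriveN d3.
  by apply: (is_derive_eq d4); rewrite sub0r; lra.
have cF t : 0 < t -> t <= y -> {for t, continuous F}.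
  move=> t0 ty; apply: differentiable_continuous.
  by apply/derivable1_diffP; apply: ex_derive; exact: dF.
rewrite (@continuous_FTC2 _ _ F)//.
- by rewrite -EFinD /F opprK addrC.
- apply: continuous_in_subspaceT => t; rewrite inE/= in_itv/= => /andP[xt ty].
  have t0 : 0 < t by apply: lt_le_trans xt.
  apply: cvgM; last by apply: cvgV => //; rewrite gt_eqF.
  apply: (@cvg_comp _ _ _ (fun t => 1 - ln t) g); last exact: cg (s0 _ ty).
  by apply: cvgB; [exact: cvg_cst|exact: continuous_ln].
- split => [t|/=|/=].
  + rewrite in_itv/= => /andP[xt ty]; apply: ex_derive; apply: dF; last exact: ltW.
    exact: lt_trans xt.
  + by apply: cvg_at_right_filter; apply: cF => //; exact: ltW.
  + by apply: cvg_at_left_filter; apply: cF => //; exact: lt_trans xy.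
- move=> t; rewrite in_itv/= => /andP[xt ty].
  rewrite derive1E; apply: derive_val; apply: dF; last exact: ltW.
  exact: lt_trans xt.
Qed.

Lemma log_integral_pow (c : R) x y : 0 < x -> x < y -> y < 1 -> c != 1 ->
  (\int[leb1]_(t in `[x, y]) ((1 - ln t) `^ (- c) * t^-1)%:E =
   ((((1 - ln y) `^ (1 - c)) - ((1 - ln x) `^ (1 - c))) / (c - 1))%:E)%E.
Proof.
move=> x0 xy y1 c1; have c10 : 1 - c != 0 by rewrite subr_eq0 eq_sym.
have dG s : 0 < s -> is_derive s 1 (fun s => s `^ (1 - c) * (1 - c)^-1) (s `^ (- c)).
  move=> s0; have dp := is_derive1_powR (1 - c) s0.
  have h := @is_deriveM _ _ (fun s => s `^ (1 - c)) (fun=> (1 - c)^-1) s 1 _ _ dp (is_derive_cst _ _ _).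
  apply: (is_derive_eq h).
  by rewrite scaler0 add0r /GRing.scale/= addrAC subrr add0r; field; exact: c10.
have cg s : 0 < s -> {for s, continuous (fun s => s `^ (- c))}.
  move=> s0; apply: differentiable_continuous; apply/derivable1_diffP.
  by apply: ex_derive; exact: is_derive1_powR.
rewrite (log_integral x0 xy y1 dG cg).
by congr EFin; field; rewrite c10 -opprB oppr_eq0 c10.
Qed.

Lemma log_integral_inv x y : 0 < x -> x < y -> y < 1 ->
  (\int[leb1]_(t in `[x, y]) ((1 - ln t)^-1 * t^-1)%:E =
   (ln (1 - ln x) - ln (1 - ln y))%:E)%E.
Proof.
move=> x0 xy y1; have cg s : 0 < s -> {for s, continuous (fun s : R => s^-1)}.
  by move=> s0; apply: cvgV => //; rewrite gt_eqF.
by rewrite (log_integral x0 xy y1 (@is_derive1_ln R) cg).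
Qed.

Lemma measurable_log_weight (b : R) (D : set R) : measurable D ->
  measurable_fun D (fun t => (1 - ln t) `^ b).
Proof.
move=> mD; apply: measurable_funS (measurableT) (@subsetT _ _) _.
apply: (measurableT_comp (measurable_powR b)).
by apply: measurable_funB => //; exact: measurable_ln.
Qed.

Lemma measurable_inv_pos : measurable_fun (`]0%R, 1%R[%classic : set R) (fun t : R => t^-1).
Proof.
apply: (@eq_measurable_fun _ _ _ _ _ (fun t => t `^ (-1))).
  by move=> t; rewrite inE/= in_itv/= => /andP[t0 _]; rewrite powR_inv1// ltW.
apply: measurable_funS (measurableT) (@subsetT _ _) _.
exact: measurable_powR.
Qed.

(** The critical integrals, with a bound that is uniform in the distance e to
    the divergent exponent: this is what gives the iterated logarithm in
    [wsemi_upper_cutoff]. *)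
Lemma log_integral_bound (e : R) : 0 < e ->
  (\int[leb1]_(t in `]0%R, 1%R[) ((1 - ln t) `^ (- (1 + e)) * t^-1)%:E <= (e^-1)%:E)%E.
Proof.
move=> e0.
pose I (n : nat) : set R := `[n.+3%:R^-1, 1 - n.+3%:R^-1]%classic.
have n3 (n : nat) : 0 < (n.+3%:R^-1 : R) < 1 - n.+3%:R^-1.
  rewrite invr_gt0 ltr0n/= ltrBrDr.
  have -> : n.+3%:R^-1 + n.+3%:R^-1 = 2 / n.+3%:R :> R by rewrite mulrDl mul1r.
  by rewrite ltr_pdivrMr ?ltr0n// mul1r ltr_nat.
have IE : \bigcup_n I n = `]0%R, 1%R[%classic.
  apply/seteqP; split => t.
    move=> [n _]; rewrite /I/= !in_itv/= => /andP[h1 h2].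
    have /andP[n30 _] := n3 n.
    rewrite (lt_le_trans n30 h1)/= (le_lt_trans h2)// ltrBlDr ltrDl//.
  rewrite /= in_itv/= => /andP[t0 t1].
  have m0 : 0 < Num.min t (1 - t) by rewrite lt_min t0 subr_gt0.
  have [n nlt] := ltr_add_invr m0; rewrite add0r in nlt.
  exists n => //; rewrite /I/= in_itv/=.
  have le3 : n.+3%:R^-1 <= n.+1%:R^-1 :> R by rewrite lef_pV2 ?posrE ?ltr0n// ler_nat; lia.
  move: nlt; rewrite lt_min => /andP[h1 h2].
  move: (n.+3%:R^-1 : R) (n.+1%:R^-1 : R) le3 h1 h2 => u v le3 h1 h2.
  by apply/andP; split; lra.
have mf : measurable_fun (`]0%R, 1%R[%classic : set R) (fun t => ((1 - ln t) `^ (- (1 + e)) * t^-1)%:E).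
  apply/measurable_EFinP; apply: measurable_funM; last exact: measurable_inv_pos.
  exact: measurable_log_weight.
have sub n : I n `<=` `]0%R, 1%R[%classic by rewrite -IE; exact: bigcup_sup.
have f0 t : `]0%R, 1%R[%classic t -> (0 <= ((1 - ln t) `^ (- (1 + e)) * t^-1)%:E)%E.
  by rewrite /= in_itv/= => /andP[t0 _]; rewrite lee_fin mulr_ge0 ?powR_ge0// invr_ge0 ltW.
pose F t := ((1 - ln t) `^ (- (1 + e)) * t^-1)%:E.
have cv : (\int[leb1]_(t in I n) F t)%E @[n --> \oo] -->
    (\int[leb1]_(t in \bigcup_n I n) F t)%E.
  apply: ge0_nondecreasing_set_cvg_integral.
  - move=> m n mn; apply/subsetPset => t; rewrite /I/= !in_itv/= => /andP[h1 h2].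
    have le3 : n.+3%:R^-1 <= m.+3%:R^-1 :> R by rewrite lef_pV2 ?posrE ?ltr0n// ler_nat !ltnS.
    move: (n.+3%:R^-1 : R) (m.+3%:R^-1 : R) le3 h1 h2 => u v le3 h1 h2.
    by apply/andP; split; lra.
  - by move=> n; exact: measurable_itv.
  - by move=> n; apply: measurable_funS (sub n) mf; exact: measurable_itv.
  - by move=> n t It; apply: f0; exact: sub It.
rewrite -IE -(cvg_lim _ cv)//; apply: lime_le.
  by apply/cvg_ex; eexists; exact: cv.
apply: nearW => n; have /andP[n30 n31] := n3 n.
have y1 : 1 - n.+3%:R^-1 < 1 :> R by rewrite ltrBlDr ltrDl.
have c1 : 1 + e != 1 by rewrite -subr_eq0 addrC addKr gt_eqF.
rewrite /I /F (log_integral_pow n30 n31 y1 c1).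
rewrite lee_fin (_ : 1 + e - 1 = e); last by rewrite addrC addKr.
rewrite ler_piMl ?invr_ge0 ?(ltW e0)//.
set y := 1 - n.+3%:R^-1.
have ly : 1 <= 1 - ln y.
  by rewrite lerBrDl gerDr; apply: ln_le0; rewrite /y gerBl invr_ge0.
apply: (@le_trans _ _ ((1 - ln y) `^ (1 - (1 + e)))).
  by rewrite gerBl powR_ge0.
rewrite -[leRHS](powRr0 (1 - ln y)) ler_powR//; lra.
Qed.

End logarithmic_integrals.

(** * Logarithmically weighted seminorms *)

Section weighted_seminorms.
Context {R : realType}.
Implicit Types (a b t u x y K : R) (q : \bar R) (w : R -> R).

Local Notation leb1 := (@lebesgue_measure R).

Definition wfun a b w t : R := t `^ (- a) * (1 - ln t) `^ (- b) * w t.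

Definition wsemi a b q w : \bar R :=
  (if q is r%:E then
    (\int[leb1]_(t in `]0%R, 1%R[) ((wfun a b w t `^ r * t^-1)%:E)) `^ r^-1
  else ereal_sup [set (wfun a b w t)%:E | t in `]0%R, 1%R[])%E.

Lemma one_sub_ln_ge1 t : t <= 1 -> 1 <= 1 - ln t.
Proof. by move=> t1; rewrite lerBrDl gerDr ln_le0. Qed.

Section fixed_function.
Variables (a : R) (w : R -> R).
Hypothesis w0 : forall t, 0 <= w t.
Hypothesis w_nd : nondecreasing_fun w.

Let I01 : set R := `]0%R, 1%R[%classic.

Lemma wfun_ge0 b t : 0 <= wfun a b w t.
Proof. by rewrite /wfun !mulr_ge0 ?powR_ge0. Qed.

Lemma measurable_wfun b : measurable_fun I01 (wfun a b w).
Proof.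
apply: measurable_funM; first apply: measurable_funM.
- exact: measurable_funS (measurableT) (@subsetT _ _) (measurable_powR _).
- by apply: measurable_log_weight; exact: measurable_itv.
- by apply: nondecreasing_measurable => //; exact: measurable_itv.
Qed.

Lemma measurable_integrand b (r : R) :
  measurable_fun I01 (fun t => (wfun a b w t `^ r * t^-1)%:E).
Proof.
apply/measurable_EFinP; apply: measurable_funM; last exact: measurable_inv_pos.
exact: (measurableT_comp (measurable_powR r) (measurable_wfun b)).
Qed.

Lemma integrand_ge0 b (r : R) t : I01 t -> (0 <= (wfun a b w t `^ r * t^-1)%:E)%E.
Proof.
by rewrite /I01/= in_itv/= => /andP[t0 _]; rewrite lee_fin mulr_ge0 ?powR_ge0// invr_ge0 ltW.
Qed.

Lemma wsemi_leP b (r : R) K : 0 < r -> 0 <= K ->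
  (wsemi a b r%:E w <= K%:E)%E <->
  (\int[leb1]_(t in `]0%R, 1%R[) ((wfun a b w t `^ r * t^-1)%:E) <= (K `^ r)%:E)%E.
Proof.
move=> r0 K0; rewrite /wsemi; set J := (\int[_]_(_ in _) _)%E.
have J0 : (0 <= J)%E by apply: integral_ge0 => t; exact: integrand_ge0.
have mono (s : R) (x y : \bar R) : 0 <= s -> (0 <= x -> x <= y -> x `^ s <= y `^ s)%E.
  move=> s0 x0 xy; rewrite gt0_ler_poweR// in_itv/= leey andbT//.
  exact: le_trans xy.
have rn0 : r != 0 by rewrite gt_eqF.
rewrite -poweR_EFin; split => h.
  rewrite -[leLHS](poweRe1) // -(mulVf rn0) poweRrM mono ?poweR_ge0// ltW//.
rewrite -[leRHS](@poweRe1 _ K%:E) ?lee_fin// -(mulfV rn0) poweRrM.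
by rewrite mono// invr_ge0 ltW.
Qed.

Let sub_interval x y : 0 < x -> y < 1 -> (`[x, y]%classic : set R) `<=` I01.
Proof.
move=> x0 y1 t; rewrite /I01/= !in_itv/= => /andP[xt ty].
by rewrite (lt_le_trans x0 xt) (le_lt_trans ty y1).
Qed.

(** Every lower bound on a seminorm comes from this restriction of the integral
    to a subinterval. *)
Lemma wsemi_lower b (r : R) K x y (g : R -> R) (k : R) :
  0 < r -> 0 <= K -> 0 < x -> y < 1 -> 0 <= k ->
  (wsemi a b r%:E w <= K%:E)%E ->
  measurable_fun I01 g -> (forall t, x <= t <= y -> 0 <= g t) ->
  (forall t, x <= t <= y -> k * g t <= wfun a b w t `^ r) ->
  (k%:E * \int[leb1]_(t in `[x, y]) (g t * t^-1)%:E <= (K `^ r)%:E)%E.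
Proof.
move=> r0 K0 x0 y1 k0 /wsemi_leP - /(_ r0 K0) hK mg g0 gw.
apply: le_trans hK.
have xyI := sub_interval x0 y1.
have mgt : measurable_fun (`[x, y]%classic : set R) (fun t => (g t * t^-1)%:E).
  apply: measurable_funS xyI _; first exact: measurable_itv.
  by apply/measurable_EFinP/measurable_funM => //; exact: measurable_inv_pos.
have tpos t : x <= t <= y -> 0 <= t^-1.
  by case/andP => xt _; rewrite invr_ge0 (le_trans (ltW x0)).
rewrite -ge0_integralZl_EFin//.
- apply: (@le_trans _ _ (\int[leb1]_(t in `[x, y]) ((wfun a b w t `^ r * t^-1)%:E))%E).
    apply: ge0_le_integral => //.
    + move=> t; rewrite /= in_itv/= => xty.
      by rewrite -EFinM lee_fin !mulr_ge0 ?g0 ?tpos.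
    + exact: measurable_funeM.
    + apply: measurable_funS xyI (measurable_integrand b r); exact: measurable_itv.
    + move=> t; rewrite /= in_itv/= => xty.
      by rewrite -EFinM lee_fin mulrA ler_wpM2r ?tpos// gw.
  apply: ge0_subset_integral => //.
  + exact: measurable_integrand.
  + exact: integrand_ge0.
- by move=> t; rewrite /= in_itv/= => xty; rewrite lee_fin mulr_ge0 ?g0 ?tpos.
Qed.

End fixed_function.

(** As t^-a w is almost decreasing, the part of the integral over the t' with 1
    - log t < 1 - log t' < M (1 - log t) already controls the value at t. The
    factor M is taken such that this part has half of the mass of the integral
    up to infinity. *)
Lemma wsemi_pointwise a b q (A : R) : 0 <= a -> 0 < A -> (0 < q)%E ->
  inv_exponent q < b ->
  exists C : R, 0 <= C /\ forall w K, (forall t, 0 <= w t) -> nondecreasing_fun w ->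
    (forall u t, 0 < u -> u <= t -> w t <= A * (t / u) `^ a * w u) ->
    0 <= K -> (wsemi a b q w <= K%:E)%E ->
  forall t, 0 < t < 1 -> wfun a (b - inv_exponent q) w t <= C * K.
Proof.
move=> a0 A0; case: q => [r|_|//]; last first.
  rewrite /inv_exponent invey/= => b0.
  exists 1; split => // w K w0 wnd ad K0 hK t t01; rewrite mul1r subr0 -lee_fin.
  by apply: le_trans hK; apply: ereal_sup_ubound; exists t => //=; rewrite in_itv.
rewrite lte_fin => r0.
have -> : inv_exponent r%:E = r^-1 by rewrite /inv_exponent fine_invr.
move=> rb.
have br1 : 1 < b * r by rewrite -ltr_pdivrMr// mul1r.
set c := b * r in br1.
have c1 : 0 < c - 1 by rewrite subr_gt0.
(* half of the integral of u^(- c) over u > s lies below M s *)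
pose M : R := 2 `^ (c - 1)^-1.
have M1 : 1 < M.
  by rewrite -[ltLHS](powRr0 2) /M /powR pnatr_eq0/= ltr_expR ltr_pM2r ?invr_gt0// ln_gt0// ltr1n.
have M0 : 0 < M by apply: lt_trans M1.
have Mc : M `^ (1 - c) = 2^-1.
  rewrite /M -powRrM -[1 - c]opprB mulrN mulVf ?gt_eqF//.
  by rewrite powRN powRr1.
exists (A * (2 * (c - 1)) `^ r^-1); split; first by rewrite mulr_ge0 ?powR_ge0// ltW.
move=> w K w0 wnd ad K0 hK t /andP[t0 t1].
pose s := 1 - ln t.
have s1 : 1 <= s by apply: one_sub_ln_ge1; exact: ltW.
have s0 : 0 < s by apply: lt_le_trans s1.
(* x is the point at which 1 - ln x is M times 1 - ln t *)
pose x := expR (1 - M * s).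
have x0 : 0 < x by exact: expR_gt0.
have lx : 1 - ln x = M * s by rewrite /x expRK opprB addrC subrK.
have xt : x < t.
  rewrite -(ltr_ln (x := x)) ?posrE// -ltrN2 -(ltrD2l 1) lx -/s.
  by rewrite -[ltLHS]mul1r ltr_pM2r.
pose P := t `^ (- a) * w t.
have P0 : 0 <= P by rewrite /P mulr_ge0 ?powR_ge0.
have := @wsemi_lower a w wnd b r K x t (fun u => (1 - ln u) `^ (- c)) ((P / A) `^ r)
  r0 K0 x0 t1 (powR_ge0 _ _) hK (measurable_log_weight _ _).
move=> /(_ (measurable_itv _) (fun _ _ => powR_ge0 _ _)) h.
have {}h : (((P / A) `^ r)%:E * (\int[leb1]_(u in `[x, t]) ((1 - ln u) `^ (- c) * u^-1)%:E)
    <= (K `^ r)%:E)%E.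
  apply: h => u /andP[xu ut].
  have u0 : 0 < u by apply: lt_le_trans xu.
  have lu1 : 0 <= 1 - ln u.
    by apply: le_trans ler01 _; apply: one_sub_ln_ge1; rewrite (le_trans ut) ?ltW.
  have PA0 : 0 <= P / A by rewrite divr_ge0// ltW.
  have hw : P / A * (1 - ln u) `^ (- b) <= wfun a b w u.
    rewrite /wfun [leRHS]mulrAC; apply: ler_wpM2r; first exact: powR_ge0.
    rewrite ler_pdivrMr// /P mulrAC.
    have tE : t `^ (- a) = (t / u) `^ (- a) * u `^ (- a).
      by rewrite -powRM ?divr_ge0 ?ltW// divfK// gt_eqF.
    rewrite tE mulrAC -(mulrA (u `^ (- a))) [leRHS]mulrC mulrAC.
    rewrite [leLHS]mulrC [leRHS]mulrC ler_wpM2l ?powR_ge0//.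
    rewrite powRN ler_pdivrMl; last by rewrite powR_gt0// divr_gt0.
    by apply: le_trans (ad u t u0 ut) _; rewrite le_eqVlt; apply/orP; left; apply/eqP; ring.
  have -> : - c = - b * r by rewrite mulNr.
  rewrite powRrM -powRM ?powR_ge0// ge0_ler_powR ?(ltW r0) ?nnegrE ?wfun_ge0//.
  by rewrite mulr_ge0 ?powR_ge0.
rewrite log_integral_pow// in h; last by rewrite gt_eqF// -subr_gt0.
have Ms : (M * s) `^ (1 - c) = 2^-1 * s `^ (1 - c).
  by rewrite powRM ?Mc ?(ltW M0) ?(ltW s0).
rewrite lx -/s Ms -EFinM lee_fin in h.
have sc : s `^ (1 - c) = (s `^ (r^-1 - b)) `^ r.
  by rewrite -powRrM mulrBl mulVf ?gt_eqF.
have {}h : (P / A * s `^ (r^-1 - b)) `^ r <= 2 * (c - 1) * K `^ r.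
  rewrite powRM ?powR_ge0 ?divr_ge0 ?(ltW A0)// -sc.
  rewrite -ler_pdivrMl; last by rewrite mulr_gt0.
  apply: le_trans h; rewrite le_eqVlt; apply/orP; left; apply/eqP.
  by field; rewrite gt_eqF.
have {}h : P / A * s `^ (r^-1 - b) <= (2 * (c - 1)) `^ r^-1 * K.
  have rn0 : r != 0 by rewrite gt_eqF.
  have inv z : 0 <= z -> z = (z `^ r) `^ r^-1.
    by move=> z0; rewrite -powRrM mulfV// powRr1.
  rewrite (inv (P / A * _)); last by rewrite mulr_ge0 ?powR_ge0 ?divr_ge0 ?(ltW A0).
  rewrite [in leRHS](inv K)// -powRM ?powR_ge0//; last by rewrite mulr_ge0 ?ltW.
  rewrite ge0_ler_powR ?invr_ge0 ?(ltW r0) ?nnegrE ?powR_ge0//.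
  by rewrite !mulr_ge0 ?powR_ge0 ?(ltW c1).
have -> : wfun a (b - r^-1) w t = A * (P / A * s `^ (r^-1 - b)).
  rewrite /wfun /P /s opprB; field; rewrite gt_eqF//.
by rewrite -[leRHS]mulrA ler_wpM2l ?(ltW A0).
Qed.

Lemma wsemi_upper a b q (c : R) : (0 < q)%E -> c < b - inv_exponent q ->
  exists C : R, 0 <= C /\ forall w K, (forall t, 0 <= w t) -> nondecreasing_fun w ->
    0 <= K -> (forall t, 0 < t < 1 -> t `^ (- a) * w t <= K * (1 - ln t) `^ c) ->
    (wsemi a b q w <= (C * K)%:E)%E.
Proof.
have wle w K t : 0 < t < 1 -> t `^ (- a) * w t <= K * (1 - ln t) `^ c ->
    wfun a b w t <= K * (1 - ln t) `^ (c - b).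
  move=> /andP[t0 t1] h; have s1 := one_sub_ln_ge1 (ltW t1).
  have s0 : 1 - ln t != 0 by rewrite gt_eqF// (lt_le_trans ltr01 s1).
  rewrite /wfun mulrAC powRD ?s0 ?implybT// mulrA ler_wpM2r ?powR_ge0//.
case: q => [r|_|//]; last first.
  rewrite /inv_exponent invey/= subr0 => cb.
  exists 1; split => // w K w0 wnd K0 h; rewrite mul1r.
  apply: ge_ereal_sup => _ [t /= t01 <-]; rewrite in_itv/= in t01.
  rewrite lee_fin; apply: le_trans (wle w K t t01 (h t t01)) _.
  have s1 : 1 <= 1 - ln t by case/andP: t01 => _ /ltW /one_sub_ln_ge1.
  rewrite ler_piMr// -[leRHS](powRr0 (1 - ln t)) ler_powR// subr_le0 ltW//.
rewrite lte_fin => r0; rewrite /inv_exponent fine_invr => cb.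
pose e := (b - c) * r - 1.
have e0 : 0 < e by rewrite /e subr_gt0 -ltr_pdivrMr// mul1r; lra.
exists (e^-1 `^ r^-1); split; first exact: powR_ge0.
move=> w K w0 wnd K0 h; apply/wsemi_leP => //; first by rewrite mulr_ge0 ?powR_ge0.
rewrite powRM ?powR_ge0// -powRrM mulVf ?gt_eqF// powRr1 ?invr_ge0 ?(ltW e0)//.
rewrite mulrC EFinM; apply: le_trans (lee_wpmul2l _ (log_integral_bound e0)); last first.
  by rewrite lee_fin powR_ge0.
rewrite -ge0_integralZl_EFin//; last 3 first.
- move=> t; rewrite /= in_itv/= => /andP[t0 _].
  by rewrite lee_fin mulr_ge0 ?powR_ge0// invr_ge0 ltW.
- apply/measurable_EFinP; apply: measurable_funM; last exact: measurable_inv_pos.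
  exact: measurable_log_weight.
- exact: powR_ge0.
apply: ge0_le_integral => //.
- exact: integrand_ge0.
- exact: measurable_integrand.
- apply: measurable_funeM; apply/measurable_EFinP; apply: measurable_funM.
    exact: measurable_log_weight.
  exact: measurable_inv_pos.
- move=> t; rewrite /= in_itv/= => /[dup] t01 /andP[t0 t1].
  rewrite -EFinM lee_fin mulrA ler_wpM2r ?invr_ge0 ?(ltW t0)//.
  have -> : - (1 + e) = (c - b) * r by rewrite /e; ring.
  rewrite powRrM -powRM ?powR_ge0// ge0_ler_powR ?(ltW r0) ?nnegrE ?wfun_ge0//.
    by rewrite mulr_ge0 ?powR_ge0.
  exact: wle (h t t01).
Qed.

(** The power of the logarithm is critical, and its cut-off at S is compared
    with the convergent integral of exponent 1 + e. For e of size 1 / (1 + log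
    S), this loses only the factor S^e, which stays bounded, while the integral
    is 1 / e. *)
Lemma wsemi_upper_cutoff a b q : (0 < q)%E -> inv_exponent q < b ->
  exists C : R, 0 <= C /\ forall w K S, (forall t, 0 <= w t) -> nondecreasing_fun w ->
    0 <= K -> 1 <= S ->
    (forall t, 0 < t < 1 -> t `^ (- a) * w t <=
       K * (Num.min (1 - ln t) S) `^ (b - inv_exponent q)) ->
    (wsemi a b q w <= (C * K * (1 + ln S) `^ inv_exponent q)%:E)%E.
Proof.
case: q => [r|_|//]; last first.
  rewrite /inv_exponent invey/= subr0 => b0.
  exists 1; split => // w K S w0 wnd K0 S1 h; rewrite mul1r powRr0 mulr1.
  apply: ge_ereal_sup => _ [t /= t01 <-]; rewrite in_itv/= in t01.
  have [t0 t1] := andP t01; have s1 := one_sub_ln_ge1 (ltW t1).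
  have s0 : 0 < 1 - ln t by apply: lt_le_trans s1.
  rewrite lee_fin /wfun mulrAC (powRN (1 - ln t)) ler_pdivrMr ?powR_gt0//.
  apply: le_trans (h t t01) _; rewrite ler_wpM2l// ge0_ler_powR ?(ltW b0) ?nnegrE ?(ltW s0)//.
    by rewrite le_min (ltW s0) (le_trans ler01 S1).
  by rewrite ge_min lexx.
rewrite lte_fin => r0; rewrite /inv_exponent fine_invr => rb.
have br1 : 0 < b * r - 1 by rewrite subr_gt0 -ltr_pdivrMr// mul1r.
have [C2 C2E] : exists C2, C2 = expR (b * r - 1) / (b * r - 1) by eexists.
have C20 : 0 <= C2 by rewrite C2E divr_ge0 ?expR_ge0 ?(ltW br1).
exists (C2 `^ r^-1); split; first exact: powR_ge0.
move=> w K S w0 wnd K0 S1 h.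
have S0 : 0 < S by apply: lt_le_trans S1.
have lS : 0 <= ln S by exact: ln_ge0.
pose e := (b * r - 1) / (1 + ln S).
have e0 : 0 < e by rewrite divr_gt0// ltr_wpDr.
have ebr : e <= b * r - 1.
  by rewrite /e ler_pdivrMr ?ler_peMr ?(ltW br1)// ?lerDl// ltr_wpDr.
have Se : S `^ e <= expR (b * r - 1).
  rewrite /powR gt_eqF// ler_expR /e mulrAC ler_pdivrMr ?ltr_wpDr//.
  by rewrite ler_wpM2l ?(ltW br1)// lerDr.
apply/wsemi_leP => //; first by rewrite !mulr_ge0 ?powR_ge0.
have rn0 : r != 0 by rewrite gt_eqF.
have -> : (C2 `^ r^-1 * K * (1 + ln S) `^ r^-1) `^ r = K `^ r * (C2 * (1 + ln S)).
  rewrite powRM ?mulr_ge0 ?powR_ge0// powRM ?powR_ge0// -!powRrM mulVf//.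
  by rewrite !powRr1 ?addr_ge0//; ring.
apply: (@le_trans _ _ ((K `^ r * S `^ e)%:E * (e^-1)%:E)%E); last first.
  rewrite -EFinM lee_fin -mulrA ler_wpM2l ?powR_ge0// C2E /e invf_div.
  rewrite mulrA [leRHS]mulrAC ler_wpM2r ?invr_ge0 ?(ltW br1)//.
  by rewrite ler_wpM2r ?addr_ge0.
apply: le_trans (lee_wpmul2l _ (log_integral_bound e0)); last first.
  by rewrite lee_fin mulr_ge0 ?powR_ge0.
rewrite -ge0_integralZl_EFin//; last 3 first.
- move=> t; rewrite /= in_itv/= => /andP[t0 _].
  by rewrite lee_fin mulr_ge0 ?powR_ge0// invr_ge0 ltW.
- apply/measurable_EFinP; apply: measurable_funM; last exact: measurable_inv_pos.
  exact: measurable_log_weight.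
- by rewrite mulr_ge0 ?powR_ge0.
apply: ge0_le_integral => //.
- exact: integrand_ge0.
- exact: measurable_integrand.
- apply: measurable_funeM; apply/measurable_EFinP; apply: measurable_funM.
    exact: measurable_log_weight.
  exact: measurable_inv_pos.
- move=> t; rewrite /= in_itv/= => /[dup] t01 /andP[t0 t1].
  rewrite -EFinM lee_fin mulrA ler_wpM2r ?invr_ge0 ?(ltW t0)//.
  have s1 := one_sub_ln_ge1 (ltW t1).
  have := h t t01; set s := 1 - ln t in s1 *; move=> hs.
  have s0 : 0 < s by apply: lt_le_trans s1.
  set m := Num.min s S in hs.
  have m0 : 0 < m by rewrite lt_min s0.
  apply: (@le_trans _ _ ((K * m `^ (b - r^-1) * s `^ (- b)) `^ r)).
    rewrite ge0_ler_powR ?(ltW r0) ?nnegrE ?wfun_ge0 ?mulr_ge0 ?powR_ge0//.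
    by rewrite /wfun mulrAC ler_wpM2r ?powR_ge0.
  rewrite powRM ?mulr_ge0 ?powR_ge0// powRM ?powR_ge0// -mulrA -[leRHS]mulrA.
  rewrite ler_wpM2l ?powR_ge0// -!powRrM mulrBl mulVf//.
  have -> : m `^ (b * r - 1) = m `^ e * m `^ (b * r - 1 - e).
    by rewrite -powRD ?(gt_eqF m0) ?implybT//; congr (_ `^ _); ring.
  have -> : s `^ (- (1 + e)) = s `^ (b * r - 1 - e) * s `^ (- b * r).
    by rewrite -powRD ?(gt_eqF s0) ?implybT//; congr (_ `^ _); ring.
  rewrite mulrA ler_wpM2r ?powR_ge0// ler_pM ?powR_ge0//.
    by rewrite ge0_ler_powR ?(ltW e0) ?nnegrE ?(ltW m0) ?(ltW S0)// ge_min lexx orbT.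
  by rewrite ge0_ler_powR ?subr_ge0 ?nnegrE ?(ltW m0) ?(ltW s0)// ge_min lexx.
Qed.

(** The power q1 of the weighted function is its power q0 times its power q1 -
    q0, bounded pointwise. The exponents of the logarithm match because b - 1/q
    is the same for both. *)
Lemma wsemi_interpolation a b0 b1 (q0 q1 : \bar R) w K :
  (forall t, 0 <= w t) -> nondecreasing_fun w ->
  (0 < q0)%E -> (q0 <= q1)%E -> b1 - inv_exponent q1 = b0 - inv_exponent q0 ->
  0 <= K -> (wsemi a b0 q0 w <= K%:E)%E ->
  (forall t, 0 < t < 1 -> wfun a (b0 - inv_exponent q0) w t <= K) ->
  (wsemi a b1 q1 w <= K%:E)%E.
Proof.
move=> w0 wnd; case: q1 => [r1| |].
- case: q0 => [r0|//|//]; rewrite lte_fin lee_fin => r00 r01.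
  rewrite /inv_exponent !fine_invr => bE K0 hK pw.
  have r10 : 0 < r1 by apply: lt_le_trans r01.
  apply/wsemi_leP => //; have {}hK := (wsemi_leP a w b0 r00 K0).1 hK.
  have -> : K `^ r1 = K `^ (r1 - r0) * K `^ r0.
    by rewrite -powRD ?subrK// gt_eqF.
  rewrite EFinM; apply: le_trans (lee_wpmul2l _ hK); last by rewrite lee_fin powR_ge0.
  rewrite -ge0_integralZl_EFin ?powR_ge0//; last 2 first.
  - exact: integrand_ge0.
  - exact: measurable_integrand.
  apply: ge0_le_integral => //.
  - exact: integrand_ge0.
  - exact: measurable_integrand.
  - by apply: measurable_funeM; exact: measurable_integrand.
  - move=> t; rewrite /= in_itv/= => /[dup] t01 /andP[t0 t1].
    rewrite -EFinM lee_fin mulrA ler_wpM2r ?invr_ge0 ?(ltW t0)//.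
    have s1 := one_sub_ln_ge1 (ltW t1).
    have sn0 : 1 - ln t != 0 by rewrite gt_eqF// (lt_le_trans ltr01 s1).
    have wE c : wfun a c w t = t `^ (- a) * w t * (1 - ln t) `^ (- c).
      by rewrite /wfun mulrAC.
    have := pw t t01; rewrite !wE.
    set s := 1 - ln t in s1 sn0 *; set P := t `^ (- a) * w t => hP.
    have P0 : 0 <= P by rewrite /P mulr_ge0 ?powR_ge0.
    clearbody P.
    have -> : (P * s `^ (- b1)) `^ r1 =
        (P * s `^ (- (b0 - r0^-1))) `^ (r1 - r0) * (P * s `^ (- b0)) `^ r0.
      rewrite !powRM ?powR_ge0// mulrACA -powRD ?subrK; last by rewrite gt_eqF.
      congr (_ * _); rewrite -!powRrM -powRD ?sn0 ?implybT//; congr (_ `^ _).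
      have -> : b1 = b0 - r0^-1 + r1^-1 by rewrite -bE subrK.
      by field; rewrite !gt_eqF.
    rewrite ler_wpM2r ?powR_ge0// ge0_ler_powR ?subr_ge0 ?nnegrE ?mulr_ge0 ?powR_ge0//.
- move=> _ _; rewrite {1}/inv_exponent invey/= subr0 => -> K0 _ pw.
  apply: ge_ereal_sup => _ [t /= t01 <-]; rewrite in_itv/= in t01.
  by rewrite lee_fin; exact: pw.
- by case: q0.
Qed.

(** With the critical power of the logarithm, the integrand is 1 / ((1 - log t)
    t), whose primitive is the iterated logarithm. *)
Lemma wsemi_lower_log a b (r : R) w (K k : R) x y :
  (forall t, 0 <= w t) -> nondecreasing_fun w -> 0 < r -> 0 <= K -> 0 <= k ->
  0 < x -> x < y -> y < 1 ->
  (forall t, x <= t <= y -> k * (1 - ln t) `^ (b - r^-1) <= t `^ (- a) * w t) ->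
  (wsemi a b r%:E w <= K%:E)%E ->
  k `^ r * (ln (1 - ln x) - ln (1 - ln y)) <= K `^ r.
Proof.
move=> w0 wnd r0 K0 k0 x0 xy y1 hk hK.
have sge t : x <= t <= y -> 1 <= 1 - ln t.
  by case/andP=> _ ty; apply: one_sub_ln_ge1; rewrite (le_trans ty) ?ltW.
have mg : measurable_fun (`]0%R, 1%R[%classic : set R) (fun t => (1 - ln t) `^ (- 1)).
  by apply: measurable_log_weight; exact: measurable_itv.
have := wsemi_lower wnd r0 K0 x0 y1 (powR_ge0 k r) hK mg.
have E : (\int[leb1]_(t in `[x, y]) ((1 - ln t) `^ (- 1) * t^-1)%:E =
    (ln (1 - ln x) - ln (1 - ln y))%:E)%E.
  rewrite -log_integral_inv//; apply: eq_integral => t; rewrite inE/= in_itv/= => /sge s1.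
  by rewrite powR_inv1// (le_trans ler01).
rewrite E -EFinM lee_fin; apply; first by move=> t _; exact: powR_ge0.
move=> t xty; have s1 := sge t xty; have s0 : 0 < 1 - ln t by apply: lt_le_trans s1.
have -> : (1 - ln t) `^ (- 1) = ((1 - ln t) `^ (- r^-1)) `^ r.
  by rewrite -powRrM mulNr mulVf ?gt_eqF.
rewrite -powRM ?powR_ge0// ge0_ler_powR ?(ltW r0) ?nnegrE ?wfun_ge0 ?mulr_ge0 ?powR_ge0//.
rewrite /wfun mulrAC.
have -> : (1 - ln t) `^ (- r^-1) = (1 - ln t) `^ (b - r^-1) * (1 - ln t) `^ (- b).
  by rewrite -powRD ?(gt_eqF s0) ?implybT//; congr (_ `^ _); ring.
by rewrite mulrA ler_wpM2r ?powR_ge0// hk.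
Qed.

End weighted_seminorms.

(** * Sufficiency of the conditions *)

Section sufficiency.
Context {R : realType} {d : nat}.
Variables (mu : {measure set (space R d) -> \bar R}) (L : set (space R d)) (p : R).
Hypothesis TI : translation_invariant mu L.
Hypothesis p1 : 1 <= p.
Implicit Types (f g : space R d -> R[i]) (h : space R d) (a b t u K : R).

Local Notation Lpi := (Lpi mu L p).
Local Notation nrm := (nrm mu p).
Local Notation rmod := (rmod mu p).

Lemma modulus_lt0 a f t : t < 0 -> rmod a f t = 0.
Proof.
move=> t0; rewrite /rmod /modulus [X in ereal_sup X](_ : _ = set0) ?ereal_sup0//.
apply/seteqP; split => // _ [h /= ht _].
by have := le_lt_trans ht t0; rewrite ltNge sqrtr_ge0.
Qed.

Lemma rmod_ge0_all a f : 0 <= a -> Lpi f -> forall t, 0 <= rmod a f t.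
Proof.
move=> a0 fX t; have [t0|t0] := leP 0 t; last by rewrite modulus_lt0.
exact: (rmod_ge0 TI).
Qed.

Lemma rmod_nd a f : 0 <= a -> Lpi f -> nondecreasing_fun (rmod a f).
Proof.
move=> a0 fX s t st; have [s0|s0] := leP 0 s; first exact: (rmod_mono TI).
by rewrite (modulus_lt0 _ _ s0) rmod_ge0_all.
Qed.

Lemma Lip_seminormE a b (q : \bar R) f : 0 <= a -> Lpi f ->
  Lip_seminorm mu a b p q f = wsemi a b q (rmod a f).
Proof.
move=> a0 fX.
have wE t : 0 < t -> Lip_weighted mu a b p f t = (wfun a b (rmod a f) t)%:E.
  move=> t0; rewrite /Lip_weighted (modulusE TI p1 a0 fX); last exact: ltW.
  by rewrite -EFinM.
have supE : ereal_sup [set Lip_weighted mu a b p f t | t in `]0%R, 1%R[] =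
    ereal_sup [set (wfun a b (rmod a f) t)%:E | t in `]0%R, 1%R[].
  congr ereal_sup; apply/seteqP; split => _ [t t01 <-]; exists t => //;
    by move: t01; rewrite /= in_itv/= => /andP[t0 _]; rewrite wE.
case: q => [r| |] //; rewrite /Lip_seminorm /wsemi; congr (_ `^ _)%E.
apply: eq_integral => t; rewrite inE/= in_itv/= => /andP[t0 t1].
by rewrite wE// poweR_EFin EFinM.
Qed.

Lemma Lip_qnorm_le a b q f K : 0 <= a -> Lpi f -> (Lip_qnorm mu a b p q f <= K%:E)%E ->
  nrm f <= K /\ (wsemi a b q (rmod a f) <= K%:E)%E.
Proof.
move=> a0 fX; rewrite /Lip_qnorm Lip_seminormE// (Lp_normE fX) => h.
have s0 : (0 <= wsemi a b q (rmod a f))%E.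
  rewrite /wsemi; case: q h => [r _| _|_]; first exact: poweR_ge0.
    have t01 : `]0%R, 1%R[%classic (2^-1 : R) by rewrite /= in_itv/=; apply/andP; split; lra.
    apply: (@le_trans _ _ (wfun a b (rmod a f) 2^-1)%:E).
      by rewrite lee_fin wfun_ge0//; exact: rmod_ge0_all.
    by apply: ereal_sup_ubound; exists 2^-1.
  have t01 : `]0%R, 1%R[%classic (2^-1 : R) by rewrite /= in_itv/=; apply/andP; split; lra.
  apply: (@le_trans _ _ (wfun a b (rmod a f) 2^-1)%:E).
    by rewrite lee_fin wfun_ge0//; exact: rmod_ge0_all.
  by apply: ereal_sup_ubound; exists 2^-1.
split.
  by rewrite -lee_fin; apply: le_trans h; rewrite leeDl.
by apply: le_trans h; rewrite leeDr// lee_fin nrm_ge0.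
Qed.

(** [wsemi_pointwise] for moduli of smoothness, which are almost decreasing
    after division by t^a. *)
Lemma pointwise_bound a b (q : \bar R) : 0 <= a -> (0 < q)%E -> inv_exponent q < b ->
  exists C : R, 0 <= C /\ forall f K, Lpi f -> 0 <= K ->
    (Lip_qnorm mu a b p q f <= K%:E)%E ->
    forall t, 0 < t < 1 -> wfun a (b - inv_exponent q) (rmod a f) t <= C * K.
Proof.
move=> a0 q0 qb; have [A [A0 hA]] := rmod_almost_decreasing TI p1 a0.
have A1 : 0 < A + 1 by rewrite ltr_wpDl.
have [C [C0 hC]] := wsemi_pointwise a0 A1 q0 qb; exists C; split => //.
move=> f K fX K0 /(Lip_qnorm_le a0 fX)[_ hs]; apply: hC => //.
- exact: rmod_ge0_all.
- exact: rmod_nd.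
- move=> u t u0 ut; apply: le_trans (hA f u t fX u0 ut) _.
  rewrite ler_wpM2r ?rmod_ge0_all// ler_wpM2r ?powR_ge0// lerDl//.
Qed.

Lemma log_le_pow (c e : R) : 0 < c -> 0 < e -> exists C : R, 0 <= C /\
  forall t, 0 < t < 1 -> (1 - ln t) `^ c <= C * t `^ (- e).
Proof.
move=> c0 e0; pose g := e / c; have g0 : 0 < g by rewrite divr_gt0.
exists ((1 + g^-1) `^ c); split; first exact: powR_ge0.
move=> t /andP[t0 t1].
have s1 := one_sub_ln_ge1 (ltW t1).
have -> : - e = (- g) * c by rewrite mulNr divfK ?gt_eqF.
rewrite powRrM -powRM ?powR_ge0 ?addr_ge0 ?invr_ge0 ?(ltW g0)//.
rewrite ge0_ler_powR ?(ltW c0) ?nnegrE ?mulr_ge0 ?powR_ge0 ?addr_ge0 ?invr_ge0 ?(ltW g0)//.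
  by rewrite oppr_ge0 ln_le0 ?(ltW t1).
have h : 1 - g * ln t <= t `^ (- g).
  by rewrite /powR gt_eqF// mulNr expR_ge1Dx.
have l0 : ln t <= 0 by apply: ln_le0; exact: ltW.
have h1 : 1 - ln t <= (1 + g^-1) * (1 - g * ln t).
  have -> : (1 + g^-1) * (1 - g * ln t) = (1 - ln t) + (g^-1 - g * ln t).
    by field; rewrite gt_eqF.
  by rewrite lerDl subr_ge0 (@le_trans _ _ 0)// ?invr_ge0 ?(ltW g0)// mulr_ge0_le0// ltW.
apply: le_trans h1 _; rewrite ler_wpM2l// addr_ge0// invr_ge0 ltW//.
Qed.

Section embedding.
Variables (a0 a1 b0 b1 : R) (q0 q1 : \bar R).
Hypotheses (ha0 : 0 < a0) (ha1 : 0 < a1) (hq0 : (0 < q0)%E) (hq1 : (0 < q1)%E).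
Hypotheses (hb0 : inv_exponent q0 < b0) (hb1 : inv_exponent q1 < b1).

Let s0 := b0 - inv_exponent q0.

(** The modulus of order a0 is O(t^e) for e < a0, since powers of t dominate
    the logarithm. For a1 < e < a0, Marchaud's inequality gives the full order
    a1. *)
Let smaller_order : a1 < a0 -> exists C : R, 0 <= C /\ forall f K, Lpi f -> 0 <= K ->
    (Lip_qnorm mu a0 b0 p q0 f <= K%:E)%E ->
    forall t, 0 < t < 1 -> t `^ (- a1) * rmod a1 f t <= C * K.
Proof.
move=> a10; have [C1 [C10 hC1]] := pointwise_bound (ltW ha0) hq0 hb0.
pose e := (a0 + a1) / 2.
have [e1 e2] : a1 < e /\ e < a0 by rewrite /e; split; lra.
have s00 : 0 < s0 by rewrite subr_gt0.
have de : 0 < a0 - e by rewrite subr_gt0.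
have [C2 [C20 hC2]] := log_le_pow s00 de.
have [C3 [C30 hC3]] := marchaud TI p1 ha1 a10 e1.
have [C4 [C40 hC4]] := rmod_bound TI p1 (ltW ha1).
pose C := C1 * C2 + 1.
have C0 : 0 <= C by rewrite addr_ge0// mulr_ge0.
exists ((C3 * C + C4) * 2 `^ a1).
split; first by rewrite mulr_ge0 ?powR_ge0 ?addr_ge0 ?mulr_ge0.
move=> f K fX K0 hK t /andP[t0 t1].
have [fK _] := Lip_qnorm_le (ltW ha0) fX hK.
have w0 u : 0 < u <= 2^-1 -> rmod a0 f u <= C * K * (u / 2^-1) `^ e.
  case/andP=> u0 u2; have u1 : u < 1 by lra.
  have := hC1 f K fX K0 hK u; rewrite u0 u1 => /(_ isT); rewrite /wfun => h.
  have h2 : u `^ (- a0) * rmod a0 f u <= C1 * K * (1 - ln u) `^ s0.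
    rewrite -ler_pdivrMr -?powRN 1?mulrAC//.
    by rewrite powR_gt0// (lt_le_trans ltr01)// one_sub_ln_ge1// ltW.
  have h3 : rmod a0 f u <= C1 * K * (1 - ln u) `^ s0 * u `^ a0.
    by move: h2; rewrite powRN mulrC ler_pdivrMr ?powR_gt0.
  apply: (le_trans h3).
  have := hC2 u; rewrite u0 u1 => /(_ isT) h4.
  apply: (@le_trans _ _ (C1 * K * (C2 * u `^ (- (a0 - e))) * u `^ a0)).
    by rewrite ler_wpM2r ?powR_ge0// ler_wpM2l// mulr_ge0.
  have -> : C1 * K * (C2 * u `^ (- (a0 - e))) * u `^ a0 = C1 * C2 * K * u `^ e.
    rewrite -[in RHS](_ : - (a0 - e) + a0 = e); last by ring.
    rewrite powRD; last by rewrite (gt_eqF u0) implybT.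
    ring.
  apply: ler_pM; rewrite ?mulr_ge0 ?powR_ge0//.
    by rewrite ler_wpM2r// /C lerDl.
  rewrite invrK ge0_ler_powR ?nnegrE ?(ltW u0) ?(ltW (lt_trans ha1 e1))//.
    by rewrite mulr_ge0// ltW.
  by rewrite ler_peMr ?(ltW u0)// ler1n.
have fCK : nrm f <= C * K.
  by apply: le_trans fK _; rewrite /C mulrDl mul1r lerDr// !mulr_ge0.
have h20 : 0 < 2^-1 :> R by rewrite invr_gt0.
have mar := hC3 f (C * K) 2^-1 fX h20 fCK w0.
have t2a : t `^ (- a1) * (t / 2^-1) `^ a1 = 2 `^ a1.
  rewrite invrK powRM ?(ltW t0)// mulrA -powRD ?addNr ?powRr0 ?mul1r//.
  by rewrite (gt_eqF t0) implybT.
have [t2|t2] := leP t 2^-1.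
  have := mar t; rewrite t0 t2 => /(_ isT) h.
  apply: (@le_trans _ _ (t `^ (- a1) * (C3 * (C * K) * (t / 2^-1) `^ a1))).
    by rewrite ler_wpM2l ?powR_ge0.
  by rewrite mulrCA t2a [leRHS]mulrAC ler_wpM2r ?powR_ge0// mulrA ler_wpM2r// lerDl.
apply: (@le_trans _ _ (t `^ (- a1) * (C4 * K * (t / 2^-1) `^ a1))).
  rewrite ler_wpM2l ?powR_ge0//; apply: (le_trans (hC4 f t fX (ltW t0))).
  apply: (@le_trans _ _ (C4 * K)); first by rewrite ler_wpM2l.
  rewrite ler_peMr ?mulr_ge0// invrK -[leLHS](powRr0 (t * 2)) ler_powR ?(ltW ha1)//.
  lra.
by rewrite mulrCA t2a [leRHS]mulrAC ler_wpM2r ?powR_ge0// ler_wpM2r// lerDr mulr_ge0.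
Qed.

Definition embedding_condition :=
  [\/ a1 < a0,
      a0 = a1 /\ b0 - inv_exponent q0 < b1 - inv_exponent q1
    | [/\ a0 = a1, b1 - inv_exponent q1 = b0 - inv_exponent q0 & (q0 <= q1)%E]].

Lemma embedding_bound : embedding_condition ->
  exists C : R, 0 <= C /\ forall f K, Lpi f -> 0 <= K ->
    (Lip_qnorm mu a0 b0 p q0 f <= K%:E)%E ->
    (Lip_qnorm mu a1 b1 p q1 f <= (C * K)%:E)%E.
Proof.
suff semi : embedding_condition -> exists C : R, 0 <= C /\
    forall f K, Lpi f -> 0 <= K -> (Lip_qnorm mu a0 b0 p q0 f <= K%:E)%E ->
    (wsemi a1 b1 q1 (rmod a1 f) <= (C * K)%:E)%E.
  move=> /semi[C [C0 hC]]; exists (C + 1); split; first by rewrite addr_ge0.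
  move=> f K fX K0 hK; have [fK _] := Lip_qnorm_le (ltW ha0) fX hK.
  rewrite /Lip_qnorm Lip_seminormE ?(ltW ha1)// (Lp_normE fX) mulrDl mul1r addrC EFinD.
  by rewrite leeD ?lee_fin ?hC.
have [C1 [C10 hC1]] := pointwise_bound (ltW ha0) hq0 hb0.
have pw f K : Lpi f -> 0 <= K -> (Lip_qnorm mu a0 b0 p q0 f <= K%:E)%E ->
    forall t, 0 < t < 1 -> t `^ (- a0) * rmod a0 f t <= C1 * K * (1 - ln t) `^ s0.
  move=> fX K0 hK t t01; have := hC1 f K fX K0 hK t t01; rewrite /wfun => h.
  rewrite -ler_pdivrMr -?powRN 1?mulrAC//.
  by case/andP: t01 => _ t1; rewrite powR_gt0// (lt_le_trans ltr01)// one_sub_ln_ge1// ltW.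
case=> [a10|[a01 lt01]|[a01 eq01 q01]].
- have [C [C0 hC]] := smaller_order a10.
  have c0 : 0 < b1 - inv_exponent q1 by rewrite subr_gt0.
  have [C' [C'0 hC']] := wsemi_upper a1 hq1 c0.
  exists (C' * C); split; first by rewrite mulr_ge0.
  move=> f K fX K0 hK; rewrite -mulrA; apply: hC'.
  + exact: rmod_ge0_all (ltW ha1) fX.
  + exact: rmod_nd (ltW ha1) fX.
  + by rewrite mulr_ge0.
  + by move=> t t01; rewrite powRr0 mulr1; exact: (hC f K).
- have [C' [C'0 hC']] := wsemi_upper a1 hq1 lt01.
  exists (C' * C1); split; first by rewrite mulr_ge0.
  move=> f K fX K0 hK; rewrite -mulrA; apply: hC'.
  + exact: rmod_ge0_all (ltW ha1) fX.
  + exact: rmod_nd (ltW ha1) fX.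
  + by rewrite mulr_ge0.
  + by move=> t t01; rewrite -a01; exact: pw.
- exists (C1 + 1); split; first by rewrite addr_ge0.
  move=> f K fX K0 hK; have [_ hs] := Lip_qnorm_le (ltW ha0) fX hK.
  rewrite -a01; apply: (wsemi_interpolation _ _ hq0 q01 eq01).
  + exact: rmod_ge0_all (ltW ha0) fX.
  + exact: rmod_nd (ltW ha0) fX.
  + by rewrite mulr_ge0// addr_ge0.
  + by apply: le_trans hs _; rewrite lee_fin mulrDl mul1r lerDr mulr_ge0.
  + move=> t t01; apply: le_trans (hC1 f K fX K0 hK t t01) _.
    by rewrite mulrDl mul1r lerDl.
Qed.

(** Stated for a general measure, so that both spaces of the theorem are
    instances. *)
Definition LipX a b q : set (space R d -> R[i]) :=
  [set f | Lpi f /\ (Lip_qnorm mu a b p q f < +oo)%E].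

Lemma Lpi_sub f g : Lpi f -> Lpi g -> Lpi (fun x => g x - f x).
Proof.
move=> fX gX; have [nfX _] := Lpi_cscale p1 (-1) fX.
have [gfX _] := Lpi_add p1 gX nfX.
rewrite (_ : (fun x => _) = (fun x => g x + cscale (-1) f x))//.
apply/funext => x; rewrite /cscale !mulN1r; case: (f x) => u v.
by rewrite -[(u +i* v)%C]opprK.
Qed.

Lemma continuous_embedding : embedding_condition ->
  continuous_inclusion (LipX a0 b0 q0) (Lip_qnorm mu a0 b0 p q0)
                       (LipX a1 b1 q1) (Lip_qnorm mu a1 b1 p q1).
Proof.
move=> /embedding_bound[C [C0 hC]].
have fin f : Lpi f -> (Lip_qnorm mu a0 b0 p q0 f < +oo)%E -> exists K : R, 0 <= K /\
    Lip_qnorm mu a0 b0 p q0 f = K%:E.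
  move=> fX foo; have Q0 : (0 <= Lip_qnorm mu a0 b0 p q0 f)%E.
    rewrite /Lip_qnorm; apply: adde_ge0; first exact: Lnorm_ge0.
    have := @Lip_seminormE a0 b0 q0 f (ltW ha0) fX => ->.
    case: (q0) hq0 => [r _|_|//]; first exact: poweR_ge0.
    have t01 : `]0%R, 1%R[%classic (2^-1 : R) by rewrite /= in_itv/=; apply/andP; split; lra.
    apply: (@le_trans _ _ (wfun a0 b0 (rmod a0 f) 2^-1)%:E).
      by rewrite lee_fin wfun_ge0//; exact: rmod_ge0_all (ltW ha0) fX.
    by apply: ereal_sup_ubound; exists 2^-1.
  exists (fine (Lip_qnorm mu a0 b0 p q0 f)); split; first exact: fine_ge0.
  by rewrite fineK// ge0_fin_numE.
split.
  move=> f [fX foo]; split => //; have [K [K0 hK]] := fin f fX foo.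
  by apply: le_lt_trans (hC f K fX K0 _) (ltry _); rewrite hK.
move=> f [fX _] e e0; have C1 : 0 < C + 1 by rewrite ltr_wpDl.
exists (e / (C + 1)); first by rewrite divr_gt0.
move=> g [gX _] hlt; have gfX := Lpi_sub fX gX.
have [K [K0 hK]] := fin _ gfX (lt_trans hlt (ltry _)).
rewrite hK lte_fin ltr_pdivlMr// in hlt.
apply: le_lt_trans (hC _ K gfX K0 _) _; first by rewrite hK.
rewrite lte_fin; apply: le_lt_trans hlt; rewrite mulrC ler_wpM2l// lerDl//.
Qed.

End embedding.
End sufficiency.

(** * Linear combinations and lacunary sums of weights *)

Section linear_combinations.
Context {R : realType} {d : nat}.
Variables (mu : {measure set (space R d) -> \bar R}) (L : set (space R d)) (p : R).
Hypothesis TI : translation_invariant mu L.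
Hypothesis p1 : 1 <= p.
Implicit Types (f g : space R d -> R[i]) (h x : space R d) (a b t u K : R).

Local Notation Lpi := (Lpi mu L p).
Local Notation nrm := (nrm mu p).
Local Notation rmod := (rmod mu p).

Lemma majorant_add (a : nat -> R) s h f g n x :
  majorant a s h (fun y => f y + g y) n x <=
  majorant a s h f n x + majorant a s h g n x.
Proof.
rewrite -big_split; apply: ler_sum => j _ /=.
by rewrite -mulrDr ler_wpM2l//; exact: le_normcD.
Qed.

Lemma op_addf (a : nat -> R) s h f g x :
  summable_at a s h f x -> summable_at a s h g x ->
  op a s h (fun y => f y + g y) x = op a s h f x + op a s h g x.
Proof.
move=> sf sg; have [A fA] := sf; have [B gB] := sg.
have addE (z w : R[i]) : z + w = ((Re z + Re w) +i* (Im z + Im w))%C by case: z w => ? ? [].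
rewrite addE; apply: op_limit.
- by exists (A + B) => n; apply: le_trans (majorant_add _ _ _ _ _ _ _) _; exact: lerD.
- rewrite (_ : (fun n => _) = (fun n =>
      \sum_(j < n) a j * Re (f (translate x (s - j%:R) h)) +
      \sum_(j < n) a j * Re (g (translate x (s - j%:R) h)))).
    by apply: cvgD; exact: op_Re_cvg.
  apply/funext => n; rewrite -big_split; apply: eq_bigr => j _ /=.
  by rewrite addE/= mulrDr.
- rewrite (_ : (fun n => _) = (fun n =>
      \sum_(j < n) a j * Im (f (translate x (s - j%:R) h)) +
      \sum_(j < n) a j * Im (g (translate x (s - j%:R) h)))).
    by apply: cvgD; exact: op_Im_cvg.
  apply/funext => n; rewrite -big_split; apply: eq_bigr => j _ /=.
  by rewrite addE/= mulrDr.
Qed.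

Lemma op_scalef (a : nat -> R) s h f (k : R) x : summable_at a s h f x ->
  op a s h (cscale k f) x = cscale k (op a s h f) x.
Proof.
move=> sf; have [A fA] := sf; apply: op_limit.
- exists (`|k| * A) => n; apply: le_trans (ler_wpM2l (normr_ge0 k) (fA n)).
  by rewrite mulr_sumr; apply: ler_sum => j _; rewrite normc_cscale mulrCA.
- rewrite (_ : (fun n => _) = (fun n => k *
      \sum_(j < n) a j * Re (f (translate x (s - j%:R) h)))).
    by apply: cvgMl_tmp; exact: op_Re_cvg.
  by apply/funext => n; rewrite mulr_sumr; apply: eq_bigr => j _; rewrite mulrCA.
- rewrite (_ : (fun n => _) = (fun n => k *
      \sum_(j < n) a j * Im (f (translate x (s - j%:R) h)))).
    by apply: cvgMl_tmp; exact: op_Im_cvg.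
  by apply/funext => n; rewrite mulr_sumr; apply: eq_bigr => j _; rewrite mulrCA.
Qed.

Lemma nrm_difference_add a h f g : 0 <= a -> Lpi f -> Lpi g ->
  nrm (difference a h (fun x => f x + g x)) <=
  nrm (difference a h f) + nrm (difference a h g).
Proof.
move=> /diff_coef_l1[C aC] fX gX; have [fgX _] := Lpi_add p1 fX gX.
have [sf fD _] := op_bound TI p1 a h fX aC.
have [sg gD _] := op_bound TI p1 a h gX aC.
have [_ fgD _] := op_bound TI p1 a h fgX aC.
have [sumX sumle] := Lpi_add p1 fD gD.
rewrite (nrm_ae fgD sumX)//.
by apply: filterS2 sf sg => x; exact: op_addf.
Qed.

Lemma nrm_difference_scale a h f (k : R) : 0 <= a -> Lpi f ->
  nrm (difference a h (cscale k f)) = `|k| * nrm (difference a h f).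
Proof.
move=> /diff_coef_l1[C aC] fX; have [kX _] := Lpi_cscale p1 k fX.
have [sf fD _] := op_bound TI p1 a h fX aC.
have [_ kD _] := op_bound TI p1 a h kX aC.
have [kfX <-] := Lpi_cscale p1 k fD.
apply: (nrm_ae kD kfX); apply: filterS sf => x; exact: op_scalef.
Qed.

Definition lin J (k : nat -> R) (phi : nat -> space R d -> R[i]) x : R[i] :=
  ((\sum_(j < J) k j * Re (phi j x)) +i* (\sum_(j < J) k j * Im (phi j x)))%C.

Lemma linS J k phi : lin J.+1 k phi = fun x => lin J k phi x + cscale (k J) (phi J) x.
Proof. by apply/funext => x; rewrite /lin !big_ord_recr. Qed.

Lemma lin_norm J k phi : (forall j, Lpi (phi j)) ->
  Lpi (lin J k phi) /\ nrm (lin J k phi) <= \sum_(j < J) `|k j| * nrm (phi j).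
Proof.
move=> phiX; elim: J => [|J [IX IH]].
  have -> : lin 0 k phi = cscale 0 (phi 0%N).
    by apply/funext => x; rewrite /lin !big_ord0 /cscale !mul0r.
  have [zX zE] := Lpi_cscale p1 0 (phiX 0%N).
  by split => //; rewrite zE big_ord0 normr0 mul0r.
have [kX kE] := Lpi_cscale p1 (k J) (phiX J).
have [sX sle] := Lpi_add p1 IX kX; rewrite linS; split => //.
by apply: (le_trans sle); rewrite big_ord_recr/= -kE lerD.
Qed.

Lemma lin_difference J k phi a h : 0 <= a -> (forall j, Lpi (phi j)) ->
  nrm (difference a h (lin J k phi)) <=
  \sum_(j < J) `|k j| * nrm (difference a h (phi j)).
Proof.
move=> a0 phiX; elim: J => [|J IH].
  have -> : lin 0 k phi = cscale 0 (phi 0%N).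
    by apply/funext => x; rewrite /lin !big_ord0 /cscale !mul0r.
  by rewrite nrm_difference_scale// big_ord0 normr0 mul0r.
have [kX kE] := Lpi_cscale p1 (k J) (phiX J).
have [IX _] := lin_norm J k phiX.
rewrite linS; apply: (le_trans (nrm_difference_add h a0 IX kX)).
by rewrite big_ord_recr/= -nrm_difference_scale// lerD.
Qed.

Lemma lin_rmod J k phi a t : 0 <= a -> 0 <= t -> (forall j, Lpi (phi j)) ->
  rmod a (lin J k phi) t <= \sum_(j < J) `|k j| * rmod a (phi j) t.
Proof.
move=> a0 t0 phiX; have [lX _] := lin_norm J k phiX.
apply: (rmod_le TI p1 a0 lX t0) => h ht; apply: (le_trans (lin_difference _ _ _ a0 phiX)).
by apply: ler_sum => j _; rewrite ler_wpM2l//; exact: (rmod_ub TI).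
Qed.

(** The triangle inequality, for isolating one frequency in a lacunary sum. *)
Lemma lin_difference_lower J (k : nat -> R) (phi : nat -> space R d -> R[i])
    a h (i : 'I_J) : 0 <= a -> (forall j, Lpi (phi j)) ->
  `|k i| * nrm (difference a h (phi i)) <=
  nrm (difference a h (lin J k phi)) +
  \sum_(j < J | j != i) `|k j| * nrm (difference a h (phi j)).
Proof.
move=> a0 phiX; pose k' j := if j == i :> nat then 0 else - k j.
have [lX _] := lin_norm J k phiX; have [l'X _] := lin_norm J k' phiX.
rewrite -nrm_difference_scale//.
have -> : cscale (k i) (phi i) = fun x => lin J k phi x + lin J k' phi x.
  have E (F : nat -> R) : k i * F i = \sum_(j < J) k j * F j + \sum_(j < J) k' j * F j.
    rewrite -big_split (bigD1 i)//= {1}/k' eqxx mul0r addr0 big1 ?addr0// => j ji.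
    by rewrite /k' -(inj_eq val_inj) in ji *; rewrite (negbTE ji) -mulrDl subrr mul0r.
  apply/funext => x; rewrite /cscale /lin (E (fun j => Re (phi j x))).
  by rewrite (E (fun j => Im (phi j x))).
apply: (le_trans (nrm_difference_add h a0 lX l'X)); rewrite lerD2l.
apply: (le_trans (lin_difference _ _ _ a0 phiX)).
rewrite (bigD1 i)//= {1}/k' eqxx normr0 mul0r add0r.
apply: ler_sum => j ji; rewrite /k' -(inj_eq val_inj) in ji *.
by rewrite (negbTE ji) normrN.
Qed.

End linear_combinations.

Section lacunary_sums.
Context {R : realType}.
Implicit Types (c t s u : R).

(** The exponential form of [log_le_pow]. *)
Lemma one_add_pow_le_exp (c e : R) : 0 < c -> 0 < e -> exists C : R, 1 <= C /\
  forall y, 0 <= y -> (1 + y) `^ c <= C * expR (e * y).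
Proof.
move=> c0 e0; have [C [C0 hC]] := log_le_pow c0 e0.
exists (C + 1); split; first by rewrite lerDr.
move=> y; rewrite le_eqVlt => /predU1P[<-|y0].
  by rewrite addr0 powR1 mulr0 expR0 mulr1 lerDr.
have := hC (expR (- y)); rewrite expR_gt0 expR_lt1 oppr_lt0 y0 => /(_ isT).
rewrite expRK opprK -expRM mulrNN => h; apply: le_trans h _.
by rewrite [y * e]mulrC ler_wpM2r ?expR_ge0// lerDl.
Qed.

(** A geometric sequence only meets a bounded neighbourhood of 1: the sum
    telescopes against u / (1 + u). *)
Lemma geometric_min_sum (g u : R) J : 1 < g -> 0 < u ->
  \sum_(j < J) Num.min (g ^+ j * u) (g ^+ j * u)^-1 <= 4 * g / (g - 1).
Proof.
move=> g1 u0; have g0 : 0 < g by apply: lt_trans g1.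
pose psi v : R := v / (1 + v).
have psi01 v : 0 < v -> 0 <= psi v <= 1.
  move=> v0; have v1 : 0 < 1 + v by rewrite addr_gt0.
  rewrite /psi divr_ge0 ?(ltW v0) ?(ltW v1)//= ler_pdivrMr// mul1r lerDr//.
have step v : 0 < v -> Num.min v v^-1 <= 4 * g / (g - 1) * (psi (g * v) - psi v).
  move=> v0; have v1 : 0 < 1 + v by rewrite addr_gt0.
  have gv0 : 0 < g * v by rewrite mulr_gt0.
  have gv1 : 0 < 1 + g * v by rewrite addr_gt0.
  have g10 : 0 < g - 1 by rewrite subr_gt0.
  have -> : 4 * g / (g - 1) * (psi (g * v) - psi v) =
      4 * g * v / ((1 + g * v) * (1 + v)).
    by rewrite /psi; field; rewrite !gt_eqF.
  rewrite ler_pdivlMr ?mulr_gt0//.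
  have [v1'|v1'] := leP v 1.
    rewrite min_l; last by rewrite (le_trans v1')// invf_ge1.
    rewrite mulrC ler_wpM2r ?(ltW v0)//.
    apply: (@le_trans _ _ ((g + g) * 2)); last by rewrite -mulr2n -mulr_natr; lra.
    apply: ler_pM; rewrite ?(ltW gv1) ?(ltW v1)//; last lra.
    by apply: lerD; [exact: ltW|rewrite ler_piMr// ltW].
  rewrite min_r; last by rewrite (le_trans _ (ltW v1'))// invf_le1// ltW.
  rewrite mulrC -ler_pdivlMr ?invr_gt0// invrK.
  apply: (@le_trans _ _ ((g * v + g * v) * (v + v))); last by rewrite le_eqVlt; apply/orP; left; apply/eqP; ring.
  apply: ler_pM; rewrite ?(ltW gv1) ?(ltW v1)//.
    by rewrite lerD2r -[leLHS]mulr1 ler_pM// ltW.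
  by rewrite lerD2r ltW.
apply: (@le_trans _ _ (\sum_(j < J) 4 * g / (g - 1) *
    (psi (g ^+ j.+1 * u) - psi (g ^+ j * u)))).
  apply: ler_sum => j _; have v0 : 0 < g ^+ j * u by rewrite mulr_gt0// exprn_gt0.
  by have := step _ v0; rewrite (mulrA g) -exprS.
have -> : \sum_(j < J) 4 * g / (g - 1) * (psi (g ^+ j.+1 * u) - psi (g ^+ j * u)) =
    4 * g / (g - 1) * (psi (g ^+ J * u) - psi u).
  rewrite -mulr_sumr; congr (_ * _); elim: J => [|J IH].
    by rewrite big_ord0 expr0 mul1r subrr.
  by rewrite big_ord_recr/= IH; lra.
rewrite -[leRHS]mulr1 ler_wpM2l//.
  by rewrite divr_ge0 ?mulr_ge0 ?(ltW g0)// subr_ge0 ltW.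
have /andP[_ h1] : 0 <= psi (g ^+ J * u) <= 1 by apply: psi01; rewrite mulr_gt0 ?exprn_gt0.
have /andP[h2 _] := psi01 u u0; lra.
Qed.

Variables (sg al : R).
Hypotheses (sg0 : 0 < sg) (al0 : 0 < al).

(** The logarithms of the frequencies form a geometric sequence, so that a
    power of the logarithm sums like its last term. *)
Definition lacn (M j : nat) : nat := (M ^ (2 ^ j))%N.

Lemma lacn_gt0 M j : (0 < M)%N -> (0 < lacn M j)%N.
Proof. by move=> M0; rewrite expn_gt0 M0. Qed.

Lemma ln_lacn M j : (0 < M)%N -> ln (lacn M j)%:R = 2 ^+ j * ln M%:R :> R.
Proof.
move=> M0; rewrite /lacn natrX lnXn ?ltr0n// -[LHS]mulr_natl natrX//.
Qed.

(** Terms with log N_j below 1 - log t grow geometrically in j; beyond this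
    threshold, the power of t N_j decays exponentially in log N_j. The sum is
    thus of the size of its term at the threshold, or of the last term if the
    threshold is not reached. *)
Lemma lacunary_sum : exists C : R, 0 <= C /\ forall M J t,
  1 <= ln M%:R :> R -> 0 < t <= 1 ->
  \sum_(j < J) ln (lacn M j)%:R `^ sg * Num.min 1 ((t * (lacn M j)%:R) `^ (- al)) <=
    C * Num.min (1 - ln t) (ln (lacn M J)%:R) `^ sg.
Proof.
have sg20 : 0 < 2 * sg by rewrite mulr_gt0.
have [C1 [C11 hC1]] := one_add_pow_le_exp sg20 al0.
have C10 : 0 <= C1 by apply: le_trans C11.
pose g : R := 2 `^ sg.
have g1 : 1 < g.
  by rewrite -[ltLHS](powRr0 2) /g /powR pnatr_eq0/= ltr_expR ltr_pM2r// ln_gt0// ltr1n.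
have g0 : 0 < g by apply: lt_trans g1.
pose C2 := C1 * (4 * g / (g - 1)); pose C3 := (g - 1)^-1.
have g10 : 0 < g - 1 by rewrite subr_gt0.
have C20 : 0 <= C2 by rewrite mulr_ge0// divr_ge0 ?mulr_ge0 ?(ltW g0) ?(ltW g10).
have C30 : 0 <= C3 by rewrite invr_ge0 ltW.
exists (C2 + C3); split; first by rewrite addr_ge0.
move=> M J t lM1 /andP[t0 t1].
have M0 : (0 < M)%N.
  by case: M lM1 => // ; rewrite ln0// ler10.
set l := ln M%:R in lM1.
have l0 : 0 < l by apply: lt_le_trans lM1.
have gE (j : nat) : (2 ^+ j * l) `^ sg = g ^+ j * l `^ sg.
  rewrite powRM ?exprn_ge0 ?(ltW l0)//; congr (_ * _).
  by rewrite /g -!powR_mulrn ?powR_ge0// -!powRrM mulrC.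
set s := 1 - ln t.
have s1 : 1 <= s by exact: one_sub_ln_ge1.
have s0 : 0 < s by apply: lt_le_trans s1.
set S := ln (lacn M J)%:R.
have SE : S = 2 ^+ J * l by rewrite /S ln_lacn.
have S0 : 0 < S by rewrite SE mulr_gt0// exprn_gt0.
set X := \sum_(j < J) _.
have XS : X <= C3 * S `^ sg.
  apply: (@le_trans _ _ (\sum_(j < J) g ^+ j * l `^ sg)).
    apply: ler_sum => j _; rewrite ln_lacn// gE.
    have gj0 : 0 <= g ^+ j * l `^ sg by rewrite mulr_ge0 ?powR_ge0 ?exprn_ge0 ?(ltW g0).
    by apply: ler_piMr => //; rewrite ge_min lexx.
  rewrite -mulr_suml SE gE mulrA ler_wpM2r ?powR_ge0// /C3 ler_pdivlMl//.
  by rewrite -subrX1 gerBl.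
have Xs : X <= C2 * s `^ sg.
  pose u := (l / s) `^ sg.
  have u0 : 0 < u by rewrite powR_gt0// divr_gt0.
  apply: (@le_trans _ _ (\sum_(j < J) C1 * s `^ sg * Num.min (g ^+ j * u) (g ^+ j * u)^-1)).
    apply: ler_sum => j _; rewrite ln_lacn// gE.
    have uE : g ^+ j * l `^ sg = s `^ sg * (g ^+ j * u).
      rewrite [RHS]mulrCA /u -powRM ?divr_ge0 ?(ltW s0) ?(ltW l0)//.
      by congr (_ * _ `^ _); rewrite [RHS]mulrC divfK ?gt_eqF.
    rewrite uE; set v := g ^+ j * u.
    have v0 : 0 < v by rewrite mulr_gt0// exprn_gt0.
    rewrite mulrAC -!mulrA [leRHS]mulrCA ler_wpM2l ?powR_ge0//.
    have [vs|vs] := leP v 1.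
      rewrite [Num.min v _]min_l; last by rewrite (le_trans vs)// invf_ge1.
      apply: (@le_trans _ _ (1 * v)); last by rewrite ler_wpM2r// ltW.
      by rewrite ler_wpM2r ?(ltW v0)// ge_min lexx.
    rewrite [Num.min v _]min_r; last by rewrite (le_trans _ (ltW vs))// invf_le1// ltW.
    (* here ln (lacn M j) > s, and the power of t * lacn M j decays exponentially *)
    set sj := 2 ^+ j * l.
    have sj0 : 0 < sj by rewrite mulr_gt0// exprn_gt0.
    have vE : v = (sj / s) `^ sg.
      rewrite /v /u powRM ?(ltW l0) ?invr_ge0 ?(ltW s0)// mulrA -gE -powRM ?(ltW sj0)//.
      by rewrite invr_ge0 ltW.
    have ssj : s < sj.
      rewrite ltNge; apply/negP => sjs; move: vs; rewrite ltNge vE => /negP; apply.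
      have r1 : sj / s <= 1 by rewrite ler_pdivrMr// mul1r.
      rewrite -[leRHS](powRr0 (sj / s)) ger_powR ?(ltW sg0)// divr_gt0//=.
    rewrite ler_pdivlMr// -mulrA -expr2.
    have v2 : v ^+ 2 <= C1 * expR (al * (sj - s)).
      rewrite vE -powR_mulrn ?powR_ge0// -powRrM (mulrC sg).
      apply: (@le_trans _ _ ((1 + (sj - s)) `^ (2 * sg))).
        rewrite ge0_ler_powR ?(ltW sg20) ?nnegrE ?divr_ge0 ?(ltW sj0) ?(ltW s0)//.
          by rewrite addr_ge0// subr_ge0 ltW.
        rewrite ler_pdivrMr//.
        have : 0 <= (sj - s) * (s - 1) by rewrite mulr_ge0 ?subr_ge0 ?(ltW ssj).
        lra.
      by apply: hC1; rewrite subr_ge0 ltW.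
    apply: (@le_trans _ _ ((t * (lacn M j)%:R) `^ (- al) * (C1 * expR (al * (sj - s))))).
      by apply: ler_pM; rewrite ?sqr_ge0 ?le_min ?ler01 ?powR_ge0// ge_min lexx orbT.
    rewrite mulrCA ler_piMr//.
    have tN0 : 0 < t * (lacn M j)%:R by rewrite mulr_gt0// ltr0n lacn_gt0.
    rewrite /powR gt_eqF// -expRD -[leRHS]expR0 ler_expR lnM ?posrE ?ltr0n ?lacn_gt0// ln_lacn//.
    rewrite -/l -/sj /s.
    have : 0 <= al by exact: ltW.
    nra.
  rewrite -mulr_sumr /C2 [leRHS]mulrAC ler_wpM2l ?mulr_ge0 ?powR_ge0//.
  exact: geometric_min_sum.
have mpow : 0 <= Num.min s S by rewrite le_min !ltW.
have [sS|Ss] := leP s S.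
  apply: (le_trans Xs); rewrite ler_wpM2r ?powR_ge0// lerDl//.
apply: (le_trans XS); rewrite ler_wpM2r ?powR_ge0// lerDr//.
Qed.

End lacunary_sums.

(** * Lacunary test functions *)

Section small_powers.
Context {R : realType}.

Lemma pow_small (e C c : R) : 0 < e -> 0 <= C -> 0 < c ->
  exists X : R, 1 <= X /\ forall Y, X <= Y -> C * Y `^ (- e) < c.
Proof.
move=> e0 C0 c0; pose Z := (C + 1) / c.
have Z0 : 0 < Z by rewrite divr_gt0// ltr_wpDl.
exists (Z `^ e^-1 + 1); split; first by rewrite lerDr powR_ge0.
move=> Y ZY.
have Y0 : 0 < Y by apply: lt_le_trans ZY; rewrite ltr_wpDl// powR_ge0.
have YZ : Z <= Y `^ e.
  have -> : Z = (Z `^ e^-1) `^ e by rewrite -powRrM mulVf ?gt_eqF// powRr1// ltW.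
  rewrite ge0_ler_powR ?(ltW e0) ?nnegrE ?powR_ge0 ?(ltW Y0)//.
  by apply: le_trans ZY; rewrite lerDl.
rewrite powRN ltr_pdivrMr ?powR_gt0//.
apply: (@lt_le_trans _ _ (c * Z)); last by rewrite ler_wpM2l// ltW.
by rewrite /Z mulrCA mulfV ?gt_eqF// mulr1 ltrDl.
Qed.

Lemma ln_unbounded (Y : R) (M0 : nat) : exists M : nat, (M0 <= M)%N /\ Y <= ln M%:R.
Proof.
exists (maxn M0 (Num.truncn (expR Y)).+1); split; first exact: leq_maxl.
have /andP[_ h] := Num.Theory.truncn_itv (expR_ge0 Y).
have n0 : 0 < (maxn M0 (Num.truncn (expR Y)).+1)%:R :> R by rewrite ltr0n leq_max orbT.
rewrite -[leLHS]expRK ler_ln ?posrE ?expR_gt0//.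
by apply: (le_trans (ltW h)); rewrite ler_nat leq_maxr.
Qed.

(** The exponent is the distance between j and k, written with truncated
    subtractions. *)
Lemma two_sided_geometric (th : R) (k J : nat) : 0 <= th <= 2^-1 -> (k < J)%N ->
  \sum_(j < J | j != k :> nat) th ^+ ((k - j) + (j - k))%N <= 4 * th.
Proof.
move=> /andP[t0 t2] kJ.
pose u j := if j != k then th ^+ ((k - j) + (j - k))%N else 0.
have -> : \sum_(j < J | j != k :> nat) th ^+ ((k - j) + (j - k))%N = \sum_(j < J) u j.
  by rewrite big_mkcond.
have thn n : th ^+ n.+1 <= 2^-1 * th ^+ n by rewrite exprS ler_wpM2r// exprn_ge0.
have below n : (n <= k)%N -> \sum_(j < n) u j <= 2 * th ^+ (k - n).+1.
  elim: n => [|n IH] nk; first by rewrite big_ord0 mulr_ge0// exprn_ge0.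
  rewrite big_ord_recr/= /u ltn_eqF// (eqP (ltnW nk : n - k == 0)%N) addn0.
  have := IH (ltnW nk); have := thn (k - n)%N.
  rewrite subnSK// => h1 h2; rewrite /u in h2; rewrite /=; lra.
have above n : \sum_(j < k.+1 + n) u j <= 4 * th - 2 * th ^+ n.+1.
  elim: n => [|n IH].
    rewrite addn0 big_ord_recr/= /u eqxx addr0.
    by have := below k (leqnn k); rewrite subnn !expr1 => h; lra.
  rewrite addnS big_ord_recr/= {2}/u gtn_eqF ?ltn_addr//.
  have -> : (k - (k.+1 + n) + (k.+1 + n - k) = n.+1)%N by lia.
  by have := thn n.+1; move: IH; rewrite /u/= => h1 h2; lra.
rewrite -(subnKC kJ); apply: (le_trans (above _)).
by rewrite gerBl mulr_ge0// exprn_ge0.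
Qed.

End small_powers.

Section necessity.
Context {R : realType} {d : nat}.
Variables (mu : {measure set (space R d) -> \bar R}) (L : set (space R d)) (p : R).
Hypothesis TI : translation_invariant mu L.
Hypothesis p1 : 1 <= p.
Implicit Types (f g : space R d -> R[i]) (h x : space R d) (a b t u K : R).

Local Notation Lpi := (Lpi mu L p).
Local Notation nrm := (nrm mu p).
Local Notation rmod := (rmod mu p).

(** Functions phi N oscillating at frequency N, as far as differences of the
    integer order m can tell: the difference of step h is of size (N |h|)^m for
    small steps, and of size 1 for some step bounded by a multiple of 1/N. *)
Definition test_family (m : nat) (phi : nat -> space R d -> R[i]) :=
  exists C c H : R, [/\ 0 <= C, 0 < c, 1 <= H &
    forall N, (0 < N)%N -> [/\ Lpi (phi N), nrm (phi N) <= C,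
      (forall h, N%:R * enorm h <= 1 ->
         nrm (difference m%:R h (phi N)) <= C * (N%:R * enorm h) ^+ m) &
      exists h, enorm h <= H / N%:R /\ c <= nrm (difference m%:R h (phi N))]].

Variables (m : nat) (phi : nat -> space R d -> R[i]) (C0 c0 H : R).
Hypotheses (C00 : 0 <= C0) (c00 : 0 < c0) (H1 : 1 <= H).
Hypothesis phiP : forall N, (0 < N)%N -> [/\ Lpi (phi N), nrm (phi N) <= C0,
      (forall h, N%:R * enorm h <= 1 ->
         nrm (difference m%:R h (phi N)) <= C0 * (N%:R * enorm h) ^+ m) &
      exists h, enorm h <= H / N%:R /\ c0 <= nrm (difference m%:R h (phi N))].

Let H0 : 0 < H. Proof. exact: lt_le_trans ltr01 H1. Qed.

Let phiX N : (0 < N)%N -> Lpi (phi N). Proof. by case/phiP. Qed.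

(** Marchaud's inequality turns the bounds on differences of integer order into
    bounds of any smaller order. *)
Let phi_rmod a : 0 < a < m%:R -> exists C : R, 0 <= C /\ forall N t, (0 < N)%N -> 0 < t ->
  rmod a (phi N) t <= C * Num.min 1 ((t * N%:R) `^ a).
Proof.
case/andP=> a0 am; have [C1 [C10 hC1]] := marchaud TI p1 a0 am am.
have [C2 [C20 hC2]] := rmod_bound TI p1 (ltW a0).
exists ((C1 + C2) * C0); split; first by rewrite mulr_ge0// addr_ge0.
move=> N t N0 t0; have [fX fC fD _] := phiP N0.
have NR0 : 0 < N%:R :> R by rewrite ltr0n.
have bnd : rmod a (phi N) t <= C2 * C0.
  by apply: (le_trans (hC2 _ _ fX (ltW t0))); rewrite ler_wpM2l.
have [tN|tN] := leP (t * N%:R) 1; last first.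
  rewrite min_l; last first.
    by rewrite -[leLHS](powRr0 (t * N%:R)) ler_powR// ltW.
  by apply: (le_trans bnd); rewrite mulr1 ler_wpM2r// lerDr.
rewrite min_r; last first.
  by rewrite -[leRHS](powRr0 (t * N%:R)) ger_powR ?(ltW a0)// mulr_gt0.
have t00 : 0 < N%:R^-1 :> R by rewrite invr_gt0.
have h u : 0 < u <= N%:R^-1 -> rmod m%:R (phi N) u <= C0 * (u / N%:R^-1) `^ m%:R.
  case/andP=> u0 uN; rewrite invrK.
  apply: (rmod_le TI p1 _ fX (ltW u0)) => // v vu.
  have v0 : 0 <= enorm v by exact: sqrtr_ge0.
  have Nv : N%:R * enorm v <= u * N%:R by rewrite mulrC ler_wpM2r// ltW.
  have uN1 : u * N%:R <= 1 by rewrite -ler_pdivlMr// mul1r.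
  apply: (le_trans (fD v (le_trans Nv uN1))).
  rewrite powR_mulrn ?mulr_ge0 ?(ltW u0)// ler_wpM2l// lerXn2r ?nnegrE ?mulr_ge0//.
  exact: ltW.
have tN' : t <= N%:R^-1 by rewrite -[leRHS]mul1r ler_pdivlMr.
have := hC1 (phi N) C0 N%:R^-1 fX t00 fC h t; rewrite t0 tN' invrK => /(_ isT) h2.
by apply: (le_trans h2); rewrite ler_wpM2r ?powR_ge0// ler_wpM2r// lerDl.
Qed.

Definition lac_coef (sg al : R) M j : R :=
  ln (lacn M j)%:R `^ sg * (lacn M j)%:R `^ (- al).

Definition lac_fun sg al M J : space R d -> R[i] :=
  lin J (lac_coef sg al M) (fun j => phi (lacn M j)).

Let lac_coef_ge0 sg al M j : 0 <= lac_coef sg al M j.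
Proof. by rewrite mulr_ge0 ?powR_ge0. Qed.

Lemma lac_funX sg al M J : (0 < M)%N -> Lpi (lac_fun sg al M J).
Proof.
by move=> M0; have [] := @lin_norm _ _ mu L p p1 J (lac_coef sg al M)
  (fun j => phi (lacn M j)) (fun j => phiX (lacn_gt0 j M0)).
Qed.

Let ln_ge1_gt0 (M : nat) : 1 <= ln M%:R :> R -> (0 < M)%N.
Proof. by case: M => //; rewrite ln0// ler10. Qed.

(** At each t, the terms of the sum are bounded through [phi_rmod], and
    [lacunary_sum] gives the critical power of the logarithm, cut off at log
    N_J. *)
Lemma lac_fun_upper al b (q : \bar R) : 0 < al < m%:R -> (0 < q)%E ->
  inv_exponent q < b -> exists C : R, 0 <= C /\ forall M J, 1 <= ln M%:R :> R ->
  (Lip_qnorm mu al b p q (lac_fun (b - inv_exponent q) al M J) <=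
    (C * (1 + ln (ln (lacn M J)%:R)) `^ inv_exponent q)%:E)%E.
Proof.
move=> alm q0 qb; have [al0 _] := andP alm.
set sg := b - inv_exponent q; have sg0 : 0 < sg by rewrite subr_gt0.
have [C1 [C10 hC1]] := phi_rmod alm.
have [C2 [C20 hC2]] := lacunary_sum sg0 al0.
have [C3 [C30 hC3]] := wsemi_upper_cutoff al q0 qb.
exists (C2 * C0 + C3 * (C1 * C2)); split; first by rewrite addr_ge0 ?mulr_ge0.
move=> M J lM; have M0 := ln_ge1_gt0 lM.
have fX := lac_funX sg al J M0; set f := lac_fun _ _ _ _ in fX *.
have phX j : Lpi (phi (lacn M j)) by exact: phiX (lacn_gt0 j M0).
set S := ln (lacn M J)%:R.
have S1 : 1 <= S.
  by rewrite /S ln_lacn// -[leLHS]mulr1 ler_pM// exprn_ege1// ler1n.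
have N0 j : 0 < (lacn M j)%:R :> R by rewrite ltr0n lacn_gt0.
have N1 j : 1 <= (lacn M j)%:R :> R by rewrite ler1n lacn_gt0.
have normf : nrm f <= C2 * C0.
  have [_ h] := @lin_norm _ _ mu L p p1 J (lac_coef sg al M) _ phX.
  apply: (le_trans h).
  apply: (@le_trans _ _ (\sum_(j < J) lac_coef sg al M j * C0)).
    apply: ler_sum => j _; rewrite ger0_norm// ler_wpM2l//.
    by have [] := phiP (lacn_gt0 j M0).
  rewrite -mulr_suml ler_wpM2r//.
  have := hC2 M J 1 lM; rewrite ltr01 lexx => /(_ isT).
  rewrite ln1 subr0 min_l// powR1 mulr1; apply: le_trans; apply: ler_sum => j _.
  rewrite mul1r min_r// -[leRHS](powRr0 (lacn M j)%:R) ler_powR// oppr_le0 ltW//.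
have semif : (wsemi al b q (rmod al f) <=
    (C3 * (C1 * C2) * (1 + ln S) `^ inv_exponent q)%:E)%E.
  apply: hC3 => //.
  - exact: rmod_ge0_all (ltW al0) fX.
  - exact: rmod_nd (ltW al0) fX.
  - by rewrite mulr_ge0.
  - move=> t /andP[t0 t1]; rewrite -mulrA.
    apply: (@le_trans _ _ (C1 * \sum_(j < J) ln (lacn M j)%:R `^ sg *
        Num.min 1 ((t * (lacn M j)%:R) `^ (- al)))); last first.
      by rewrite ler_wpM2l//; apply: hC2 => //; rewrite t0 ltW.
    apply: (@le_trans _ _ (t `^ (- al) * (\sum_(j < J) lac_coef sg al M j *
        (C1 * Num.min 1 ((t * (lacn M j)%:R) `^ al))))).
      rewrite ler_wpM2l ?powR_ge0//.
      apply: (le_trans (lin_rmod TI p1 J _ (ltW al0) (ltW t0) phX)).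
      apply: ler_sum => j _; rewrite ger0_norm// ler_wpM2l//.
      by apply: hC1 => //; exact: lacn_gt0.
    rewrite !mulr_sumr; apply: ler_sum => j _.
    rewrite /lac_coef; set N := (lacn M j)%:R.
    have tN0 : 0 < t * N by exact: mulr_gt0 t0 (N0 j).
    have -> : t `^ (- al) * (ln N `^ sg * N `^ (- al) * (C1 * Num.min 1 ((t * N) `^ al))) =
      C1 * (ln N `^ sg * ((t * N) `^ (- al) * Num.min 1 ((t * N) `^ al))).
      by rewrite [(t * N) `^ (- al)]powRM ?(ltW t0)//; ring.
    rewrite ler_wpM2l// ler_wpM2l ?powR_ge0// le_min; apply/andP; split.
      rewrite powRN mulrC ler_pdivrMr ?powR_gt0// mul1r.
      by rewrite ge_min lexx orbT.
    by rewrite ler_piMr ?powR_ge0// ge_min lexx.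
rewrite /Lip_qnorm (Lip_seminormE TI p1 _ _ (ltW al0) fX) (Lp_normE fX) mulrDl EFinD.
apply: leeD => //; rewrite lee_fin; apply: (le_trans normf).
rewrite ler_peMr ?mulr_ge0// -[leLHS](powRr0 (1 + ln S)) ler_powR//.
  by rewrite lerDl ln_ge0.
by rewrite /inv_exponent; case: (q) q0 => [r|_|//]; rewrite ?fine_invr ?invey// lte_fin => /ltW; rewrite invr_ge0.
Qed.

(** As 2^k is at least 2^j + k - j. *)
Lemma lac_ratio M j k : (0 < M)%N -> (j <= k)%N ->
  (lacn M j * M ^ (k - j) <= lacn M k)%N.
Proof.
move=> M0 jk; rewrite /lacn -expnD; apply: leq_pexp2l => //.
rewrite -{2}(subnKC jk) expnD; set i := (k - j)%N.
have h1 : (0 < 2 ^ j)%N by rewrite expn_gt0.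
have h2 : (i < 2 ^ i)%N by exact: ltn_expl.
nia.
Qed.

(** At the step where the difference of the k-th term is large, lower
    frequencies are smooth and higher ones have small coefficients. Both
    effects give a factor th^|j - k|, with th small when M is large: two
    consecutive frequencies differ by a factor M at least, a power of which
    beats the constants. *)
Lemma lac_fun_lower al sg : 0 < al < m%:R -> 0 < sg -> exists c : R, 0 < c /\
  exists M0 : nat, forall M J k, (M0 <= M)%N -> (k < J)%N ->
    c * lac_coef sg al M k <= rmod m%:R (lac_fun sg al M J) (H / (lacn M k)%:R).
Proof.
move=> /andP[al0 alm] sg0; have m0 : 0 <= m%:R :> R by [].
have [D [D0 hD]] := difference_bound (L := L) TI p1 m0.
pose C3 := C0 * H ^+ m + D * C0.
have C30 : 0 <= C3 by rewrite addr_ge0 ?mulr_ge0 ?exprn_ge0 ?(ltW H0).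
(* the two-sided geometric sum is at most 4 th0, and this must leave half of c0 *)
pose th0 := Num.min 2^-1 (c0 / (8 * (C3 + 1))).
have C31 : 0 < C3 + 1 by rewrite ltr_wpDl.
have th00 : 0 < th0 by rewrite lt_min invr_gt0 ltr0n/= divr_gt0 ?mulr_gt0.
have e1 : 0 < m%:R - al by rewrite subr_gt0.
have [X1 [X11 hX1]] := pow_small e1 ler01 th00.
have [X2 [X21 hX2]] := pow_small al0 (powR_ge0 2 sg) th00.
exists (c0 / 2); split; first by rewrite divr_gt0.
exists (Num.truncn (X1 + X2 + H + expR 1)).+1 => M J k MM kJ.
have MR : X1 + X2 + H + expR 1 <= M%:R.
  have h0 : 0 <= X1 + X2 + H + expR 1.
    by rewrite !addr_ge0 ?expR_ge0 ?(ltW H0) ?(le_trans ler01).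
  have /andP[_ h] := Num.Theory.truncn_itv h0.
  by apply: (le_trans (ltW h)); rewrite ler_nat.
have [MX1 MX2 MH Me] : [/\ X1 <= M%:R, X2 <= M%:R, H <= M%:R & expR 1 <= M%:R :> R].
  have h1 := expR_gt0 (1 : R); have h2 := H0.
  by split; lra.
have M0' : 0 < M%:R :> R by apply: lt_le_trans Me; exact: expR_gt0.
have M0 : (0 < M)%N by rewrite -(ltr0n R).
have lM1 : 1 <= ln M%:R :> R by rewrite -[leLHS]expRK ler_ln ?posrE ?expR_gt0.
have th1 := hX1 _ MX1; have th2 := hX2 _ MX2; rewrite mul1r in th1.
have phX j : Lpi (phi (lacn M j)) by exact: phiX (lacn_gt0 j M0).
have fX := lac_funX sg al J M0.
have [_ _ _ [h [hH hc]]] := phiP (lacn_gt0 k M0).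
have Nk0 : 0 < (lacn M k)%:R :> R by rewrite ltr0n lacn_gt0.
have := @lin_difference_lower _ _ mu L p TI p1 J (lac_coef sg al M)
  (fun j => phi (lacn M j)) m%:R h (Ordinal kJ) m0 phX.
rewrite /= ger0_norm// => low.
have up : nrm (difference m%:R h (lac_fun sg al M J)) <=
    rmod m%:R (lac_fun sg al M J) (H / (lacn M k)%:R) by exact: (rmod_ub TI).
set kk := lac_coef sg al M k in low *.
have kk0 : 0 <= kk by exact: lac_coef_ge0.
have rest : \sum_(j < J | j != Ordinal kJ) `|lac_coef sg al M j| *
    nrm (difference m%:R h (phi (lacn M j))) <= C3 * (4 * th0) * kk.
  apply: (@le_trans _ _ (\sum_(j < J | j != k :> nat)
      C3 * kk * th0 ^+ ((k - j) + (j - k))%N)).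
    apply: ler_sum => j jk; rewrite ger0_norm//.
    have Nj0 : 0 < (lacn M j)%:R :> R by rewrite ltr0n lacn_gt0.
    have lnN i : ln (lacn M i)%:R = 2 ^+ i * ln M%:R :> R by exact: ln_lacn.
    have lM0 : 0 <= ln M%:R :> R by apply: le_trans lM1.
    have [_ _ fD _] := phiP (lacn_gt0 j M0).
    have [jk'|kj] := ltnP j k.
      (* lower frequencies are smoother: the m-th difference gains m - al *)
      have kjE : (j - k = 0)%N by apply/eqP; rewrite subn_eq0 ltnW.
      rewrite kjE addn0; set i := (k - j)%N.
      have ratio : (lacn M j)%:R * M%:R ^+ i <= (lacn M k)%:R :> R.
        by rewrite -natrX -natrM ler_nat; apply: lac_ratio => //; exact: ltnW.
      set x := (lacn M j)%:R in fD Nj0 ratio *; set y := (lacn M k)%:R in Nk0 hH ratio *.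
      have Mi0 : 0 < M%:R ^+ i :> R by rewrite exprn_gt0.
      have xy : x / y <= (M%:R ^+ i)^-1.
        rewrite ler_pdivrMr// mulrC ler_pdivlMr//.
      have xh : x * enorm h <= H * (x / y).
        rewrite [leRHS]mulrCA ler_pM2l//.
      have i0 : (0 < i)%N by rewrite subn_gt0.
      have xh1 : x * enorm h <= 1.
        apply: (le_trans xh); apply: (@le_trans _ _ (H * (M%:R ^+ i)^-1)).
          by rewrite ler_wpM2l// ltW.
        rewrite ler_pdivrMr// mul1r; apply: (le_trans MH).
        by rewrite -[leLHS]expr1 ler_weXn2l// ler1n.
      have step1 : nrm (difference m%:R h (phi (lacn M j))) <= C0 * H ^+ m * (x / y) ^+ m.
        apply: (le_trans (fD h xh1)); rewrite -mulrA -exprMn ler_wpM2l//.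
        rewrite lerXn2r ?nnegrE ?mulr_ge0 ?invr_ge0 ?(ltW Nj0) ?(ltW Nk0) ?(ltW H0)//.
        exact: sqrtr_ge0.
      apply: (@le_trans _ _ (lac_coef sg al M j * (C0 * H ^+ m * (x / y) ^+ m))).
        by rewrite ler_wpM2l.
      have xm : x `^ (- al) * (x / y) ^+ m = y `^ (- al) * (x / y) `^ (m%:R - al).
        have xy0 : 0 < x / y by rewrite divr_gt0.
        rewrite -powR_mulrn ?(ltW xy0)// -{1}(subrK al m%:R).
        rewrite powRD ?(gt_eqF xy0) ?implybT// mulrC -mulrA [LHS]mulrC; congr (_ * _).
        rewrite [(x / y) `^ al]powRM ?invr_ge0 ?(ltW Nj0) ?(ltW Nk0)//.
        rewrite mulrAC -powRD ?(gt_eqF Nj0) ?implybT// subrr powRr0 mul1r.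
        by rewrite powRN -powR_inv1 ?(ltW Nk0)// -powRrM mulN1r powRN.
      have -> : lac_coef sg al M j * (C0 * H ^+ m * (x / y) ^+ m) =
          C0 * H ^+ m * (ln x `^ sg * (x `^ (- al) * (x / y) ^+ m)).
        by rewrite /lac_coef -/x; ring.
      have -> : C3 * kk * th0 ^+ i = C3 * (ln y `^ sg * (y `^ (- al) * th0 ^+ i)).
        by rewrite /kk /lac_coef -/y; ring.
      rewrite xm; apply: ler_pM.
      - by rewrite mulr_ge0// exprn_ge0// ltW.
      - by rewrite !mulr_ge0 ?powR_ge0.
      - by rewrite /C3 lerDl mulr_ge0.
      apply: ler_pM; rewrite ?mulr_ge0 ?powR_ge0//.
        rewrite ge0_ler_powR ?(ltW sg0) ?nnegrE//.
        + by rewrite /x lnN mulr_ge0// exprn_ge0.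
        + by rewrite /y lnN mulr_ge0// exprn_ge0.
        + by rewrite /x /y !lnN ler_wpM2r// ler_weXn2l ?ler1n// ltnW.
      rewrite ler_wpM2l ?powR_ge0//.
      apply: (@le_trans _ _ ((M%:R ^+ i)^-1 `^ (m%:R - al))).
        rewrite ge0_ler_powR ?(ltW e1) ?nnegrE ?invr_ge0 ?(ltW Mi0)//.
        by rewrite divr_ge0 ?(ltW Nj0) ?(ltW Nk0).
      have -> : (M%:R ^+ i)^-1 `^ (m%:R - al) = (M%:R `^ (- (m%:R - al))) ^+ i :> R.
        rewrite -powR_inv1 ?(ltW Mi0)// -powRrM mulN1r -!powR_mulrn ?powR_ge0 ?(ltW M0')//.
        by rewrite -!powRrM mulrC.
      by rewrite lerXn2r ?nnegrE ?powR_ge0 ?(ltW th00)// ltW.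
    (* higher frequencies have a much smaller coefficient *)
    have kjE : (k - j = 0)%N by apply/eqP; rewrite subn_eq0.
    rewrite kjE add0n; set i := (j - k)%N.
    have ratio : (lacn M k)%:R * M%:R ^+ i <= (lacn M j)%:R :> R.
      by rewrite -natrX -natrM ler_nat; exact: lac_ratio.
    have lnE : ln (lacn M j)%:R = 2 ^+ i * ln (lacn M k)%:R :> R.
      by rewrite !lnN mulrA -exprD subnK.
    have lnk0 : 0 <= ln (lacn M k)%:R :> R by rewrite lnN mulr_ge0// exprn_ge0.
    apply: (@le_trans _ _ (lac_coef sg al M j * C3)).
      rewrite ler_wpM2l//; have [_ hn] := hD h _ (phX j).
      apply: (le_trans hn); apply: (@le_trans _ _ (D * C0)).
        by rewrite ler_wpM2l//; have [] := phiP (lacn_gt0 j M0).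
      by rewrite /C3 lerDr mulr_ge0// exprn_ge0// ltW.
    rewrite mulrC -mulrA ler_wpM2l// /kk /lac_coef lnE.
    rewrite powRM ?exprn_ge0//.
    have -> : (2 ^+ i) `^ sg = (2 `^ sg) ^+ i :> R.
      by rewrite -!powR_mulrn ?powR_ge0// -!powRrM mulrC.
    have Nal : (lacn M j)%:R `^ (- al) <= (lacn M k)%:R `^ (- al) * (M%:R `^ (- al)) ^+ i.
      apply: (@le_trans _ _ (((lacn M k)%:R * M%:R ^+ i) `^ (- al))).
        rewrite !powRN lef_pV2 ?posrE ?powR_gt0 ?mulr_gt0 ?exprn_gt0//.
        rewrite ge0_ler_powR ?(ltW al0) ?nnegrE ?mulr_ge0 ?exprn_ge0 ?(ltW Nk0) ?(ltW Nj0)//.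
      rewrite powRM ?(ltW Nk0) ?exprn_ge0 ?(ltW M0')// ler_wpM2l ?powR_ge0//.
      by rewrite -!powR_mulrn ?powR_ge0 ?(ltW M0')// -!powRrM mulrC.
    apply: (@le_trans _ _ ((2 `^ sg) ^+ i * ln (lacn M k)%:R `^ sg *
        ((lacn M k)%:R `^ (- al) * (M%:R `^ (- al)) ^+ i))).
      by rewrite ler_wpM2l// mulr_ge0 ?powR_ge0// exprn_ge0// powR_ge0.
    have -> : (2 `^ sg) ^+ i * ln (lacn M k)%:R `^ sg *
        ((lacn M k)%:R `^ (- al) * (M%:R `^ (- al)) ^+ i) =
      ln (lacn M k)%:R `^ sg * (lacn M k)%:R `^ (- al) * (2 `^ sg * M%:R `^ (- al)) ^+ i.
      by rewrite exprMn; ring.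
    rewrite ler_wpM2l ?mulr_ge0 ?powR_ge0// lerXn2r ?nnegrE ?mulr_ge0 ?powR_ge0 ?(ltW th00)//.
    exact: ltW.
  have th0h : 0 <= th0 <= 2^-1 by rewrite (ltW th00)/= /th0 ge_min lexx.
  rewrite -mulr_sumr [leLHS]mulrAC ler_wpM2r// ler_wpM2l//.
  exact: two_sided_geometric.
have sm : C3 * (4 * th0) <= c0 / 2.
  have h8 : th0 <= c0 / (8 * (C3 + 1)) by rewrite /th0 ge_min lexx orbT.
  have h9 : th0 * (8 * (C3 + 1)) <= c0 by rewrite -ler_pdivlMr// mulr_gt0.
  have : 0 <= th0 by exact: ltW.
  lra.
have h1 : C3 * (4 * th0) * kk <= c0 / 2 * kk by rewrite ler_wpM2r.
have h2 : kk * c0 <= kk * nrm (difference m%:R h (phi (lacn M k))) by rewrite ler_wpM2l.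
lra.
Qed.

End necessity.

(** * Homogeneity and growth *)

Section homogeneity.
Context {R : realType} {d : nat}.
Variables (mu : {measure set (space R d) -> \bar R}) (L : set (space R d)) (p : R).
Hypothesis TI : translation_invariant mu L.
Hypothesis p1 : 1 <= p.
Implicit Types (f g : space R d -> R[i]) (h x : space R d) (a b t u K : R).

Local Notation Lpi := (Lpi mu L p).
Local Notation nrm := (nrm mu p).
Local Notation rmod := (rmod mu p).

Lemma wsemi_scale a b (q : \bar R) (w : R -> R) c K : (forall t, 0 <= w t) ->
  nondecreasing_fun w -> (0 < q)%E -> 0 < c -> 0 <= K ->
  (wsemi a b q w <= K%:E)%E -> (wsemi a b q (fun t => (c * w t)%R) <= (c * K)%:E)%E.
Proof.
move=> w0 wnd q0 c0 K0.
have wE t : wfun a b (fun t => c * w t) t = c * wfun a b w t by rewrite /wfun mulrCA.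
case: q q0 => [r|_|//].
  rewrite lte_fin => r0 /(wsemi_leP a w b r0 K0) h.
  apply/(wsemi_leP a _ b r0 (mulr_ge0 (ltW c0) K0)).
  under eq_integral => t _ do
    rewrite wE powRM ?wfun_ge0 ?(ltW c0)// -mulrA EFinM.
  rewrite ge0_integralZl_EFin ?powR_ge0//.
  - by rewrite powRM ?(ltW c0)// EFinM lee_wpmul2l// lee_fin powR_ge0.
  - by move=> t; exact: integrand_ge0.
  - exact: measurable_integrand.
rewrite /wsemi => h; apply: ge_ereal_sup => _ [t t01 <-].
rewrite wE lee_fin ler_wpM2l ?(ltW c0)// -lee_fin.
by apply: le_trans h; apply: ereal_sup_ubound; exists t.
Qed.

Lemma rmod_scale a f c : 0 <= a -> 0 < c -> Lpi f ->
  rmod a (cscale c f) = (fun t => c * rmod a f t).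
Proof.
move=> a0 c0 fX; have [cX _] := Lpi_cscale p1 c fX.
apply/funext => t; have [t0|t0] := leP 0 t; last by rewrite !modulus_lt0// mulr0.
apply/eqP; rewrite eq_le; apply/andP; split.
  apply: (rmod_le TI p1) => // h ht.
  rewrite (nrm_difference_scale TI p1)// gtr0_norm// ler_pM2l//.
  exact: (rmod_ub TI p1 a0 fX ht).
rewrite mulrC -ler_pdivlMr//; apply: (rmod_le TI p1) => // h ht.
rewrite ler_pdivlMr// mulrC -[c in leLHS](gtr0_norm c0) -(nrm_difference_scale TI p1)//.
exact: (rmod_ub TI p1 a0 cX ht).
Qed.

Lemma Lip_qnorm_scale a b (q : \bar R) f c K : 0 <= a -> (0 < q)%E -> 0 < c -> Lpi f ->
  (Lip_qnorm mu a b p q f <= K%:E)%E ->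
  (Lip_qnorm mu a b p q (cscale c f) <= (c * K)%:E)%E.
Proof.
move=> a0 q0 c0 fX h; have [cX cE] := Lpi_cscale p1 c fX.
have [nK _] := Lip_qnorm_le TI p1 a0 fX h.
have h' : (wsemi a b q (rmod a f) <= (K - nrm f)%:E)%E.
  move: h; rewrite /Lip_qnorm (Lip_seminormE TI p1 _ _ a0 fX) (Lp_normE fX).
  by rewrite EFinB leeBrDl.
rewrite /Lip_qnorm (Lip_seminormE TI p1 _ _ a0 cX) (Lp_normE cX) cE gtr0_norm//.
have -> : c * K = c * nrm f + c * (K - nrm f) by ring.
rewrite EFinD leeD2l// rmod_scale//; apply: wsemi_scale => //.
- exact: (rmod_ge0_all TI p1 a0 fX).
- exact: (rmod_nd TI p1 a0 fX).
- by rewrite subr_ge0.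
Qed.

(** By homogeneity, continuity at 0 is a bound. Restricting to K at least 1
    avoids dividing by a quasi-norm that may vanish. *)
Lemma bounded_inclusion a0 a1 b0 b1 (q0 q1 : \bar R) : 0 <= a0 -> 0 <= a1 ->
  (0 < q0)%E -> (0 < q1)%E ->
  continuous_inclusion (LipX mu L p a0 b0 q0) (Lip_qnorm mu a0 b0 p q0)
                       (LipX mu L p a1 b1 q1) (Lip_qnorm mu a1 b1 p q1) ->
  (exists f, Lpi f) ->
  exists B : R, 0 <= B /\ forall f K, Lpi f -> 1 <= K ->
    (Lip_qnorm mu a0 b0 p q0 f <= K%:E)%E -> (Lip_qnorm mu a1 b1 p q1 f <= (B * K)%:E)%E.
Proof.
move=> a00 a10 q00 q10 [_ cont] [g gX].
pose z : space R d -> R[i] := cscale 0 g.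
have [zX zE] := Lpi_cscale p1 0 gX.
have zA : LipX mu L p a0 b0 q0 z.
  split => //; apply: (@le_lt_trans _ _ 0%:E); last exact: ltry.
  rewrite /Lip_qnorm (Lip_seminormE TI p1 _ _ a00 zX) (Lp_normE zX) zE normr0 mul0r add0e.
  have -> : rmod a0 z = (fun=> 0).
    apply/funext => t; have [t0|t0] := leP 0 t; last by rewrite modulus_lt0.
    apply/eqP; rewrite eq_le (rmod_ge0 TI p1 a00 zX t0) andbT.
    apply: (rmod_le TI p1 a00 zX t0) => h _.
    by rewrite (nrm_difference_scale TI p1)// normr0 mul0r.
  case: (q0) q00 => [r|_|//].
    rewrite lte_fin => r0; apply/(wsemi_leP a0 _ b0 r0 (lexx 0)).
    rewrite powR0 ?gt_eqF// integral0_eq// => t _.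
    by rewrite /wfun mulr0 powR0 ?gt_eqF// mul0r.
  by rewrite /wsemi; apply: ge_ereal_sup => _ [t _ <-]; rewrite /wfun mulr0.
have [dl dl0 hdl] := cont z zA 1 ltr01.
exists (2 / dl); split; first by rewrite divr_ge0// ltW.
move=> f K fX K1 fK; have K0 : 0 < K by apply: lt_le_trans K1.
pose c := dl / (2 * K); have c0 : 0 < c by rewrite divr_gt0// mulr_gt0.
have [cX _] := Lpi_cscale p1 c fX.
have cK := Lip_qnorm_scale a00 q00 c0 fX fK.
have cz : (fun x => cscale c f x - z x) = cscale c f.
  by apply/funext => x; rewrite /z /cscale !mul0r subr0.
have cKE : c * K = dl / 2 by rewrite /c; field; rewrite gt_eqF.
have lt : (Lip_qnorm mu a0 b0 p q0 (cscale c f) < dl%:E)%E.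
  by apply: (le_lt_trans cK); rewrite cKE lte_fin; lra.
have := hdl (cscale c f); rewrite cz => /(_ _ lt) h1.
have cA : LipX mu L p a0 b0 q0 (cscale c f).
  by split => //; apply: (lt_trans lt); exact: ltry.
have ci0 : 0 < c^-1 by rewrite invr_gt0.
have := Lip_qnorm_scale a10 q10 ci0 cX (ltW (h1 cA)).
have -> : cscale c^-1 (cscale c f) = f.
  apply/funext => x; rewrite /cscale/= !mulKf ?gt_eqF//.
  by case: (f x).
by move/le_trans; apply; rewrite lee_fin mulr1 /c invf_div mulrAC.
Qed.

End homogeneity.

Section growth.
Context {R : realType}.
Implicit Types (e dl rho A c X l : R).

(** Any positive power of l, and a fortiori an exponential, beats a power of
    the logarithm of l. *)
Lemma growth e dl rho A c : (0 < e \/ e = 0 /\ 0 < dl) -> 0 <= rho -> 0 <= A -> 0 < c ->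
  exists X, 1 <= X /\ forall l, X <= l ->
    A * (1 + ln (2 * l)) `^ rho < c * expR (e * l) * l `^ dl.
Proof.
move=> hyp rho0 A0 c0.
have [tau [tau0 [D [D0 hD]]]] : exists tau, 0 < tau /\ exists D, 0 < D /\
    forall l, 1 <= l -> l `^ tau <= D * (expR (e * l) * l `^ dl).
  case: hyp => [e0|[-> dl0]]; last first.
    by exists dl; split => //; exists 1; split => // l _; rewrite mul0r expR0 !mul1r.
  exists 1; split => //.
  have s0 : 0 < 1 + `|dl| by rewrite ltr_wpDr.
  have [C [C1 hC]] := one_add_pow_le_exp s0 e0.
  have C0 : 0 < C by apply: lt_le_trans C1.
  exists C; split => // l l1; have l0 : 0 < l by apply: lt_le_trans l1.
  rewrite mulrA; apply: (@le_trans _ _ (l `^ (1 + `|dl|) * l `^ dl)).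
    rewrite -powRD ?(gt_eqF l0) ?implybT// ler_powR//.
    by have := ler_norm (- dl); rewrite normrN; lra.
  rewrite ler_wpM2r ?powR_ge0//; apply: le_trans (hC l (ltW l0)).
  by rewrite ge0_ler_powR ?(ltW s0) ?nnegrE ?addr_ge0 ?(ltW l0)// lerDr.
have rho1 : 0 < rho + 1 by rewrite ltr_wpDl.
have tau2 : 0 < tau / 2 by rewrite divr_gt0.
have [E [E0 hE]] := log_le_pow rho1 tau2.
have AE0 : 0 <= A * E * 2 `^ (tau / 2) by rewrite !mulr_ge0 ?powR_ge0.
have cD0 : 0 < c / D by rewrite divr_gt0.
have [X [X1 hX]] := pow_small tau2 AE0 cD0.
exists X; split => // l Xl; have l1 : 1 <= l by apply: le_trans Xl.
have l0 : 0 < l by apply: lt_le_trans l1.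
have h1 : (1 + ln (2 * l)) `^ rho <= E * (2 `^ (tau / 2) * l `^ (tau / 2)).
  have t01 : 0 < (2 * l)^-1 < 1.
    by rewrite invr_gt0 mulr_gt0//= invf_lt1 ?mulr_gt0//; lra.
  have := hE _ t01; rewrite lnV ?posrE ?mulr_gt0// opprK powRN.
  have -> : ((2 * l)^-1 `^ (tau / 2))^-1 = 2 `^ (tau / 2) * l `^ (tau / 2).
    by rewrite -powRM ?(ltW l0)// -powRN -powR_inv1 ?mulr_ge0 ?(ltW l0)// -powRrM mulN1r opprK.
  apply: le_trans; apply: ler_powR; last by rewrite lerDl.
  by rewrite lerDl ln_ge0//; lra.
apply: (@le_lt_trans _ _ (A * E * 2 `^ (tau / 2) * l `^ (tau / 2))).
  by apply: le_trans (ler_wpM2l A0 h1) _; rewrite !mulrA.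
apply: (@lt_le_trans _ _ (c / D * l `^ tau)).
  have -> : l `^ tau = l `^ (tau / 2) * l `^ (tau / 2).
    by rewrite -powRD ?(gt_eqF l0) ?implybT// -splitr.
  rewrite mulrA ltr_pM2r ?powR_gt0//; have := hX l Xl.
  by rewrite powRN ltr_pdivrMr ?powR_gt0.
by rewrite mulrAC ler_pdivrMr// -!mulrA ler_wpM2l ?(ltW c0)// mulrA mulrC; exact: hD.
Qed.

End growth.

(** * Necessity of the conditions *)

Section necessity_theorem.
Context {R : realType} {d : nat}.
Variables (mu : {measure set (space R d) -> \bar R}) (L : set (space R d)) (p : R).
Hypothesis TI : translation_invariant mu L.
Hypothesis p1 : 1 <= p.
Implicit Types (f g : space R d -> R[i]) (h x : space R d) (a b t u K : R).

Local Notation Lpi := (Lpi mu L p).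
Local Notation nrm := (nrm mu p).
Local Notation rmod := (rmod mu p).

Variables (m : nat) (phi : nat -> space R d -> R[i]) (a0 a1 b0 b1 B : R) (q0 q1 : \bar R).
Hypotheses (ha0 : 0 < a0 < m%:R) (ha1 : 0 < a1 < m%:R).
Hypotheses (hq0 : (0 < q0)%E) (hq1 : (0 < q1)%E).
Hypotheses (hb0 : inv_exponent q0 < b0) (hb1 : inv_exponent q1 < b1).
Hypothesis phiP : test_family mu L p m phi.
Hypothesis B0 : 0 <= B.
Hypothesis hB : forall f K, Lpi f -> 1 <= K ->
  (Lip_qnorm mu a0 b0 p q0 f <= K%:E)%E -> (Lip_qnorm mu a1 b1 p q1 f <= (B * K)%:E)%E.

Let s0 := b0 - inv_exponent q0.
Let s1 := b1 - inv_exponent q1.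

Lemma inv_exponent_ge0 (q : \bar R) : (0 < q)%E -> 0 <= inv_exponent q.
Proof.
case: q => [r|_|//]; rewrite /inv_exponent ?invey//.
by rewrite lte_fin fine_invr invr_ge0 => /ltW.
Qed.

(** The effect of the inclusion on lacunary sums: an upper bound from the first
    space, and a lower bound on the modulus of order a1, obtained from the one
    of order m since moduli of higher order are smaller. *)
Let lacunary_test : exists C c H : R, exists M0 : nat, [/\ 0 <= C, 0 < c, 1 <= H &
  forall M J, (M0 <= M)%N -> 1 <= ln M%:R :> R -> let f := lac_fun phi s0 a0 M J in
  [/\ Lpi f, 1 <= C * (1 + ln (ln (lacn M J)%:R)) `^ inv_exponent q0,
    (Lip_qnorm mu a1 b1 p q1 f <=
       (B * (C * (1 + ln (ln (lacn M J)%:R)) `^ inv_exponent q0))%:E)%E &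
    forall k, (k < J)%N ->
      c * lac_coef s0 a0 M k <= rmod a1 f (H / (lacn M k)%:R)]].
Proof.
have [C0 [c0 [H [C00 c00 H1 phP]]]] := phiP.
have [C [C0' hC]] := lac_fun_upper TI p1 C00 phP ha0 hq0 hb0.
have sg0 : 0 < s0 by rewrite subr_gt0.
have [c [c0' [M0 hM]]] := lac_fun_lower TI p1 C00 c00 H1 phP ha0 sg0.
have [a10 a1m] := andP ha1.
have a1m' : 0 <= a1 <= m%:R by rewrite !ltW.
have [D [D0 hD]] := rmod_mono_order TI p1 a1m'.
have D1 : 0 < D + 1 by rewrite ltr_wpDl.
exists (C + 1), (c / (D + 1)), H, M0; split => //; first by rewrite addr_ge0.
  by rewrite divr_gt0.
move=> M J M0M lM f.
have M1 : (0 < M)%N by case: (M) lM => //; rewrite ln0// ler10.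
have S1 : 1 <= ln (lacn M J)%:R :> R.
  by rewrite ln_lacn// -[leLHS]mulr1 ler_pM// exprn_ege1// ler1n.
have P1 : 1 <= (1 + ln (ln (lacn M J)%:R : R)) `^ inv_exponent q0.
  rewrite -[leLHS](powRr0 (1 + ln (ln (lacn M J)%:R : R))) ler_powR//.
    by rewrite lerDl ln_ge0.
  exact: inv_exponent_ge0.
have fX : Lpi f by apply: (lac_funX p1 phP).
have K1 : 1 <= (C + 1) * (1 + ln (ln (lacn M J)%:R)) `^ inv_exponent q0.
  by rewrite -[leLHS]mulr1 ler_pM// lerDr.
split => //.
  apply: hB => //; apply: (le_trans (hC M J lM)).
  by rewrite lee_fin ler_wpM2r ?powR_ge0// lerDl.
move=> k kJ; have := hM M J k M0M kJ; rewrite -/f => h1.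
have Nk0 : 0 < (lacn M k)%:R :> R by rewrite ltr0n lacn_gt0.
have t0 : 0 <= H / (lacn M k)%:R by rewrite divr_ge0 ?(ltW Nk0) ?(le_trans ler01).
rewrite mulrAC ler_pdivrMr//; apply: (le_trans h1); apply: (le_trans (hD f _ fX t0)).
by rewrite mulrC ler_wpM2l ?(rmod_ge0 TI p1 (ltW a10))// lerDl.
Qed.

Lemma ln_nat_large (M : nat) (H : R) : 1 <= H -> H <= M%:R -> 0 <= ln H <= (ln M%:R : R).
Proof.
move=> H1 HM; have H0 : 0 < H by apply: lt_le_trans H1.
by rewrite ln_ge0//= ler_ln ?posrE// (lt_le_trans H0).
Qed.

(** A single frequency M suffices: its quasi-norm in the second space, read off
    at t = H / M, is too large as M grows. *)
Lemma necessary_order : ~ (a0 < a1 \/ a0 = a1 /\ s1 < s0).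
Proof.
move=> hyp; have [C [c [H [M0 [C0 c0 H1 hM]]]]] := lacunary_test.
have H0 : 0 < H by apply: lt_le_trans H1.
have [a10 _] := andP ha1.
have [D [D0 hD]] := pointwise_bound TI p1 (ltW a10) hq1 hb1.
have rho0 := inv_exponent_ge0 hq0.
have sg1 : 0 < s1 by rewrite subr_gt0.
(* compared with the lower bound e M^(a1 - a0) l^(s0 - s1), for l = ln M *)
pose A := D * (B * C).
have A0 : 0 <= A by rewrite !mulr_ge0.
pose e := c * H `^ (- a1) * 2 `^ (- s1).
have e0 : 0 < e by rewrite !mulr_gt0 ?powR_gt0.
have hyp' : 0 < a1 - a0 \/ a1 - a0 = 0 /\ 0 < s0 - s1.
  by case: hyp => [h|[-> h]]; [left|right; split]; rewrite ?subr_gt0 ?subrr.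
have [X [X1 hX]] := growth hyp' rho0 A0 e0.
have [M [MM XM]] := ln_unbounded (Num.max X (ln (H + 1))) M0.
have [XM1 HM] : X <= ln M%:R /\ ln (H + 1) <= ln M%:R :> R.
  by move: XM; rewrite ge_max => /andP[].
have lM : 1 <= ln M%:R :> R by apply: le_trans XM1.
have M1 : (0 < M)%N by case: (M) lM => //; rewrite ln0// ler10.
have MR : 0 < M%:R :> R by rewrite ltr0n.
have HM' : H + 1 <= M%:R by rewrite -ler_ln ?posrE// ltr_wpDl// ltW.
have [fX K1 fB low] := hM M 1%N MM lM.
have := low 0%N (ltn0Sn 0); set f := lac_fun _ _ _ _ _ in fX fB low *.
have E0 : lacn M 0 = M by rewrite /lacn expn0 expn1.
rewrite /lac_coef E0 => low0.
have lE : ln (lacn M 1)%:R = 2 * ln M%:R :> R by rewrite ln_lacn// expr1.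
rewrite lE in K1 fB.
have BK0 : 0 <= B * (C * (1 + ln (2 * ln M%:R)) `^ inv_exponent q0).
  by rewrite mulr_ge0// (le_trans ler01).
have t01 : 0 < H / M%:R < 1.
  by rewrite divr_gt0//= ltr_pdivrMr// mul1r; apply: lt_le_trans HM'; rewrite ltrDl.
have [t0 t1] := andP t01.
have := hD f _ fX BK0 fB _ t01; rewrite -/s1.
have := hX (ln M%:R) XM1; rewrite /wfun.
set l := ln M%:R in lM low0 lE XM1 HM *.
have l0 : 0 < l by apply: lt_le_trans lM.
have lt : 1 - ln (H / M%:R) <= 2 * l.
  have HM2 : H <= M%:R by apply: le_trans HM'; rewrite lerDl.
  have /andP[h1 h2] := ln_nat_large H1 HM2.
  rewrite ln_div ?posrE// -/l; lra.
have u1 := one_sub_ln_ge1 (ltW t1).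
have u0 : 0 < 1 - ln (H / M%:R) by apply: lt_le_trans u1.
have w1 : 2 `^ (- s1) * l `^ (- s1) <= (1 - ln (H / M%:R)) `^ (- s1).
  rewrite -powRM ?(ltW l0)// !powRN lef_pV2 ?posrE ?powR_gt0 ?mulr_gt0//.
  by rewrite ge0_ler_powR ?(ltW sg1) ?nnegrE ?(ltW u0) ?mulr_ge0 ?(ltW l0).
have w2 : (H / M%:R) `^ (- a1) = H `^ (- a1) * M%:R `^ a1.
  rewrite powRM ?(ltW H0) ?invr_ge0 ?(ltW MR)//; congr (_ * _).
  by rewrite -powR_inv1 ?(ltW MR)// -powRrM mulN1r opprK.
have ME r : M%:R `^ r = expR (r * l) by rewrite /powR gt_eqF.
rewrite w2 => lt1 lt2.
have : e * expR ((a1 - a0) * l) * l `^ (s0 - s1) <=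
    H `^ (- a1) * M%:R `^ a1 * (1 - ln (H / M%:R)) `^ (- s1) * rmod a1 f (H / M%:R).
  have -> : e * expR ((a1 - a0) * l) * l `^ (s0 - s1) =
    H `^ (- a1) * M%:R `^ a1 * (2 `^ (- s1) * l `^ (- s1)) * (c * (l `^ s0 * M%:R `^ (- a0))).
    rewrite mulrBl expRD -ME -mulNr -ME powRD ?(gt_eqF l0) ?implybT// /e; ring.
  apply: ler_pM => //.
  - by rewrite !mulr_ge0 ?powR_ge0.
  - by rewrite !mulr_ge0 ?powR_ge0 ?(ltW c0).
  - by rewrite ler_wpM2l// mulr_ge0 ?powR_ge0.
move=> /le_trans/(_ lt2); apply/negP; rewrite -ltNge; move: lt1; congr (_ < _).
by rewrite /A !mulrA.
Qed.

Lemma ratio_lt1 (r : R) : 0 < r -> (r%:E < q0)%E -> 0 <= r * inv_exponent q0 < 1.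
Proof.
move=> r0 rq; rewrite mulr_ge0 ?(ltW r0) ?inv_exponent_ge0//=.
case: q0 hq0 rq => [s|_ _|//]; last by rewrite /inv_exponent invey/= mulr0.
by rewrite !lte_fin /inv_exponent fine_invr => s0' rs; rewrite ltr_pdivrMr// mul1r.
Qed.

Lemma ladder (u : nat -> R) J t : u J <= t <= u 0%N -> (0 < J)%N ->
  exists k, (k < J)%N /\ u k.+1 <= t <= u k.
Proof.
elim: J => // J IH /andP[uJ u0] _.
have [uJt|tuJ] := leP (u J) t; last by exists J; rewrite uJ ltW.
have [J0|J0] := posnP J.
  by rewrite J0 in uJ uJt *; exists 0%N; rewrite uJ u0.
have [|k [kJ hk]] := IH _ J0; first by rewrite uJt u0.
by exists k; rewrite (leq_trans kJ).
Qed.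

(** The modulus of the lacunary sum has the critical size on the whole range of
    scales between 1/N_J and 1/N_0, so the second quasi-norm to the power r is
    at least of size Y = 1 + log log N_J, while the first one to the power r is
    at most of size Y^(r / q0). As r < q0, letting J grow gives a
    contradiction. *)
Lemma necessary_summability : ~ [/\ a0 = a1, s0 = s1 & (q1 < q0)%E].
Proof.
move=> [aE + q10]; rewrite /s1 => sE; have [C [c [H [M0 [C0 c0 H1 hM]]]]] := lacunary_test.
case: q1 hq1 q10 (hb1) sE (fun f K => @Lip_qnorm_le _ _ _ _ _ TI p1 a1 b1 q1 f K) hM
  => [r|_|//]; last by rewrite ltNge leey.
rewrite lte_fin => r0 rq hbr sE Lle hM.
have sE' : b1 - r^-1 = s0 by rewrite sE /inv_exponent fine_invr.
have H0 : 0 < H by apply: lt_le_trans H1.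
have [a10 _] := andP ha1.
have sg0 : 0 < s0 by rewrite subr_gt0.
have [A [A0 hA]] := rmod_almost_decreasing TI p1 (ltW a10).
have A1 : 0 < A + 1 by rewrite ltr_wpDl.
(* M stays fixed, and the number J of frequencies grows *)
have [M [MM XM]] := ln_unbounded (Num.max 1 (ln (H + 1))) M0.
have [lM HM] : 1 <= ln M%:R :> R /\ ln (H + 1) <= ln M%:R :> R.
  by move: XM; rewrite ge_max => /andP[].
have M1 : (0 < M)%N by case: (M) lM => //; rewrite ln0// ler10.
have MR : 0 < M%:R :> R by rewrite ltr0n.
have HM' : H + 1 <= M%:R by rewrite -ler_ln ?posrE// ltr_wpDl// ltW.
have HM2 : H <= M%:R by apply: le_trans HM'; rewrite lerDl.
have /andP[lH0 lHM] := ln_nat_large H1 HM2.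
have M2 : (1 < M)%N by rewrite -(ltr_nat R); apply: lt_le_trans HM'; rewrite ltrDr.
pose l : R := ln M%:R; pose s k : R := 2 ^+ k * l.
have l1 : 1 <= l by [].
have sl k : l <= s k by rewrite /s ler_peMl ?exprn_ege1 ?ler1n// (le_trans ler01).
have N0 k : 0 < (lacn M k)%:R :> R by rewrite ltr0n lacn_gt0.
pose tt k : R := H / (lacn M k)%:R.
have t0 k : 0 < tt k by rewrite divr_gt0.
have lnt k : 1 - ln (tt k) = 1 + s k - ln H.
  by rewrite /tt ln_div ?posrE// ln_lacn// -/l -/(s k); ring.
have tt01 : tt 0%N < 1.
  rewrite /tt /lacn expn0 expn1 ltr_pdivrMr// mul1r.
  by apply: lt_le_trans HM'; rewrite ltrDl.
pose kap := c / (A + 1) * H `^ (- a1) * 3 `^ (- s0).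
have kap0 : 0 < kap by rewrite !mulr_gt0 ?powR_gt0 ?invr_gt0.
(* the modulus is large on the whole range of scales up to the last frequency *)
have lower J : (0 < J)%N -> forall t, tt J <= t <= tt 0%N ->
    kap * (1 - ln t) `^ s0 <= t `^ (- a1) * rmod a1 (lac_fun phi s0 a0 M J) t.
  move=> J0 t tJ; have [k [kJ /andP[tk1 tk]]] := ladder tJ J0.
  have [fX _ _ low] := hM M J MM lM; have := low k kJ.
  set f := lac_fun _ _ _ _ _ in fX low * => lowk.
  have tp : 0 < t by apply: lt_le_trans (t0 k.+1) tk1.
  have tt1 : t <= 1 by apply: le_trans (andP tJ).2 (ltW tt01).
  have up := hA f t (tt k) fX tp tk.
  have f0 : 0 <= rmod a1 f t by rewrite (rmod_ge0 TI p1 (ltW a10) fX) ?(ltW tp).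
  have logt : 1 - ln t <= 3 * s k.
    apply: (@le_trans _ _ (1 - ln (tt k.+1))); first by rewrite lerB// ler_ln ?posrE.
    rewrite lnt; have -> : s k.+1 = 2 * s k by rewrite /s exprS mulrA.
    have := sl k; have := l1; have := lH0; lra.
  have u1 := one_sub_ln_ge1 tt1.
  have u0 : 0 <= 1 - ln t by apply: le_trans u1.
  have sk0 : 0 <= s k by apply: le_trans (sl k); apply: le_trans l1.
  have w1 : (1 - ln t) `^ s0 <= 3 `^ s0 * s k `^ s0.
    rewrite -powRM// ge0_ler_powR ?(ltW sg0) ?nnegrE//.
    exact: mulr_ge0.
  have w2 : (tt k / t) `^ a1 = H `^ a1 * (lacn M k)%:R `^ (- a1) * t `^ (- a1).
    rewrite powRM ?invr_ge0 ?(ltW tp) ?(ltW (t0 k))// /tt powRM ?invr_ge0 ?(ltW H0) ?(ltW (N0 k))//.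
    by rewrite -!powR_inv1 ?(ltW tp) ?(ltW (N0 k))// -!powRrM !mulN1r.
  have w3 : c * (s k `^ s0 * (lacn M k)%:R `^ (- a1)) <=
      (A + 1) * (H `^ a1 * (lacn M k)%:R `^ (- a1) * t `^ (- a1)) * rmod a1 f t.
    apply: (@le_trans _ _ (rmod a1 f (tt k))).
      by move: lowk; rewrite /lac_coef ln_lacn// -/l -/(s k) aE.
    apply: (le_trans up); rewrite w2 ler_wpM2r// ler_wpM2r ?lerDl//.
    by rewrite !mulr_ge0 ?powR_ge0.
  have w4 : c * s k `^ s0 <= (A + 1) * H `^ a1 * (t `^ (- a1) * rmod a1 f t).
    rewrite -(ler_pM2r (powR_gt0 (- a1) (N0 k))); apply: le_trans (le_trans _ w3) _.
      by rewrite mulrA.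
    by rewrite le_eqVlt; apply/orP; left; apply/eqP; ring.
  apply: (@le_trans _ _ (kap * (3 `^ s0 * s k `^ s0))); first by rewrite ler_wpM2l// ltW.
  have -> : kap * (3 `^ s0 * s k `^ s0) = (c * s k `^ s0) / ((A + 1) * H `^ a1).
    rewrite /kap !powRN; field.
    by rewrite !gt_eqF ?powR_gt0.
  by rewrite ler_pdivrMr ?mulr_gt0 ?powR_gt0// [leRHS]mulrC.
pose th := r * inv_exponent q0.
have /andP[th0 th1] := ratio_lt1 r0 rq; rewrite -/th in th0 th1.
pose Dl := ln (1 - ln (tt 0%N)).
pose E := (B * C) `^ r.
have e1 : 0 < 1 - th by rewrite subr_gt0.
have kr0 : 0 < kap `^ r / 2 by rewrite divr_gt0// powR_gt0.
have [X [X1 hX]] := pow_small e1 (powR_ge0 (B * C) r) kr0.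
have ln2 : 0 < ln 2 :> R by rewrite ln_gt0// ltr1n.
have Q0 : 0 <= (X + 2 * (2 + `|Dl|)) / ln 2.
  by rewrite divr_ge0 ?(ltW ln2)// addr_ge0 ?mulr_ge0 ?addr_ge0// (le_trans ler01).
have /andP[_ hJ] := Num.Theory.truncn_itv Q0.
set J := (Num.truncn _).+1 in hJ.
pose Y := 1 + ln (s J).
have sJ1 : 1 <= s J by apply: le_trans (sl J).
have sJ0 : 0 < s J by apply: lt_le_trans sJ1.
have YX : X + 2 * (2 + `|Dl|) <= Y.
  apply: ltW; move: hJ; rewrite ltr_pdivrMr// => /lt_le_trans; apply.
  have l0 : 0 < l by apply: lt_le_trans l1.
  rewrite /Y /s lnM ?posrE ?exprn_gt0// lnXn// -mulr_natl.
  by have := ln_ge0 l1; lra.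
have Dl0 : Dl <= `|Dl| by exact: ler_norm.
have Y0 : 0 < Y by have := X1; have := normr_ge0 Dl; lra.
have [fX K1 fB low] := hM M J MM lM.
rewrite ln_lacn// -/l -/(s J) -/Y in K1 fB.
set f := lac_fun _ _ _ _ _ in fX fB low.
have [_ fW] := Lle f _ (ltW a10) fX fB.
have BK0 : 0 <= B * (C * Y `^ inv_exponent q0) by rewrite mulr_ge0// (le_trans ler01).
have tJ0 : tt J < tt 0%N.
  rewrite /tt ltr_pM2l// ltf_pV2 ?posrE// ltr_nat /lacn ltn_exp2l//.
  by rewrite expn0 -{1}(expn0 2) ltn_exp2l.
have lo : forall t, tt J <= t <= tt 0%N ->
    kap * (1 - ln t) `^ (b1 - r^-1) <= t `^ (- a1) * rmod a1 f t.
  by rewrite sE'; apply: lower.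
have := wsemi_lower_log (rmod_ge0_all TI p1 (ltW a10) fX) (rmod_nd TI p1 (ltW a10) fX)
  r0 BK0 (ltW kap0) (t0 J) tJ0 tt01 lo fW.
rewrite -/Dl mulrA powRM ?mulr_ge0 ?powR_ge0// -powRrM [_ * r]mulrC -/th.
have lnJ : Y - 2 <= ln (1 - ln (tt J)).
  rewrite lnt /Y; apply: (@le_trans _ _ (ln (s J / 2))).
    rewrite ln_div ?posrE//.
    have : ln 2 <= 1 :> R by have := @le_ln1Dx R 1; rewrite -natr1; apply; lra.
    by lra.
  have -> : s J = 2 * s J.-1 by rewrite /s -[J in LHS]prednK// exprS mulrA.
  have := sl J.-1; have := lHM; have := l1; rewrite -/l => h1 h2 h3.
  by rewrite ler_ln ?posrE; lra.
have step : kap `^ r / 2 * Y <= kap `^ r * (ln (1 - ln (tt J)) - Dl).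
  rewrite -mulrA ler_wpM2l ?powR_ge0//; have := X1; lra.
move=> /(le_trans step).
have XY : X <= Y by apply: le_trans YX; rewrite lerDl mulr_ge0// addr_ge0.
apply/negP; rewrite -ltNge.
have -> : Y `^ th = Y `^ (- (1 - th)) * Y.
  by rewrite -{3}(powRr1 (ltW Y0)) -powRD ?(gt_eqF Y0) ?implybT//; congr (_ `^ _); ring.
by rewrite mulrA ltr_pM2r//; exact: hX.
Qed.

End necessity_theorem.

(** * Translations of the line and of the circle *)

Section line.
Context {R : realType}.
Implicit Types (g : R -> \bar R) (c r s : R) (A : set R).

Local Notation leb1 := (@lebesgue_measure R).

Let shift c : measurableTypeR R -> measurableTypeR R := fun s => s + c.

Let measurable_shift c : measurable_fun setT (shift c).
Proof. exact: measurable_funD. Qed.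

(** A translate of Lebesgue measure agrees with it on intervals, hence
    everywhere. *)
Lemma lebesgue_measure_shift c A : measurable A ->
  pushforward leb1 (shift c) A = leb1 A.
Proof.
move=> mA; apply/esym.
apply: (@lebesgue_measure_unique R
  (measure_function_pushforward__canonical__measure_function_Measure
     leb1 (measurable_shift c))) => //= _ [[a b]] _ <-.
rewrite /pushforward /=.
rewrite (_ : _ @^-1` _ = `]a - c, b - c]%classic).
  rewrite !lebesgue_measure_itv/= !lte_fin ltrD2r.
  by case: ifP => // _; rewrite -!EFinB; congr (_%:E); ring.
by apply/seteqP; split => s; rewrite /shift/= !in_itv/= ltrBlDr lerBrDr.
Qed.

Lemma integral_shift g c A : (forall s, 0 <= g s)%E -> measurable_fun setT g ->
  measurable A -> (\int[leb1]_(s in shift c @^-1` A) g (s + c)%R = \int[leb1]_(s in A) g s)%E.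
Proof.
move=> g0 mg mA.
rewrite -[LHS](@ge0_integral_pushforward _ _ _ _ _ _ (measurable_shift c) leb1 A g)//.
  by apply: eq_measure_integral => //= B mB _; exact: lebesgue_measure_shift.
exact: measurable_funS mg.
Qed.

(** The part of the shifted period that sticks out is brought back by
    periodicity, after reducing the shift modulo 2 pi. *)
Lemma integral_periodic g c : (forall s, 0 <= g s)%E -> measurable_fun setT g ->
  (forall s, g (s + 2 * pi) = g s) ->
  (\int[leb1]_(s in `[0%R, (2 * pi)%R[) g (s + c)%R = \int[leb1]_(s in `[0%R, (2 * pi)%R[) g s)%E.
Proof.
move=> g0 mg per; have pi2 : 0 < 2 * pi :> R by rewrite mulr_gt0// pi_gt0.
have perN s n : g (s + n%:R * (2 * pi)) = g s.
  elim: n => [|n IH]; first by rewrite mul0r addr0.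
  by rewrite -IH -[RHS]per -natr1 mulrDl mul1r addrA.
have perZ s (k : int) : g (s + k%:~R * (2 * pi)) = g s.
  case: k => n; first exact: perN.
  by rewrite NegzE mulrNz mulNr -[LHS](perN _ n.+1) addrNK.
pose k := Num.floor (c / (2 * pi)); pose r := c - k%:~R * (2 * pi).
have r0 : 0 <= r < 2 * pi.
  have := Num.Theory.real_floor_itv (num_real (c / (2 * pi))); rewrite -/k => /andP[k1 k2].
  rewrite ler_pdivlMr// in k1; rewrite ltr_pdivrMr// intrD mulrDl mul1r in k2.
  by rewrite /r subr_ge0 k1/= ltrBlDl.
have gr s : g (s + c) = g (s + r) by rewrite -[RHS](perZ _ k) /r -addrA subrK.
under eq_integral do rewrite gr.
have [r1 r2] := andP r0.
have itvE (a b : R) : `[a, b[%classic = shift r @^-1` `[a + r, b + r[%classic.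
  by apply/seteqP; split => s; rewrite /shift/= !in_itv/= lerD2r ltrD2r.
rewrite [in LHS]itvE (integral_shift _ g0 mg)// add0r.
have split3 (a b e : R) : a <= b -> b <= e ->
  (\int[leb1]_(s in `[a, e[) g s =
   \int[leb1]_(s in `[a, b[) g s + \int[leb1]_(s in `[b, e[) g s)%E.
  move=> ab be; rewrite -ge0_integral_setU//.
  - congr (integral _ _ _); apply/seteqP; split => s; rewrite /= !in_itv/=.
      by move=> /andP[as' se]; have [sb|bs] := ltP s b; [left; rewrite as'|right].
    by case=> /andP[h1 h2]; rewrite ?h1 ?h2 ?andbT//= ?(lt_le_trans h2)// ?(le_trans ab).
  - exact: measurable_funS mg.
  - rewrite disj_set2E; apply/eqP; apply/seteqP; split => // s [] /=.
    by rewrite !in_itv/= => /andP[_ h1] /andP[h2 _]; move: (le_lt_trans h2 h1); rewrite ltxx.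
rewrite (split3 r (2 * pi) (2 * pi + r)) ?(ltW r2) ?lerDl// addeC.
rewrite [RHS](split3 0 r (2 * pi)) ?(ltW r2)//; congr (_ + _)%E.
have := @integral_shift g (2 * pi) `[2 * pi, 2 * pi + r[%classic g0 mg.
rewrite (_ : _ @^-1` _ = `[0, r[%classic); last first.
  apply/seteqP; split => s; rewrite /shift/= !in_itv/= -{1}[2 * pi]add0r lerD2r;
  by rewrite [2 * pi + r]addrC ltrD2r.
by move=> <-//; under [RHS]eq_integral do rewrite -per.
Qed.

End line.

(** * Translation invariance in several variables *)

Section boxes.
Context {R : realType}.

Local Notation leb1 := (@lebesgue_measure R).

(** The side E is the whole line for R^d, and one period for the torus. *)
Definition box (E : set R) d : set (space R d) := [set x | forall i, E (tnth x i)].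
Arguments box E d : clear implicits.

Lemma measurable_box E d : measurable E -> measurable (box E d).
Proof.
move=> mE; rewrite (_ : box E d = \bigcap_(i in [set: 'I_d])
  ((fun x : space R d => tnth x i) @^-1` E)); last first.
  by apply/seteqP; split => [x Ax i _|x Ax i]; exact: Ax.
apply: fin_bigcap_measurable => // i _; rewrite -[X in measurable X]setTI.
exact: measurable_tnth.
Qed.

Lemma box_consX E d s (v : space R d) : box E d.+1 (consX (s, v)) <-> E s /\ box E d v.
Proof.
split=> [Ex|[Es Ev] i].
  by split=> [|i]; [exact: (Ex ord0)|have := Ex (lift ord0 i); rewrite tnthS].
have [->//|i0] := eqVneq i ord0.
have [j ->] : exists j, i = lift ord0 j.
  by case: (unliftP ord0 i) i0 => [j ->|-> /eqP//]; exists j.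
by rewrite tnthS.
Qed.

Lemma translate_consX d (s : R) (v : space R d) c (s' : R) (v' : space R d) :
  translate (consX (s, v)) c (consX (s', v')) = consX (s + c * s', translate v c v').
Proof.
apply: eq_from_tnth => i; rewrite tnth_mktuple.
have [->//|i0] := eqVneq i ord0.
have [j ->] : exists j, i = lift ord0 j.
  by case: (unliftP ord0 i) i0 => [j ->|-> /eqP//]; exists j.
by rewrite !tnthS tnth_mktuple.
Qed.

Lemma consX_unconsX d (h : space R d.+1) : exists s v, h = consX (s, v).
Proof. by exists (thead h), [tuple of behead h]; rewrite /consX/= -tuple_eta. Qed.

Lemma unit_vector_lift d (i : 'I_d) :
  unit_vector (lift ord0 i) = consX (0, unit_vector i) :> space R d.+1.
Proof.
apply: eq_from_tnth => k; rewrite tnth_mktuple.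
have [->//|k0] := eqVneq k ord0.
have [j ->] : exists j, k = lift ord0 j.
  by case: (unliftP ord0 k) k0 => [j ->|-> /eqP//]; exists j.
by rewrite !tnthS tnth_mktuple (inj_eq lift_inj).
Qed.

Lemma unit_vector_ord0 d :
  unit_vector ord0 = consX (1, [tuple (0 : R) | i < d]) :> space R d.+1.
Proof.
apply: eq_from_tnth => k; rewrite tnth_mktuple.
have [->//|k0] := eqVneq k ord0.
have [j ->] : exists j, k = lift ord0 j.
  by case: (unliftP ord0 k) k0 => [j ->|-> /eqP//]; exists j.
by rewrite !tnthS tnth_mktuple.
Qed.

Section fixed_side.
Variables (E : set R) (mE : measurable (E : set (measurableTypeR R))).

(** Tonelli's theorem along the inductive construction of Lebesgue measure. *)
Lemma integral_box_consX d (F : space R d.+1 -> \bar R) :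
  (forall x, 0 <= F x)%E -> measurable_fun setT F ->
  (\int[leb d.+1]_(x in box E d.+1) F x =
   \int[leb1]_(s in E) \int[leb d]_(v in box E d) F (consX (s, v)))%E.
Proof.
move=> F0 mF; have mB n := @measurable_box E n mE.
pose G : measurableTypeR R * space R d -> \bar R := (F \_ (box E d.+1)) \o @consX R d.
have G0 z : (0 <= G z)%E by rewrite /G/= patchE; case: ifP.
have mF' : measurable_fun setT (F \_ (box E d.+1)).
  by apply/(measurable_restrictT _ (mB _)); exact: measurable_funS mF.
have mG : measurable_fun setT G by apply: measurableT_comp mF' (@measurable_consX R d).
transitivity (\int[(leb1 \x leb d)%E]_z G z)%E.
  rewrite integral_mkcond.
  rewrite -[RHS](@ge0_integral_pushforward _ _ _ _ _ _ (@measurable_consX R d) _ setT)//.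
  by move=> x _; rewrite patchE; case: ifP.
rewrite fubini_tonelli1// [RHS]integral_mkcond; apply: eq_integral => s _.
rewrite /fubini_F patchE; case: ifPn => [/set_mem Es|/negP Es].
  rewrite [RHS]integral_mkcond; apply: eq_integral => v _.
  rewrite /G/= !patchE; congr (if _ then _ else _).
  apply/idP/idP => /set_mem h; apply/mem_set; first by case/box_consX: h.
  exact/box_consX.
apply: integral0_eq => v _; rewrite /G/= patchE; case: ifPn => // /set_mem/box_consX[h _].
by exfalso; apply: Es; exact/mem_set.
Qed.

Variable P : Prop.

(** Guarded by a proposition, so that a single induction on the dimension
    treats functions without periods (P false) and functions with all periods
    (P true). *)
Definition periods d : set (space R d) := [set v | P /\ range unit_vector v].
Arguments periods : clear implicits.

Hypothesis line : forall g : R -> \bar R, (forall s, 0 <= g s)%E -> measurable_fun setT g ->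
  (P -> forall s, g (s + 2 * pi) = g s) -> forall c,
  (\int[leb1]_(s in E) g (s + c)%R = \int[leb1]_(s in E) g s)%E.

(** One coordinate at a time: for a fixed first coordinate, the induction
    hypothesis removes the translation of the other ones, and the inner
    integral is then a function of the first coordinate alone, to which the
    one-dimensional invariance applies. *)
Lemma box_translation_invariant d (F : space R d -> \bar R) : (forall x, 0 <= F x)%E ->
  measurable_fun setT F -> invariant (periods d) F -> forall c h,
  (\int[leb d]_(x in box E d) F (translate x c h) =
   \int[leb d]_(x in box E d) F x)%E.
Proof.
elim: d => [|d IH] in F *.
  move=> _ _ _ c h; apply: eq_integral => x _; congr F.
  by apply: eq_from_tnth => -[].
move=> F0 mF FP c h; have [s' [v' ->]] := consX_unconsX h.
have mFt : measurable_fun setT (fun x => F (translate x c (consX (s', v')))).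
  exact: measurableT_comp mF (measurable_translate c _).
rewrite integral_box_consX// integral_box_consX//.
have mFc s : measurable_fun setT (fun v => F (consX (s, v))).
  apply: measurableT_comp mF _; apply: measurableT_comp (@measurable_consX R d) _.
  exact: pair1_measurable.
pose g s := (\int[leb d]_(v in box E d) F (consX (s, v)))%E.
have step s : (\int[leb d]_(v in box E d) F (translate (consX (s, v)) c (consX (s', v'))) =
    g (s + c * s')%R)%E.
  under eq_integral do rewrite translate_consX.
  apply: (IH (fun v => F (consX (s + c * s', v)))) => // w [pP [i _ <-]] v.
  rewrite -[RHS](FP (unit_vector (lift ord0 i))); last by split => //; exists (lift ord0 i).
  by rewrite unit_vector_lift translate_consX mulr0 addr0.
under eq_integral do rewrite step.
apply: line.
- by move=> s; apply: integral_ge0.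
- pose G : measurableTypeR R * space R d -> \bar R :=
    (F \o @consX R d) \_ (setT `*` box E d).
  have -> : g = fubini_F (leb d) G.
    apply/funext => s; rewrite /g /fubini_F [LHS]integral_mkcond; apply: eq_integral => v _.
    rewrite /G !patchE/=; congr (if _ then _ else _).
    by apply/idP/idP => /set_mem svB; apply/mem_set => //; case: svB.
  apply: measurable_fun_fubini_tonelli_F.
    have mD : measurable ([set: measurableTypeR R] `*` box E d).
      by apply: measurableX => //; exact: measurable_box.
    apply/(measurable_restrictT _ mD); apply: measurable_funS measurableT (@subsetT _ _) _.
    exact: measurableT_comp mF (@measurable_consX R d).
  by move=> z; rewrite /G patchE; case: ifP => //= _; exact: F0.
- move=> pP s; rewrite /g; apply: eq_integral => v _.
  rewrite -[RHS](FP (unit_vector ord0)); last by split => //; exists ord0.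
  rewrite unit_vector_ord0 translate_consX mulr1; congr (F (consX (_, _))).
  by apply: eq_from_tnth => i; rewrite !tnth_mktuple mulr0 addr0.
Qed.

End fixed_side.
End boxes.
Arguments box {R} E d _.
Arguments periods {R} P d _.

Section invariant_measures.
Context {R : realType}.

Lemma integral_mrestr dd (T : measurableType dd) (mu : {measure set T -> \bar R})
    (D : set T) (mD : measurable D) (F : T -> \bar R) :
  (forall x, 0 <= F x)%E -> measurable_fun setT F ->
  (\int[mrestr mu mD]_x F x = \int[mu]_(x in D) F x)%E.
Proof.
move=> F0 mF; have mDc : measurable (~` D) by exact: measurableC.
rewrite [LHS](@ge0_negligible_integral _ _ _ _ _ (~` D))//; last first.
  by rewrite -[LHS]/(mu (~` D `&` D)) setICl measure0.
rewrite setDE setTI setCK; apply: eq_measure_integral => A mA AD.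
by rewrite -[LHS]/(mu (A `&` D)) (setIidl AD).
Qed.

Lemma leb_translation_invariant d : translation_invariant (@leb R d) set0.
Proof.
move=> F F0 mF _ c h.
have boxT : box (@setT R) d = [set: space R d] by apply/seteqP; split => // x _ i.
rewrite -boxT; apply: (@box_translation_invariant R setT measurableT False) => //.
- move=> g g0 mg _ s; rewrite -[RHS](integral_shift s g0 mg)//; congr integral.
- by move=> v [].
Qed.

Lemma leb_torus_translation_invariant d :
  translation_invariant (@leb_torus R d) (range unit_vector).
Proof.
move=> F F0 mF FP c h.
have mFt : measurable_fun setT (fun x => F (translate x c h)).
  exact: measurableT_comp mF (measurable_translate c h).
rewrite /leb_torus !integral_mrestr//.
have boxE : box `[0, 2 * pi[%classic d = @cube R d.
  by apply/seteqP; split => x hx i; exact: hx.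
rewrite -boxE; apply: (@box_translation_invariant R `[0, 2 * pi[%classic (measurable_itv _) True) => //.
- by move=> g g0 mg per s; exact: integral_periodic (per I).
- by move=> v [_ ]; exact: FP.
Qed.

End invariant_measures.

(** * Finite differences of sequences *)

Section finite_differences.
Variable V : pzRingType.
Implicit Types (a b : nat -> V).

Definition fd a j := a j.+1 - a j.

Lemma iter_fd_shift k a j : iter k fd (fun i => a i.+1) j = iter k fd a j.+1.
Proof. by elim: k j => // k IH j; rewrite !iterS /fd !IH. Qed.

Lemma iter_fdS k a j : iter k.+1 fd a j = iter k fd a j.+1 - iter k fd a j.
Proof. by []. Qed.

(** Pascal's rule, summed by parts. *)
Lemma pascal_sum k (G : nat -> V) :
  \sum_(i < k.+2) (-1) ^+ i * 'C(k.+1, i)%:R * G i =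
  \sum_(i < k.+1) (-1) ^+ i * 'C(k, i)%:R * G i -
  \sum_(i < k.+1) (-1) ^+ i * 'C(k, i)%:R * G i.+1.
Proof.
rewrite big_ord_recl/=.
have -> : \sum_(i < k.+1) (-1) ^+ bump 0 i * 'C(k.+1, bump 0 i)%:R * G (bump 0 i) =
  \sum_(i < k.+1) (-1) ^+ i.+1 * 'C(k, i.+1)%:R * G i.+1 -
  \sum_(i < k.+1) (-1) ^+ i * 'C(k, i)%:R * G i.+1.
  rewrite -sumrB; apply: eq_bigr => i _; rewrite /bump leq0n add1n binS natrD mulrDr mulrDl.
  by congr (_ + _); rewrite exprS mulN1r !mulNr.
rewrite addrA; congr (_ - _).
have -> : \sum_(i < k.+1) (-1) ^+ i * 'C(k, i)%:R * G i =
  \sum_(i < k.+2) (-1) ^+ i * 'C(k, i)%:R * G i.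
  by rewrite [RHS]big_ord_recr/= bin_small// mulr0 mul0r addr0.
by rewrite [RHS]big_ord_recl/= !bin0.
Qed.

Lemma iter_fdE k a j : iter k fd a j =
  \sum_(i < k.+1) (-1) ^+ i * 'C(k, i)%:R * a (j + (k - i))%N.
Proof.
elim: k j => [|k IH] j.
  by rewrite big_ord1 expr0 bin0 !mul1r addn0.
rewrite iter_fdS !IH (pascal_sum k (fun i => a (j + (k.+1 - i))%N)).
congr (_ - _); apply: eq_bigr => i _; congr (_ * a _).
by have := ltn_ord i; lia.
Qed.

End finite_differences.

Section tame_sequences.
Context {R : realType}.
Implicit Types (a b : nat -> R[i]) (D E eta : R).

(** Differences of order k are of size eta^k. This is stable under products, at
    the cost of doubling eta, and so reduces bounds for a product of functions
    to its factors. *)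
Definition tame m D eta a :=
  forall k j, (k + j <= m)%N -> normc (iter k (@fd R[i]) a j) <= D * eta ^+ k.

Lemma tame_mono m D D' eta eta' a : 0 <= D -> D <= D' -> 0 <= eta -> eta <= eta' ->
  tame m D eta a -> tame m D' eta' a.
Proof.
move=> D0 DD e0 ee ta k j kj; apply: (le_trans (ta k j kj)).
by apply: ler_pM; rewrite ?exprn_ge0// lerXn2r// nnegrE (le_trans e0).
Qed.

(** Leibniz's rule: the difference of a product is a sum of two products, with
    one more difference on one of the factors. *)
Lemma tame_mul m D E eta a b : 0 <= D -> 0 <= E -> 0 <= eta ->
  tame m D eta a -> tame m E eta b -> tame m (D * E) (2 * eta) (fun j => a j * b j).
Proof.
move=> D0 E0 e0 ta tb k j kjm.
suff main : forall k D E a b m', 0 <= D -> 0 <= E ->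
    (forall i j, (i + j <= m')%N -> normc (iter i (@fd R[i]) a j) <= D * eta ^+ i) ->
    (forall i j, (i + j <= m')%N -> normc (iter i (@fd R[i]) b j) <= E * eta ^+ i) ->
    forall j, (k + j <= m')%N ->
    normc (iter k (@fd R[i]) (fun j => a j * b j) j) <= D * E * (2 * eta) ^+ k.
  exact: (main k D E a b m).
clear -e0 => k; elim: k => [|k IH] D E a b m' D0 E0 ta tb j kj.
  rewrite expr0 mulr1 Normc.normcM; apply: ler_pM; rewrite ?normc_ge0//.
    by have := ta 0%N j kj; rewrite mulr1.
  by have := tb 0%N j kj; rewrite mulr1.
have -> : iter k.+1 (@fd R[i]) (fun j => a j * b j) j =
  iter k (@fd R[i]) (fun i => fd a i * b i.+1) j + iter k (@fd R[i]) (fun i => a i * fd b i) j.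
  rewrite iterSr; have addE (u v : nat -> R[i]) n i : iter n (@fd R[i]) (fun i => u i + v i) i =
      iter n (@fd R[i]) u i + iter n (@fd R[i]) v i.
    by elim: n i => // n ihn i; rewrite !iterS {1}/fd !ihn /fd; ring.
  by rewrite -addE; congr (iter _ _ _ _); apply/funext => i; rewrite /fd; ring.
have m1 : (0 < m')%N by apply: leq_trans kj; rewrite addSn.
have sta : forall i j, (i + j <= m'.-1)%N -> normc (iter i (@fd R[i]) (fd a) j) <= (D * eta) * eta ^+ i.
  by move=> i l il; rewrite -iterSr -mulrA -exprS; apply: ta; lia.
have stb : forall i j, (i + j <= m'.-1)%N -> normc (iter i (@fd R[i]) (fd b) j) <= (E * eta) * eta ^+ i.
  by move=> i l il; rewrite -iterSr -mulrA -exprS; apply: tb; lia.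
have ssb : forall i j, (i + j <= m'.-1)%N -> normc (iter i (@fd R[i]) (fun i => b i.+1) j) <= E * eta ^+ i.
  by move=> i l il; rewrite iter_fd_shift; apply: tb; lia.
have ssa : forall i j, (i + j <= m'.-1)%N -> normc (iter i (@fd R[i]) a j) <= D * eta ^+ i.
  by move=> i l il; apply: ta; lia.
have kj' : (k + j <= m'.-1)%N by lia.
have h1 := IH (D * eta) E _ _ m'.-1 (mulr_ge0 D0 e0) E0 sta ssb j kj'.
have h2 := IH D (E * eta) _ _ m'.-1 D0 (mulr_ge0 E0 e0) ssa stb j kj'.
apply: (le_trans (le_normcD _ _)); apply: (le_trans (lerD h1 h2)).
by rewrite exprS le_eqVlt; apply/orP; left; apply/eqP; ring.
Qed.

Lemma tame_const m (c : R[i]) eta : 0 <= eta -> tame m (normc c) eta (fun=> c).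
Proof.
move=> e0 [|k] j _; first by rewrite mulr1.
have -> : iter k.+1 (@fd R[i]) (fun=> c) j = 0.
  by rewrite iterSr; elim: k j => [|k IH] j; rewrite ?iterS /fd ?IH subrr.
by rewrite Normc.normc0 mulr_ge0 ?normc_ge0// exprn_ge0.
Qed.

Lemma tame_geometric m (c w : R[i]) eta : normc w = 1 -> normc (w - 1) <= eta ->
  tame m (normc c) eta (fun j => c * w ^+ j).
Proof.
move=> w1 we k j _.
have -> : iter k (@fd R[i]) (fun j => c * w ^+ j) j = c * (w - 1) ^+ k * w ^+ j.
  by elim: k j => [|k IH] j; rewrite ?mulr1// iter_fdS !IH !exprS; ring.
have nX (z : R[i]) n : normc (z ^+ n) = normc z ^+ n.
  by elim: n => [|n IH]; rewrite ?Normc.normc1// !exprS Normc.normcM IH.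
rewrite !Normc.normcM !nX w1 expr1n mulr1 ler_wpM2l ?normc_ge0// lerXn2r// nnegrE ?normc_ge0//.
exact: le_trans (normc_ge0 _) we.
Qed.

(** The differences of the reciprocal of an arithmetic progression are
    explicit, so that no derivative has to be estimated. *)
Lemma iter_fd_inv (z w : R[i]) k j : (forall i : nat, z + i%:R * w != 0) ->
  iter k (@fd R[i]) (fun j => (z + j%:R * w)^-1) j =
  (-1) ^+ k * k`!%:R * w ^+ k * \prod_(i < k.+1) (z + (j + i)%:R * w)^-1.
Proof.
move=> nz; elim: k j => [|k IH] j.
  by rewrite big_ord1 addn0 !mul1r.
rewrite iter_fdS !IH.
have e1 : \prod_(i < k.+1) (z + (j.+1 + i)%:R * w)^-1 =
    \prod_(i < k) (z + (j.+1 + i)%:R * w)^-1 * (z + (j + k.+1)%:R * w)^-1.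
  by rewrite big_ord_recr/= addSnnS.
have e2 : \prod_(i < k.+1) (z + (j + i)%:R * w)^-1 =
    (z + j%:R * w)^-1 * \prod_(i < k) (z + (j.+1 + i)%:R * w)^-1.
  by rewrite big_ord_recl/= addn0; congr (_ * _); apply: eq_bigr => i _; rewrite /bump leq0n addnCA addSn add1n.
have e3 : \prod_(i < k.+2) (z + (j + i)%:R * w)^-1 = (z + j%:R * w)^-1 *
    \prod_(i < k) (z + (j.+1 + i)%:R * w)^-1 * (z + (j + k.+1)%:R * w)^-1.
  by rewrite big_ord_recr/= e2.
rewrite e1 e2 e3; set P := \prod_(_ < k) _; have n1 := nz j; have n2 := nz (j + k.+1)%N.
rewrite factS natrM !exprS natrD -[k.+1%:R]natr1; rewrite natrD -[k.+1%:R]natr1 in n2.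
by field; rewrite n1 n2.
Qed.

(** With alternating signs, differences become sums, and nonnegative terms
    cannot cancel. *)
Lemma iter_fd_alternating k (c : R[i]) (b : nat -> R) j : (forall j, 0 <= b j) ->
  normc c * b j <= normc (iter k (@fd R[i]) (fun j => c * (-1) ^+ j * (b j)%:C%C) j).
Proof.
move=> b0.
suff [b' [b'0 [bb' ->]]] : exists b' : nat -> R, (forall j, 0 <= b' j) /\
    ((forall j, b j <= b' j) /\ forall j,
    iter k (@fd R[i]) (fun j => c * (-1) ^+ j * (b j)%:C%C) j =
    (-1) ^+ k * (c * (-1) ^+ j * (b' j)%:C%C)).
  have nX n : normc ((-1) ^+ n : R[i]) = 1.
    by elim: n => [|n IH]; rewrite ?Normc.normc1// exprS Normc.normcM IH normcN Normc.normc1 mulr1.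
  rewrite !Normc.normcM !nX mul1r mulr1 ler_wpM2l ?normc_ge0//.
  by rewrite normcE/= expr0n/= addr0 sqrtr_sqr ger0_norm.
elim: k => [|k [b' [b'0 [bb' IH]]]].
  by exists b; split => //; split => // i; rewrite mul1r.
exists (fun j => b' j.+1 + b' j); split; first by move=> i; rewrite addr_ge0.
split => i; first by rewrite (le_trans (bb' i))// lerDr.
by rewrite iter_fdS !IH !exprS (_ : ((b' i.+1 + b' i)%:C)%C = (b' i.+1)%:C%C + (b' i)%:C%C) ?rmorphD//; ring.
Qed.

End tame_sequences.

(** * A rational weight with explicit differences *)

Section rational_weight.
Context {R : realType}.
Implicit Types (x y : R) (z : R[i]).

Lemma normc_real x : normc (x%:C)%C = `|x|.
Proof. by rewrite normcE expr0n/= addr0 sqrtr_sqr. Qed.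

(** In [iter_fd_inv], all factors but the first have modulus at most 1, because
    the imaginary part of z + j y has modulus 1. For the same reason, and as
    |y| is at most 1, the first factor is comparable to the one at j = 0. *)
Lemma tame_inv_affine m z y : `|Im z| = 1 -> `|y| <= 1 ->
  tame m ((m.+1)`!%:R / normc z) `|y| (fun j => (z + j%:R * (y%:C)%C)^-1).
Proof.
move=> z1 y1 k j kj.
have far (n : nat) : 1 <= normc (z + n%:R * (y%:C)%C).
  apply: le_trans (Im_le_normc _); rewrite -(rmorph_nat (real_complex R)) -rmorphM.
  by case: z z1 => a b /= <-; rewrite addr0.
have z0 : 0 < normc z.
  by have := far 0%N; rewrite mul0r addr0 => /(lt_le_trans ltr01).
have farz (n : nat) : normc z <= n.+1%:R * normc (z + n%:R * (y%:C)%C).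
  rewrite -{1}(addrK (n%:R * (y%:C)%C) z); apply: (le_trans (le_normcD _ _)).
  rewrite normcN Normc.normcM normc_real -natr1 mulrDl mul1r addrC lerD2r.
  have -> : normc (n%:R : R[i]) = n%:R by rewrite -(rmorph_nat (real_complex R)) normc_real ger0_norm.
  by rewrite ler_wpM2l// (le_trans y1).
have nz (n : nat) : z + n%:R * (y%:C)%C != 0.
  by apply/eqP => h; have := far n; rewrite h Normc.normc0 ler10.
rewrite iter_fd_inv// !Normc.normcM.
have nX (u : R[i]) n : normc (u ^+ n) = normc u ^+ n.
  by elim: n => [|n IH]; rewrite ?Normc.normc1// !exprS Normc.normcM IH.
rewrite !nX normcN Normc.normc1 expr1n mul1r normc_real.
have -> : normc (k`!%:R : R[i]) = k`!%:R by rewrite -(rmorph_nat (real_complex R)) normc_real ger0_norm.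
have prod1 n : normc (\prod_(i < n) (z + (j.+1 + i)%:R * (y%:C)%C)^-1) <= 1.
  elim: n => [|n IH]; first by rewrite big_ord0 Normc.normc1.
  rewrite big_ord_recr/= Normc.normcM Normc.normcV mulr_ile1 ?normc_ge0 ?invr_ge0 ?normc_ge0//.
  by rewrite invf_le1// (lt_le_trans ltr01).
rewrite big_ord_recl/= addn0 Normc.normcM Normc.normcV.
under eq_bigr => i _ do rewrite -[bump 0 i]/(i.+1) addnS -addSn.
rewrite [leLHS]mulrAC; apply: ler_wpM2r; first exact: exprn_ge0.
have h1 : (normc (z + j%:R * (y%:C)%C))^-1 <= m.+1%:R / normc z.
  have n0 : 0 < normc (z + j%:R * (y%:C)%C) by apply: lt_le_trans (far j).
  rewrite ler_pdivlMr// mulrC ler_pdivrMr//; apply: (le_trans (farz j)).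
  by rewrite ler_wpM2r ?(ltW n0)// ler_nat; lia.
rewrite factS natrM [m.+1%:R * _]mulrC -mulrA; apply: ler_pM => //.
- by rewrite mulr_ge0 ?invr_ge0 ?normc_ge0.
- by rewrite ler_nat leq_fact//; lia.
rewrite -[leRHS]mulr1; apply: ler_pM => //; rewrite ?invr_ge0 ?normc_ge0//.
exact: prod1.
Qed.

(** The weight 1 / (1 + x^2) is the product of 1 / (x + i) and 1 / (x - i). *)
Lemma tame_inv_quadratic m x y : `|y| <= 1 ->
  tame m ((m.+1)`!%:R ^+ 2 * (1 + x ^+ 2)^-1) (2 * `|y|)
    (fun j => (((1 + (x + j%:R * y) ^+ 2)^-1)%:C)%C).
Proof.
move=> y1.
have zp : `|Im (x +i* 1)%C| = 1 by rewrite /= normr1.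
have zm : `|Im (x -i* 1)%C| = 1 by rewrite /= normrN1.
have hp := @tame_inv_affine m _ y zp y1; have hm := @tame_inv_affine m _ y zm y1.
have x1 : 0 < 1 + x ^+ 2 by rewrite ltr_wpDr// sqr_ge0.
have nn : normc (x +i* 1)%C * normc (x -i* 1)%C = 1 + x ^+ 2.
  by rewrite !normcE sqrrN -expr2 sqr_sqrtr ?expr1n 1?addrC// ltW// addrC.
have D0 s : 0 <= (m.+1)`!%:R / normc (x +i* s)%C by rewrite divr_ge0// normc_ge0.
have := tame_mul (D0 1) (D0 (- 1)) (normr_ge0 y) hp hm.
have -> : (m.+1)`!%:R / normc (x +i* 1)%C * ((m.+1)`!%:R / normc (x -i* 1)%C) =
    (m.+1)`!%:R ^+ 2 * (1 + x ^+ 2)^-1 by rewrite -nn invfM expr2; ring.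
congr (tame _ _ _ _); apply/funext => j; rewrite -invfM fmorphV/=; congr (_^-1).
rewrite -(rmorph_nat (real_complex R)) -rmorphM; set u := j%:R * y.
by apply/eqP; rewrite eq_complex/=; apply/andP; split; apply/eqP; ring.
Qed.

Lemma tame_prod m n (D : 'I_n -> R) eta (a : 'I_n -> nat -> R[i]) : 0 <= eta ->
  (forall i, 0 <= D i) -> (forall i, tame m (D i) eta (a i)) ->
  tame m (\prod_(i < n) D i) (2 ^+ n * eta) (fun j => \prod_(i < n) a i j).
Proof.
move=> e0; elim: n => [|n IH] in D a * => D0 ta.
  rewrite big_ord0 (_ : (fun j => _) = (fun=> 1)); last by apply/funext => j; rewrite big_ord0.
  rewrite mul1r -[X in tame _ X](@Normc.normc1 R); exact: tame_const.
rewrite big_ord_recr/= (_ : (fun j => _) = (fun j => (\prod_(i < n) a (widen_ord (leqnSn n) i) j) * a ord_max j));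
  last by apply/funext => j; rewrite big_ord_recr.
have e1 : eta <= 2 ^+ n * eta by rewrite ler_peMl// exprn_ege1// ler1n.
rewrite exprS -mulrA; apply: tame_mul => //.
- exact: prodr_ge0.
- by rewrite mulr_ge0// exprn_ge0.
- exact: IH.
- exact: (tame_mono (D0 _) (lexx _) e0 e1).
Qed.

End rational_weight.

(** * Modulated weights as test functions *)

Section pointwise_difference.
Context {R : realType} {d : nat}.
Implicit Types (f : space R d -> R[i]) (h x : space R d).

Lemma real_difference_fd m h (u : space R d -> R) x :
  real_difference m%:R h u x = iter m (@fd R) (fun j => u (translate x j%:R h)) 0%N.
Proof.
rewrite iter_fdE /real_difference; apply/cvg_lim => //; apply: cvg_near_cst.
exists m.+1 => // n /= mn; rewrite big_mkord -(subnKC mn) big_split_ord/=.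
rewrite [X in _ + X]big1 ?addr0 => [|i _]; last first.
  by rewrite gbinom_nat bin_small ?mulr0 ?mul0r// ltn_addr.
by apply: eq_bigr => i _; rewrite gbinom_nat add0n natrB// -ltnS.
Qed.

(** For an integer order, the binomial series is a finite sum. *)
Lemma difference_fd m h f x :
  difference m%:R h f x = iter m (@fd R[i]) (fun j => f (translate x j%:R h)) 0%N.
Proof.
rewrite /difference !real_difference_fd.
have E (a : nat -> R[i]) k j : iter k (@fd R[i]) a j =
    (iter k (@fd R) (fun j => Re (a j)) j +i* iter k (@fd R) (fun j => Im (a j)) j)%C.
  elim: k j => [|k IH] j; first by rewrite /=; case: (a j).
  by rewrite !iterS {1}/fd !IH.
by rewrite E.
Qed.

End pointwise_difference.

Section characters.
Context {R : realType}.
Implicit Types s t : R.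

Definition cis t : R[i] := (cos t +i* sin t)%C.

Lemma cisD s t : cis (s + t) = cis s * cis t.
Proof. by rewrite /cis cosD sinD; congr (_ +i* _)%C; rewrite /=; ring. Qed.

Lemma normc_cis t : normc (cis t) = 1.
Proof. by rewrite normcE cos2Dsin2 sqrtr1. Qed.

Lemma cis0 : cis 0 = 1. Proof. by rewrite /cis cos0 sin0. Qed.

Lemma cis_pi : cis pi = -1.
Proof. by rewrite /cis cospi sinpi; apply/eqP; rewrite eq_complex/= oppr0 !eqxx. Qed.

Lemma cis_natmul j t : cis (j%:R * t) = cis t ^+ j.
Proof.
elim: j => [|j IH]; first by rewrite mul0r cis0.
by rewrite -natr1 mulrDl mul1r cisD IH exprSr.
Qed.

Lemma cis_period t (k : nat) : cis (t + 2 * pi * k%:R) = cis t.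
Proof.
rewrite cisD [2 * _ * _]mulrC mulrA -natrM cis_natmul cis_pi.
by rewrite exprM exprAC sqrrN !expr1n mulr1.
Qed.

(** The mean value theorem for the cosine and the sine. *)
Lemma cis_sub1 t : normc (cis t - 1) <= 2 * `|t|.
Proof.
suff h : forall t, 0 <= t -> normc (cis t - 1) <= 2 * t.
  have [t0|/ltW t0] := leP 0 t; first by rewrite ger0_norm// h.
  rewrite ler0_norm//; have := h (- t); rewrite oppr_ge0 => /(_ t0).
  have -> : cis t - 1 = - (cis t * (cis (- t) - 1)).
    by rewrite mulrBr -cisD subrr cis0 mulr1 opprB.
  by rewrite normcN Normc.normcM normc_cis mul1r.
move=> {}t t0.
have split (x y : R) : normc (x +i* y)%C <= `|x| + `|y|.
  have := normc_add x 0 0 y; rewrite addr0 add0r => /le_trans; apply.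
  by rewrite !normcE expr0n/= addr0 add0r !sqrtr_sqr.
have -> : cis t - 1 = ((cos t - cos 0) +i* (sin t - sin 0))%C.
  by apply/eqP; rewrite eq_complex/= cos0 sin0 !eqxx.
apply: (le_trans (split _ _)).
have hc : `|cos t - cos 0| <= t.
  have [c _ ->] := @MVT_segment R cos (fun x => - sin x) 0 t t0
    (fun x _ => is_derive_cos x) (continuous_subspaceT (@continuous_cos R)).
  rewrite subr0 normrM normrN (ger0_norm t0) ler_piMl// ler_norml.
  by rewrite sin_geN1 sin_le1.
have hs : `|sin t - sin 0| <= t.
  have [c _ ->] := @MVT_segment R sin cos 0 t t0
    (fun x _ => is_derive_sin x) (continuous_subspaceT (@continuous_sin R)).
  rewrite subr0 normrM (ger0_norm t0) ler_piMl// ler_norml.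
  by rewrite cos_geN1 cos_le1.
lra.
Qed.

End characters.

Section modulated_weight.
Context {R : realType} {d : nat}.
Variables (mu : {measure set (space R d.+1) -> \bar R}) (L : set (space R d.+1)) (p : R).
Hypothesis TI : translation_invariant mu L.
Hypothesis p1 : 1 <= p.
Implicit Types (h x : space R d.+1).

Local Notation Lpi := (Lpi mu L p).
Local Notation nrm := (nrm mu p).

Variables (psi : space R d.+1 -> R) (m : nat) (A B : R).
Let psiC x : R[i] := ((psi x)%:C)%C.
Hypothesis psi0 : forall x, 0 < psi x.
Hypothesis psiX : Lpi psiC.
Hypothesis mu_neq0 : mu setT != 0%E.
Hypothesis L_int : forall v, L v -> exists k : nat, tnth v ord0 = k%:R.
Hypotheses (A0 : 0 <= A) (B0 : 0 <= B).
Hypothesis psi_tame : forall x h, enorm h <= 1 ->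
  tame m (A * psi x) (B * enorm h) (fun j => psiC (translate x j%:R h)).

Definition modulated N x : R[i] := psiC x * cis (N%:R * tnth x ord0).

Let normc_psiC x : normc (psiC x) = psi x.
Proof. by rewrite normc_real ger0_norm ?(ltW (psi0 x)). Qed.

Let normc_modulated N x : normc (modulated N x) = normc (psiC x).
Proof. by rewrite Normc.normcM normc_cis mulr1. Qed.

(** A function without zeros is not almost everywhere 0. *)
Lemma nrm_psi_gt0 : 0 < nrm psiC.
Proof.
rewrite lt_neqAle nrm_ge0 andbT eq_sym; apply/eqP => n0.
have p0 : (0 < p%:E)%E by rewrite lte_fin (lt_le_trans ltr01).
have /(Lnorm_eq0_eq0 _ p0) : Lp_norm mu p psiC = 0%E by rewrite (Lp_normE psiX) n0.
have mn : measurable_fun setT (fun x => (normc (psiC x))%:E).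
  by apply/measurable_EFinP; exact: Lpi_measurable_normc psiX.
move=> /(_ mn) [N [mN muN sub]].
have NT : N = setT.
  apply/seteqP; split => // x _; apply: sub => /= /(_ I) xE.
  have : (normc (psiC x))%:E = 0%E := xE.
  by rewrite normc_psiC => -[h]; have := psi0 x; rewrite h ltxx.
by move: mu_neq0; rewrite -NT muN eqxx.
Qed.

Let modulatedX N : Lpi (modulated N) /\ nrm (modulated N) = nrm psiC.
Proof.
have nE : Lp_norm mu p (modulated N) = Lp_norm mu p psiC.
  by rewrite /Lp_norm; congr (Lnorm _ _ _); apply/funext => x; rewrite normc_modulated.
have [[mr _ fin] inv] := psiX.
have mx : measurable_fun setT (fun x : space R d.+1 => N%:R * (tnth x ord0 : R)).
  by apply: measurable_funM => //; exact: measurable_tnth.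
have reE x : Re (modulated N x) = psi x * cos (N%:R * tnth x ord0).
  by rewrite /modulated /psiC /cis/= mul0r subr0.
have imE x : Im (modulated N x) = psi x * sin (N%:R * tnth x ord0).
  by rewrite /modulated /psiC /cis/= mul0r addr0.
split; last by rewrite /nrm nE.
split; last first.
  move=> v Lv x; rewrite /modulated inv//; congr (_ * _).
  have [k vk] := L_int Lv; rewrite tnth_mktuple vk mulrDr [N%:R * (_ * _)]mulrCA -natrM.
  exact: cis_period.
split; last by rewrite nE.
- under eq_fun do rewrite reE; apply: measurable_funM => //.
  by apply: measurableT_comp mx; apply: continuous_measurable_fun; exact: continuous_cos.
- under eq_fun do rewrite imE; apply: measurable_funM => //.
  by apply: measurableT_comp mx; apply: continuous_measurable_fun; exact: continuous_sin.
Qed.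

Let seqE N x h j : modulated N (translate x j%:R h) =
  psiC (translate x j%:R h) * (cis (N%:R * tnth x ord0) * cis (N%:R * tnth h ord0) ^+ j).
Proof.
rewrite /modulated; congr (_ * _).
by rewrite tnth_mktuple mulrDr cisD mulrCA (cis_natmul j).
Qed.

(** Along a step h, the character is a geometric progression of ratio exp(i N
    h_1), at distance at most 2 N |h| from 1, and the weight is tame by
    hypothesis: [tame_mul] bounds the differences of the product. For the step
    pi / N in the first direction the ratio is -1, and [iter_fd_alternating]
    bounds the difference from below by the weight. *)
Lemma modulated_test_family : test_family mu L p m modulated.
Proof.
have nd h (i : 'I_d.+1) : `|tnth h i| <= enorm h.
  rewrite /enorm -sqrtr_sqr ler_wsqrtr// (bigD1 i)//= lerDl.
  by apply: sumr_ge0 => j _; exact: sqr_ge0.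
have B0' := B0; pose K := A * (2 * (B + 2)) ^+ m; have K0 : 0 <= K by rewrite mulr_ge0// exprn_ge0//; lra.
exists ((K + 1) * nrm psiC), (nrm psiC), pi.
have n0 := nrm_psi_gt0; split => //.
- by rewrite mulr_ge0 ?addr_ge0// ltW.
- by apply: le_trans (pi_ge2 R); rewrite ler1n.
move=> N N0; have N1 : 1 <= N%:R :> R by rewrite ler1n.
have NR : 0 < N%:R :> R by apply: lt_le_trans N1.
have [fX fE] := modulatedX N; split => //.
- by rewrite fE ler_peMl ?(ltW n0)// lerDr.
- move=> h Nh; have h0 : 0 <= enorm h by exact: sqrtr_ge0.
  have hN : enorm h <= N%:R * enorm h by rewrite ler_peMl.
  have h1 : enorm h <= 1 by apply: le_trans Nh.
  pose k := K * (N%:R * enorm h) ^+ m.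
  have k0 : 0 <= k by rewrite mulr_ge0// exprn_ge0// (le_trans h0).
  have [D [_ hD]] := difference_bound TI p1 (ler0n R m).
  have [dX _] := hD h _ fX.
  have [kX kE] := Lpi_cscale p1 k psiX.
  apply: (@le_trans _ _ (nrm (cscale k psiC))); last first.
    rewrite kE ger0_norm// /k [leLHS]mulrAC ler_wpM2r//.
      by rewrite exprn_ge0// (le_trans h0).
    by rewrite ler_wpM2r ?(ltW n0)// lerDl.
  apply: (nrm_le p1 dX kX) => x; rewrite normc_cscale normc_psiC ger0_norm// difference_fd.
  under [X in iter _ _ X]eq_fun do rewrite seqE.
  pose eta := (B + 2) * (N%:R * enorm h).
  have t1 : tame m (A * psi x) eta (fun j => psiC (translate x j%:R h)).
    apply: (tame_mono _ (lexx _) _ _ (psi_tame x h1)).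
    + by rewrite mulr_ge0// ltW.
    + by rewrite mulr_ge0.
    + by rewrite /eta; apply: ler_pM => //; lra.
  have t2 : tame m 1 eta (fun j => cis (N%:R * tnth x ord0) * cis (N%:R * tnth h ord0) ^+ j).
    have := @tame_geometric R m (cis (N%:R * tnth x ord0)) _ eta (normc_cis (N%:R * tnth h ord0)).
    rewrite normc_cis; apply.
    apply: (le_trans (cis_sub1 _)); rewrite /eta normrM (ger0_norm (ltW NR)).
    apply: ler_pM => //; rewrite ?mulr_ge0 ?(ltW NR)//; first by lra.
    by rewrite ler_pM2l.
  have ps0 : 0 <= A * psi x by rewrite mulr_ge0// ltW.
  have e0 : 0 <= eta by rewrite mulr_ge0 ?addr_ge0// mulr_ge0// ltW.
  have := tame_mul ps0 ler01 e0 t1 t2 (_ : (m + 0 <= m)%N); rewrite addn0 => /(_ (leqnn m)).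
  move/le_trans; apply; rewrite mulr1 /k /K /eta mulrA !exprMn.
  by rewrite le_eqVlt; apply/orP; left; apply/eqP; ring.
- exists (scale_vector (pi / N%:R) (unit_vector ord0)); split.
    rewrite enorm_scale ger0_norm ?divr_ge0 ?pi_ge0 ?(ltW NR)// ler_piMr//.
      by rewrite divr_ge0 ?pi_ge0 ?(ltW NR).
    rewrite /enorm big_ord_recl/= big1 ?addr0 => [|i _].
      by rewrite tnth_mktuple eqxx expr1n sqrtr1.
    by rewrite tnth_mktuple/= expr0n.
  have [D [_ hD]] := difference_bound TI p1 (ler0n R m).
  have [dX _] := hD (scale_vector (pi / N%:R) (unit_vector ord0)) _ fX.
  apply: (nrm_le p1 psiX dX) => x; rewrite difference_fd.
  under [X in iter _ _ X]eq_fun do rewrite seqE.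
  set h := scale_vector _ _.
  have -> : N%:R * tnth h ord0 = pi.
    by rewrite /h !tnth_mktuple eqxx mulr1 mulrC divfK// gt_eqF.
  rewrite cis_pi normc_psiC.
  have := @iter_fd_alternating R m (cis (N%:R * tnth x ord0))
    (fun j => psi (translate x j%:R h)) 0 (fun j => ltW (psi0 _)).
  rewrite normc_cis mul1r translate0 => /le_trans; apply.
  rewrite le_eqVlt; apply/orP; left; apply/eqP; congr (normc (iter _ _ _ _)).
  by apply/funext => j; rewrite mulrC.
Qed.

End modulated_weight.

(** * The characterization, and the weight of R^d *)

Section characterization.
Context {R : realType} {d : nat}.
Variables (mu : {measure set (space R d) -> \bar R}) (L : set (space R d)) (p : R).
Hypothesis TI : translation_invariant mu L.
Hypothesis p1 : 1 <= p.
Hypothesis tests : forall m, exists phi, test_family mu L p m phi.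
Variables (a0 a1 b0 b1 : R) (q0 q1 : \bar R).
Hypotheses (ha0 : 0 < a0) (ha1 : 0 < a1) (hq0 : (0 < q0)%E) (hq1 : (0 < q1)%E).
Hypotheses (hb0 : inv_exponent q0 < b0) (hb1 : inv_exponent q1 < b1).

(** The order m of the test differences only has to exceed both orders of
    smoothness. *)
Lemma embedding_characterization :
  continuous_inclusion (LipX mu L p a0 b0 q0) (Lip_qnorm mu a0 b0 p q0)
                       (LipX mu L p a1 b1 q1) (Lip_qnorm mu a1 b1 p q1) <->
  embedding_condition a0 a1 b0 b1 q0 q1.
Proof.
split=> [incl|]; last exact: (continuous_embedding TI p1 ha0 ha1 hq0 hq1 hb0 hb1).
pose m := (Num.truncn (Num.max a0 a1)).+1.
have [phi phiP] := tests m.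
have mx : Num.max a0 a1 < m%:R.
  have M0 : 0 <= Num.max a0 a1 by rewrite le_max (ltW ha0).
  by have /andP[_] := Num.Theory.truncn_itv M0.
have [a0m a1m] : a0 < m%:R /\ a1 < m%:R by move: mx; rewrite gt_max => /andP[].
have ha0' : 0 < a0 < m%:R by rewrite ha0.
have ha1' : 0 < a1 < m%:R by rewrite ha1.
have fX : exists f, Lpi mu L p f.
  by have [C [c [H [_ _ _ h]]]] := phiP; have [fX _ _ _] := h 1%N isT; exists (phi 1%N).
have [B [B0 hB]] := bounded_inclusion TI p1 (ltW ha0) (ltW ha1) hq0 hq1 incl fX.
have order := necessary_order TI p1 ha0' ha1' hq0 hq1 hb0 hb1 phiP B0 hB.
have sums := necessary_summability TI p1 ha0' ha1' hq0 hq1 hb0 hb1 phiP B0 hB.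
have [h|h|aE] := ltgtP a0 a1; last 2 first.
- exact: Or31.
- have [h|h|sE] := ltgtP (b0 - inv_exponent q0) (b1 - inv_exponent q1).
  + exact: Or32.
  + by case: order; right.
  + apply: Or33; split => //; have [//|h] := leP q0 q1.
    by case: sums.
by case: order; left.
Qed.

End characterization.

Section weights.
Context {R : realType}.

(** A weight between 0 and 1 is larger than its p-th power. *)
Lemma Lpi_weight d (mu : {measure set (space R d) -> \bar R}) (L : set (space R d))
    (p : R) (psi : space R d -> R) : 1 <= p -> measurable_fun setT psi ->
  (forall x, 0 < psi x <= 1) -> (\int[mu]_x (psi x)%:E < +oo)%E -> invariant L psi ->
  Lpi mu L p (fun x => ((psi x)%:C)%C).
Proof.
move=> p1 mpsi psi01 fin inv.
have psi0 x : 0 < psi x by have /andP[] := psi01 x.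
have I0 : (0 <= \int[mu]_x (psi x)%:E)%E.
  by apply: integral_ge0 => x _; rewrite lee_fin ltW.
pose K := fine (\int[mu]_x (psi x)%:E)%E `^ p^-1.
have [] // := @Lpi_intro _ _ mu L p (fun x => ((psi x)%:C)%C) K mpsi _ _ _.
- by move=> v Lv x; rewrite inv.
- rewrite /Lp_norm (_ : (fun x => _) = EFin \o psi); last first.
    by apply/funext => x; rewrite normc_real ger0_norm ?(ltW (psi0 x)).
  apply/(Lnorm_leP mu p1 psi (powR_ge0 _ _)).
  have p0 : p != 0 by rewrite gt_eqF// (lt_le_trans ltr01).
  rewrite /K -powRrM mulVf// powRr1 ?fine_ge0// fineK ?ge0_fin_numE//.
  apply: ge0_le_integral => //.
  - apply/measurable_EFinP; apply: (measurableT_comp (measurable_powR p)).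
    exact: measurableT_comp.
  - exact/measurable_EFinP.
  - move=> x _; have /andP[_ h1] := psi01 x; rewrite lee_fin ger0_norm ?(ltW (psi0 x))//.
    by rewrite -[leRHS](powRr1 (ltW (psi0 x))); apply: ger_powR; rewrite ?psi0.
Qed.

(** Positive, integrable, and a product of functions whose differences are
    explicit. *)
Definition cauchy_weight d (x : space R d) : R := \prod_(i < d) (1 + tnth x i ^+ 2)^-1.

Lemma cauchy_factor (s : R) : 0 < (1 + s ^+ 2)^-1 <= 1.
Proof.
have s1 : 1 <= 1 + s ^+ 2 by rewrite lerDl sqr_ge0.
by rewrite invr_gt0 (lt_le_trans ltr01 s1)/= invf_le1// (lt_le_trans ltr01 s1).
Qed.

Lemma cauchy_weight_bounds d (x : space R d) : 0 < cauchy_weight x <= 1.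
Proof.
rewrite /cauchy_weight; apply/andP; split.
  by apply: prodr_gt0 => i _; have /andP[] := cauchy_factor (tnth x i).
by apply: prodr_ile1 => i _; have /andP[h ->] := cauchy_factor (tnth x i); rewrite ltW.
Qed.

Lemma measurable_cauchy_factor : measurable_fun setT (fun s : R => (1 + s ^+ 2)^-1).
Proof. by apply: continuous_measurable_fun; exact: continuous_oneDsqrV. Qed.

Lemma measurable_cauchy_weight d : measurable_fun setT (@cauchy_weight d).
Proof.
apply: measurable_prod => i _.
apply: (measurableT_comp measurable_cauchy_factor); exact: measurable_tnth.
Qed.

Lemma integral_cauchy_weight d : (\int[leb d]_x (@cauchy_weight d x)%:E < +oo)%E.
Proof.
have line : (\int[@lebesgue_measure R]_s ((1 + s ^+ 2)^-1)%:E < +oo)%E.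
  rewrite (@ge0_symfun_integralT R (fun s => (1 + s ^+ 2)^-1)).
  - by rewrite -set_itvcy integral0y_oneDsqr -EFinM ltry.
  - by move=> s; have /andP[/ltW] := cauchy_factor s.
  - exact: continuous_oneDsqrV.
  - by move=> s /=; rewrite sqrrN.
elim: d => [|d IH].
  have -> : (\int[leb 0]_x (@cauchy_weight 0 x)%:E = (cauchy_weight ([tuple] : space R 0))%:E)%E.
    rewrite [LHS]integral_dirac//; first by rewrite diracE mem_set// mul1e.
    by apply/measurable_EFinP; exact: measurable_cauchy_weight.
  exact: ltry.
have boxT n : box setT n = [set: space R n] by apply/seteqP; split => // x _ i.
have mE n : measurable_fun setT (fun x : space R n => (cauchy_weight x)%:E).
  by apply/measurable_EFinP; exact: measurable_cauchy_weight.
have pos n (x : space R n) : (0 <= (cauchy_weight x)%:E)%E.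
  by rewrite lee_fin; have /andP[/ltW] := cauchy_weight_bounds x.
rewrite -(boxT d.+1) (@integral_box_consX R setT)//= boxT.
have step s : (\int[leb d]_v (cauchy_weight (consX (s, v)))%:E =
    ((1 + s ^+ 2)^-1)%:E * \int[leb d]_v (cauchy_weight v)%:E)%E.
  rewrite -ge0_integralZl_EFin//;
    [|exact: mE|by have /andP[/ltW] := cauchy_factor s].
  apply: eq_integral => v _; rewrite -EFinM /cauchy_weight big_ord_recl/=.
  by congr (_ * _)%:E; apply: eq_bigr => i _; rewrite tnthS.
under eq_integral do rewrite step.
rewrite ge0_integralZr//.
- by apply: lte_mul_pinfty => //; rewrite ?ge0_fin_numE ?integral_ge0// => s _;
    rewrite lee_fin; have /andP[/ltW] := cauchy_factor s.
- by apply/measurable_EFinP; exact: measurable_cauchy_factor.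
- by move=> s _; rewrite lee_fin; have /andP[/ltW] := cauchy_factor s.
- by apply: integral_ge0.
Qed.

(** The step h enters the i-th factor through its i-th coordinate, which is at
    most |h|. *)
Lemma cauchy_weight_tame d m (x h : space R d) : enorm h <= 1 ->
  tame m (((m.+1)`!%:R ^+ 2) ^+ d * cauchy_weight x) (2 ^+ d * 2 * enorm h)
    (fun j => ((cauchy_weight (translate x j%:R h))%:C)%C).
Proof.
move=> h1; have nd (i : 'I_d) : `|tnth h i| <= enorm h.
  rewrite /enorm -sqrtr_sqr ler_wsqrtr// (bigD1 i)//= lerDl.
  by apply: sumr_ge0 => j _; exact: sqr_ge0.
have h0 : 0 <= enorm h by exact: sqrtr_ge0.
rewrite (_ : (fun j => _) = (fun j => \prod_(i < d)
    (((1 + (tnth x i + j%:R * tnth h i) ^+ 2)^-1)%:C)%C)); last first.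
  apply/funext => j; rewrite /cauchy_weight rmorph_prod; apply: eq_bigr => i _.
  by rewrite tnth_mktuple.
have -> : ((m.+1)`!%:R ^+ 2) ^+ d * cauchy_weight x =
    \prod_(i < d) ((m.+1)`!%:R ^+ 2 * (1 + tnth x i ^+ 2)^-1).
  by rewrite big_split/= prodr_const card_ord.
have D0 (i : 'I_d) : 0 <= (m.+1)`!%:R ^+ 2 * (1 + tnth x i ^+ 2)^-1.
  by rewrite mulr_ge0 ?sqr_ge0//; have /andP[/ltW] := cauchy_factor (tnth x i).
rewrite -mulrA; apply: tame_prod => //; first by rewrite mulr_ge0.
move=> i; have hi := le_trans (nd i) h1.
have e0 : 0 <= 2 * `|tnth h i : R| by rewrite mulr_ge0.
have e1 : 2 * `|tnth h i : R| <= 2 * enorm h by rewrite ler_pM2l.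
exact: (tame_mono (D0 i) (lexx _) e0 e1 (@tame_inv_quadratic R m (tnth x i) _ hi)).
Qed.

Lemma leb_neq0 d : leb d setT != 0 :> \bar R.
Proof.
have mI : measurable (`[(0 : R), 1]%classic : set (measurableTypeR R)) by exact: measurable_itv.
have E := @leb_box R d (fun=> `[(0 : R), 1]%classic) (fun=> mI).
apply/eqP => h0.
pose I01 : set R := `[(0 : R), 1]%classic.
have : (leb d (box I01 d) <= leb d setT)%E.
  by apply: le_measure; rewrite ?inE//; exact: measurable_box.
rewrite h0 (_ : leb d _ = 1%E) ?lee_fin ?ler10//.
transitivity (\prod_(i < d) lebesgue_measure I01)%E; first exact: E.
rewrite big1 // => i _.
by rewrite lebesgue_measure_itv/= lte_fin ltr01 oppr0 adde0.
Qed.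

Lemma leb_torusT d : @leb_torus R d setT = ((2 * pi) ^+ d)%:E :> \bar R.
Proof.
rewrite /leb_torus /mrestr setTI.
rewrite (_ : @cube R d = [set x | forall i, `[0, 2 * pi[%classic (tnth x i)]); last first.
  by apply/seteqP; split => x hx i; exact: hx.
rewrite (@leb_box R d (fun=> `[0, 2 * pi[%classic))//.
have pi2 : 0 < 2 * pi :> R by rewrite mulr_gt0 ?pi_gt0.
under eq_bigr do rewrite lebesgue_measure_itv/= lte_fin pi2 oppr0 adde0.
by rewrite prodEFin prodr_const card_ord.
Qed.

End weights.

(** * The two spaces *)

Section instances.
Context {R : realType} (d : nat).
Implicit Types (p : R).

Lemma space_tests p m : 1 <= p -> exists phi, test_family (leb d.+1) set0 p m phi.
Proof.
move=> p1; exists (modulated (@cauchy_weight R d.+1)).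
pose A : R := ((m.+1)`!%:R ^+ 2) ^+ d.+1; pose B : R := 2 ^+ d.+1 * 2.
have := @modulated_test_family R d (leb d.+1) set0 p (@leb_translation_invariant R d.+1) p1
  (@cauchy_weight R d.+1) m A B.
apply => //.
- by move=> x; have /andP[] := cauchy_weight_bounds x.
- apply: Lpi_weight => //.
  + exact: measurable_cauchy_weight.
  + exact: cauchy_weight_bounds.
  + exact: integral_cauchy_weight.
- exact: leb_neq0.
- by rewrite exprn_ge0// sqr_ge0.
- by rewrite mulr_ge0// exprn_ge0.
- by move=> x h h1; exact: cauchy_weight_tame.
Qed.

Lemma torus_tests p m : 1 <= p ->
  exists phi, test_family (@leb_torus R d.+1) (range unit_vector) p m phi.
Proof.
move=> p1; exists (modulated (fun=> 1)).
apply: (@modulated_test_family _ _ _ _ _ (@leb_torus_translation_invariant R d.+1) p1 _ m 1 0) => //.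
- apply: Lpi_weight => //; first by move=> x; rewrite ltr01 lexx.
  by rewrite integral_cst// mul1e -[X in (X < _)%E]/(@leb_torus R d.+1 setT) leb_torusT ltry.
- by rewrite -[X in X != _]/(@leb_torus R d.+1 setT) leb_torusT eqe gt_eqF// exprn_gt0// mulr_gt0// pi_gt0.
- by move=> v [i _ <-]; exists (i == ord0); rewrite tnth_mktuple.
- move=> x h _; rewrite mul0r mul1r; have := @tame_const R m ((1 : R)%:C)%C 0 (lexx _).
  by rewrite normc_real normr1.
Qed.

Lemma LipR_LipX (a b p : R) q : LipR d a b p q = LipX (leb d) set0 p a b q.
Proof.
apply/seteqP; split => f; first by case=> fX fq; split => //; split.
by case=> -[].
Qed.

Lemma LipT_LipX (a b p : R) q : LipT d a b p q = LipX (leb_torus (d := d)) (range unit_vector) p a b q.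
Proof.
apply/seteqP; split => f.
  by case=> per [fX fq]; split => //; split => // _ [i _ <-] x; exact: per.
by case=> -[fX per] fq; split => // i x; apply: per; exists i.
Qed.

End instances.

Theorem theorem9p6 (R : realType) (d : nat) (hd : (0 < d)%N)
    (p a0 a1 b0 b1 : R) (q0 q1 : \bar R)
    (hp : 1 < p) (ha0 : 0 < a0) (ha1 : 0 < a1)
    (hq0 : (0 < q0)%E) (hq1 : (0 < q1)%E)
    (hb0 : inv_exponent q0 < b0) (hb1 : inv_exponent q1 < b1) :
  let condition :=
    [\/ a1 < a0,
        a0 = a1 /\ b0 - inv_exponent q0 < b1 - inv_exponent q1
      | [/\ a0 = a1, b1 - inv_exponent q1 = b0 - inv_exponent q0
          & (q0 <= q1)%E]] in
  (continuous_inclusion (LipR d a0 b0 p q0) (LipR_qnorm d a0 b0 p q0)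
                        (LipR d a1 b1 p q1) (LipR_qnorm d a1 b1 p q1)
   <-> condition) /\
  (continuous_inclusion (LipT d a0 b0 p q0) (LipT_qnorm d a0 b0 p q0)
                        (LipT d a1 b1 p q1) (LipT_qnorm d a1 b1 p q1)
   <-> condition).
Proof.
move=> condition; case: d hd => // n _; have p1 := ltW hp; split.
  rewrite !LipR_LipX.
  exact: (embedding_characterization (@leb_translation_invariant R n.+1) p1
    (fun m => space_tests n m p1)).
rewrite !LipT_LipX.
exact: (embedding_characterization (@leb_torus_translation_invariant R n.+1) p1
  (fun m => torus_tests n m p1)).
Qed.
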